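(* Let $\lambda\in\mathbb R_{<0}$, $r>0$, $\Delta=\{(x,0)\in\mathbb C^2 : |x|<r\}$ and $\Delta^*=\{(x,0): 0<|x|<r\}$. For $i=1,2$ let $\mathcal F_i=\ker(\omega_i)$ with $$\omega_i=x\,dy-(\lambda+f_i(x,y))\,y\,dx,$$ where $f_i$ is holomorphic in a neighborhood of $\Delta$ in $\mathbb C^2$ and $f_i(x,0)\equiv0$. Assume that $\mathcal F_1$ and $\mathcal F_2$ have the same holonomy along the leaf $\Delta^*$. Then there exists an analytic diffeomorphism $\Phi$ between open neighborhoods of $\Delta$ in $\mathbb C^2$, of the form $\Phi(x,y)=(x,\,y+o(y))$, conjugating the foliations, i.e. $\Phi^*\omega_2\wedge\omega_1=0$.
   Context: $\mathrm{Diff}(\mathbb C,0)$ denotes the group of germs of analytic diffeomorphisms of $(\mathbb C,0)$. Holonomy: let $\mathcal F=\ker(\omega)$ with $\omega$ as in the claim; $\Delta^*$ is contained in a leaf of $\mathcal F$. Fix $p=(x_0,0)\in\Delta^*$ and a minimal first integral $H$ of $\mathcal F$ at $p$, i.e. a germ of holomorphic function at $p$ with $H(p)=0$, $dH(p)\ne0$ and $dH\wedge\omega=0$. Then $H$ can be continued analytically along any loop in $\Delta^*$ based at $p$. Continuing along the loop $\gamma(t)=(x_0e^{2i\pi t},0)$, $t\in[0,1]$, gives a minimal first integral $H^\gamma=\varphi\circ H$ with $\varphi\in\mathrm{Diff}(\mathbb C,0)$, called the monodromy of $H$. Replacing $H$ by another minimal first integral $\psi\circ H$, $\psi\in\mathrm{Diff}(\mathbb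 C,0)$, replaces $\varphi$ by $\psi\circ\varphi\circ\psi^{-1}$. The holonomy of $\mathcal F$ along $\Delta^*$ is the class of $\varphi$ up to conjugacy in $\mathrm{Diff}(\mathbb C,0)$ (or, by abuse of notation, a representative of this class).
   Formalization: With holonomies equal up to conjugacy in Diff(C,0), y+o(y) can fail (λ=-1, f1=-xy, f2=-2xy); proved instead: Φ(x,y)=(x, c y+o(y)), c≠0, with d(ψ∘H1)=c dH2 at p for the conjugating ψ, so c=1 exactly when these differentials agree. *)

(* Defs.v *)
From Stdlib Require Export Reals.
From Coquelicot Require Export Coquelicot.

Open Scope R_scope.

Definition C2 : NormedModule C_AbsRing :=
  prod_NormedModule C_AbsRing C_NormedModule C_NormedModule.

(* Differentials are taken over [C_AbsRing], so [ex_filterdiff] is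
   complex (Frechet) differentiability. *)
Definition holomorphic {E F : NormedModule C_AbsRing} (D : E -> Prop)
    (f : E -> F) : Prop :=
  forall p : E, D p -> ex_filterdiff f (locally p).

Definition Delta (r : R) (p : C2) : Prop :=
  Cmod (fst p) < r /\ snd p = RtoC 0.

(* Covectors are plain functions [C2 -> C], and a 1-form sends a point to a
   covector. *)
Definition wedge (alpha beta : C2 -> C) (u v : C2) : C :=
  (alpha u * beta v - alpha v * beta u)%C.

Definition omega (lambda : R) (f : C2 -> C) (p v : C2) : C :=
  (fst p * snd v - (RtoC lambda + f p) * snd p * fst v)%C.

(* Phi^* eta /\ theta = 0 on [V]: [w => eta (Phi p) (l w)], where [l] is the
   differential of [Phi] at [p], is the pull-back of [eta] at [p]. *)
Definition pullback_wedge_zero (V : C2 -> Prop) (Phi : C2 -> C2)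
    (eta theta : C2 -> C2 -> C) : Prop :=
  forall p : C2, V p ->
    exists l : C2 -> C2, filterdiff Phi (locally p) l /\
      forall u v : C2,
        wedge (fun w : C2 => eta (Phi p) (l w)) (theta p) u v = RtoC 0.

Definition analytic_diffeo (V W : C2 -> Prop) (Phi : C2 -> C2) : Prop :=
  open V /\ open W /\
  (forall p, V p -> W (Phi p)) /\ holomorphic V Phi /\
  exists Psi : C2 -> C2,
    (forall q, W q -> V (Psi q)) /\ holomorphic W Psi /\
    (forall p, V p -> Psi (Phi p) = p) /\ (forall q, W q -> Phi (Psi q) = q).

(* Germs are represented by total functions; only their values near the base
   point matter. *)
Definition germ_at0 (phi : C_NormedModule -> C_NormedModule) : Prop :=
  phi (RtoC 0) = RtoC 0 /\
  locally (T := C_NormedModule) (RtoC 0)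
    (fun z => ex_filterdiff phi (locally z)).

Definition inverse_germs (phi psi : C_NormedModule -> C_NormedModule) : Prop :=
  germ_at0 phi /\ germ_at0 psi /\
  locally (T := C_NormedModule) (RtoC 0) (fun z => psi (phi z) = z) /\
  locally (T := C_NormedModule) (RtoC 0) (fun z => phi (psi z) = z).

Definition Diff0 (phi : C_NormedModule -> C_NormedModule) : Prop :=
  exists psi, inverse_germs phi psi.

(* phi2 = psi o phi1 o psi^{-1} in Diff(C,0). *)
Definition conjugate_by (psi phi1 phi2 : C_NormedModule -> C_NormedModule)
    : Prop :=
  exists psi', inverse_germs psi psi' /\
    locally (T := C_NormedModule) (RtoC 0)
      (fun z => phi2 z = psi (phi1 (psi' z))).

Definition minimal_first_integral (eta : C2 -> C2 -> C) (p : C2)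
    (H : C2 -> C_NormedModule) : Prop :=
  H p = RtoC 0 /\
  (exists l : C2 -> C_NormedModule,
     filterdiff H (locally p) l /\ exists v : C2, l v <> RtoC 0) /\
  locally p (fun q : C2 =>
    exists l : C2 -> C_NormedModule, filterdiff H (locally q) l /\
      forall u v : C2, wedge l (eta q) u v = RtoC 0).

(* [H t] represents a germ at [gamma t]; for s near t the germ at [gamma s] is
   the one defined by the holomorphic function [H t]. *)
Definition continuation (gamma : R -> C2) (H : R -> C2 -> C_NormedModule)
    : Prop :=
  forall t : R, 0 <= t <= 1 ->
    exists U : C2 -> Prop, open U /\ U (gamma t) /\ holomorphic U (H t) /\
      locally t (fun s : R => 0 <= s <= 1 ->
        U (gamma s) /\ locally (gamma s) (fun q : C2 => H s q = H t q)).

Definition circle (x0 : C) (t : R) : C2 :=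
  ((x0 * (cos (2 * PI * t), sin (2 * PI * t)))%C, RtoC 0).

Definition base_point (x0 : C) : C2 := (x0, RtoC 0).

Definition monodromy (x0 : C) (H : C2 -> C_NormedModule)
    (phi : C_NormedModule -> C_NormedModule) : Prop :=
  exists Ht : R -> C2 -> C_NormedModule,
    continuation (circle x0) Ht /\
    locally (base_point x0) (fun q : C2 => Ht 0 q = H q) /\
    locally (base_point x0) (fun q : C2 => Ht 1 q = phi (H q)).

(* [phi] represents the holonomy along the punctured disc, computed with the
   minimal first integral [H] at [(x0, 0)]. *)
Definition holonomy (eta : C2 -> C2 -> C) (x0 : C)
    (H : C2 -> C_NormedModule) (phi : C_NormedModule -> C_NormedModule)
    : Prop :=
  minimal_first_integral eta (base_point x0) H /\
  Diff0 phi /\ monodromy x0 H phi.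

(* Phi(x,y) = (x, c y + o(y)); the o(y) is understood locally uniformly along
   the disc.

   The factor c cannot be dropped when holonomies are compared up to conjugacy
   in the whole of Diff(C,0): for lambda = -1, f1 = - x y and f2 = - 2 x y
   (conjugated by (x, y/2)), the first integrals u / (1 - u log x) and
   u / (1 - 2 u log x), u = x y, have the conjugate monodromies
   z / (1 - 2 i pi z) and z / (1 - 4 i pi z), but these are not conjugate by a
   germ tangent to the identity, so there is no Phi with c = 1. *)
Definition fibered_form (r : R) (V : C2 -> Prop) (Phi : C2 -> C2) (c : C)
    : Prop :=
  (forall p : C2, V p -> fst (Phi p) = fst p) /\
  (forall p : C2, Delta r p ->
     is_domin (U := C_NormedModule) (V := C_NormedModule) (locally p)
       (fun q : C2 => snd q) (fun q : C2 => (snd (Phi q) - c * snd q)%C)).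

(* Main.v *)
(* Put [s = log x]. The leaves near the disc are the solutions of an ODE in [s]
   whose linear part is [lambda]; parametrizing a leaf by its value [c] at a
   logarithm [s0] of the base point, a contraction gives charts
   [(s, c) |-> (s, y)] that are uniform as Re s tends to minus infinity because
   [lambda < 0]. In these charts the holonomy is the value of [c] at
   [(s0 + 2 i pi, y)], so the given conjugacy, read on the transversal, is a
   germ [h] conjugating the two holonomies. The map sending [y] on the fibre of
   [s] to the value at [s] of the second leaf with constant [h c] is therefore
   2 i pi-periodic in [s]. It descends to [x <> 0], is bounded by a multiple of
   [|y|], and so extends holomorphically across [x = 0]; exchanging the two
   foliations gives its inverse. *)

(* The domains of [f1] and [f2] may become arbitrarily thin near [|x| = r], so no single polydisc is
   available: every estimate is made on boxes [|x| < rho], [|y| < del] with constants independent of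
   the box. This is possible because the Lipschitz constant of [f] in [y], of order [1 / del], only
   ever meets [|y| < eta * del]. A leaf is sought as [c * exp (lambda (s - s0)) * exp u]; then
   [u' = f] and [|f|] is at most a multiple of [|c| exp (lambda Re (s - s0))], whose integral along
   the segment from [s0] to [s] is controlled by its two end values, however long the segment. The
   sign of [lambda] matters again on the way back: the linear flow does not contract as Re s tends
   to minus infinity, so a small [y] over [s] comes from a small [c]. Leaves, charts and local
   inverses are fixed points of contractions among bounded holomorphic functions, so holomorphy in
   the parameters comes together with existence. This rests on uniform limits being holomorphic,
   which follows from the Cauchy estimate on complex lines and so treats one and two variables
   alike. *)
Require Import Defs.
From Stdlib Require Import Lra Lia ssreflect Classical ClassicalEpsilon.

(** * Complex differentiability *)

(* [ring] and [field] need the carrier of the equation to be [C] itself. *)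
Ltac to_C := match goal with |- @eq _ ?a ?b => change (@eq C a b) end.
Ltac cring := to_C; ring.
Ltac cfield := to_C; field.

Lemma locally_norm_iff {K : AbsRing} {V : NormedModule K} (p : V) (P : V -> Prop) :
  locally p P <->
  exists d, 0 < d /\ forall q, norm (minus q p) < d -> P q.
Proof.
split.
- move=> H; case: (locally_norm_le_locally p P H) => d Hd.
  exists d; split; [apply cond_pos|exact Hd].
- move=> [d [Hd H]]; apply (locally_le_locally_norm p).
  by exists (mkposreal d Hd).
Qed.

Lemma plus_minus_l {G : AbelianGroup} (p v : G) : minus (plus p v) p = v.
Proof. by rewrite /minus (plus_comm p v) -plus_assoc plus_opp_r plus_zero_r. Qed.

Lemma plus_minus_eq {G : AbelianGroup} (p q : G) : plus p (minus q p) = q.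
Proof. by rewrite /minus (plus_comm q) plus_assoc plus_opp_r plus_zero_l. Qed.

Lemma filterdiff_eps {K : AbsRing} {E F : NormedModule K} (f : E -> F) (p : E) (l : E -> F) :
  filterdiff f (locally p) l <->
  is_linear l /\
  forall eps, 0 < eps -> exists d, 0 < d /\ forall v, norm v < d ->
    norm (minus (minus (f (plus p v)) (f p)) (l v)) <= eps * norm v.
Proof.
split.
- move=> [Hl H]; split=> // eps He.
  have := H p (fun P HP => HP) (mkposreal eps He).
  move/locally_norm_iff => [d [Hd Hq]]; exists d; split=> // v Hv.
  have := Hq (plus p v); rewrite plus_minus_l /=; by apply.
- move=> [Hl H]; split=> // x Hx.
  have <- : p = x by apply is_filter_lim_locally_unique.
  move=> eps; apply/locally_norm_iff.
  case: (H eps (cond_pos eps)) => d [Hd Hv]; exists d; split=> // q Hq.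
  have := Hv (minus q p) Hq; by rewrite plus_minus_eq.
Qed.

(** The values are typed in [C] and the module structure is mentioned only inside, so that complex
    arithmetic can be written on them. *)
Definition hol {E : NormedModule C_AbsRing} (f : E -> C) (p : E) : Prop :=
  ex_filterdiff (V := C_NormedModule) f (locally p).

(** [C] carries two normed module structures with the same operations and norm; the product rule is
    stated for one, the differentials here for the other. *)
Lemma is_linear_AbsRing_C {E : NormedModule C_AbsRing} (l : E -> C) :
  is_linear (V := C_NormedModule) l <->
  is_linear (V := AbsRing_NormedModule C_AbsRing) l.
Proof. by split; case=> H1 H2 H3; split. Qed.

Lemma filterdiff_mult_C {E : NormedModule C_AbsRing} (f g : E -> C_NormedModule)
    (p : E) (lf lg : E -> C_NormedModule) :
  filterdiff f (locally p) lf -> filterdiff g (locally p) lg ->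
  filterdiff (V := C_NormedModule) (fun q => (f q * g q)%C) (locally p)
    (fun v => (lf v * g p + f p * lg v)%C).
Proof.
move=> [/is_linear_AbsRing_C Hlf Hf] [/is_linear_AbsRing_C Hlg Hg].
have [/is_linear_AbsRing_C Hl H] :=
  filterdiff_mult_fct (K := C_AbsRing) f g p lf lg Cmult_comm
    (conj Hlf Hf) (conj Hlg Hg).
by split.
Qed.

Lemma filterdiff_plus_C {E : NormedModule C_AbsRing} (f g : E -> C_NormedModule)
    (p : E) (lf lg : E -> C_NormedModule) :
  filterdiff f (locally p) lf -> filterdiff g (locally p) lg ->
  filterdiff (V := C_NormedModule) (fun q => (f q + g q)%C) (locally p)
    (fun v => (lf v + lg v)%C).
Proof. exact: filterdiff_plus_fct. Qed.

Lemma filterdiff_minus_C {E : NormedModule C_AbsRing} (f g : E -> C_NormedModule)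
    (p : E) (lf lg : E -> C_NormedModule) :
  filterdiff f (locally p) lf -> filterdiff g (locally p) lg ->
  filterdiff (V := C_NormedModule) (fun q => (f q - g q)%C) (locally p)
    (fun v => (lf v - lg v)%C).
Proof. exact: filterdiff_minus_fct. Qed.

Lemma filterdiff_const_C {E : NormedModule C_AbsRing} (a : C) (p : E) :
  filterdiff (V := C_NormedModule) (fun _ : E => a) (locally p) (fun _ => RtoC 0).
Proof. exact: filterdiff_const. Qed.

Lemma is_linear_Cmult (a : C) :
  is_linear (U := C_NormedModule) (V := C_NormedModule) (fun z : C => (a * z)%C).
Proof.
split.
- move=> x y; change (a * (x + y) = a * x + a * y)%C; ring.
- move=> k x; change (a * (k * x) = k * (a * x))%C; ring.
- exists (Cmod a + 1); split; first by have := Cmod_ge_0 a; lra.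
  move=> x; change (Cmod (a * x) <= (Cmod a + 1) * Cmod x).
  rewrite Cmod_mult; have := Cmod_ge_0 x; have := Cmod_ge_0 a; nra.
Qed.

Lemma is_linear_C (l : C_NormedModule -> C_NormedModule) :
  is_linear l -> forall z, l z = (l (RtoC 1) * z)%C.
Proof.
move=> Hl z.
have := linear_scal l Hl z (RtoC 1).
rewrite /scal /= /mult /= Cmult_1_r => ->; ring.
Qed.

Definition cderiv (f : C -> C) (z l : C) : Prop :=
  filterdiff (U := C_NormedModule) (V := C_NormedModule) f
    (locally z) (fun v : C => (l * v)%C).

Lemma cderiv_eps (f : C -> C) (z l : C) :
  cderiv f z l <->
  forall eps, 0 < eps -> exists d, 0 < d /\ forall v, Cmod v < d ->
    Cmod (f (z + v) - f z - l * v)%C <= eps * Cmod v.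
Proof.
split.
- by move=> /filterdiff_eps [_ H].
- move=> H; apply/filterdiff_eps; split; [exact: is_linear_Cmult|exact: H].
Qed.

Lemma hol_cderiv (f : C -> C) (z : C) :
  hol (E := C_NormedModule) f z <-> exists l, cderiv f z l.
Proof.
split.
- move=> [l Hl]; exists (l (RtoC 1)).
  apply: filterdiff_ext_lin (Hl) _ => v; apply: is_linear_C.
  exact: (proj1 Hl).
- by move=> [l Hl]; eexists; exact Hl.
Qed.

Lemma hol_mult {E : NormedModule C_AbsRing} (f g : E -> C) p :
  hol f p -> hol g p -> hol (fun q => (f q * g q)%C) p.
Proof. by move=> [lf Hf] [lg Hg]; eexists; exact: filterdiff_mult_C Hf Hg. Qed.

Lemma hol_plus {E : NormedModule C_AbsRing} (f g : E -> C) p :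
  hol f p -> hol g p -> hol (fun q => (f q + g q)%C) p.
Proof. by move=> [lf Hf] [lg Hg]; eexists; exact: filterdiff_plus_C Hf Hg. Qed.

Lemma hol_minus {E : NormedModule C_AbsRing} (f g : E -> C) p :
  hol f p -> hol g p -> hol (fun q => (f q - g q)%C) p.
Proof. by move=> [lf Hf] [lg Hg]; eexists; exact: filterdiff_minus_C Hf Hg. Qed.

Lemma hol_const {E : NormedModule C_AbsRing} (a : C) (p : E) : hol (fun _ => a) p.
Proof. exact: ex_filterdiff_const. Qed.

Lemma hol_id (z : C) : hol (E := C_NormedModule) (fun w => w) z.
Proof. exact: ex_filterdiff_id. Qed.

Lemma hol_comp {E : NormedModule C_AbsRing} (g : C -> C) (f : E -> C) (p : E) :
  hol f p -> hol (E := C_NormedModule) g (f p) -> hol (fun q => g (f q)) p.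
Proof. exact: ex_filterdiff_comp'. Qed.

Lemma hol_ext_loc {E : NormedModule C_AbsRing} (f g : E -> C) (p : E) :
  locally p (fun q => f q = g q) -> hol f p -> hol g p.
Proof. exact: ex_filterdiff_ext_locally. Qed.

Lemma hol_continuous {E : NormedModule C_AbsRing} (f : E -> C) (p : E) :
  hol f p -> forall eps, 0 < eps ->
  exists d, 0 < d /\ forall q, norm (minus q p) < d -> Cmod (f q - f p) < eps.
Proof.
move=> H eps He.
have Hc := filterdiff_continuous _ _ H.
have : locally p (fun q => Cmod (f q - f p) < eps).
  apply: (Hc (fun z : C => Cmod (z - f p) < eps)).
  apply/locally_norm_iff; by exists eps.
by move/locally_norm_iff.
Qed.

Lemma Cmod_sub_rev (a b : C) : Cmod (a - b) = Cmod (b - a).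
Proof. by rewrite -Cmod_opp; congr Cmod; ring. Qed.

Lemma Cmod_triangle_inv (a b : C) : Cmod a - Cmod b <= Cmod (a - b).
Proof.
have := Cmod_triangle (a - b) b.
have -> : (a - b + b = a)%C by ring.
lra.
Qed.

Lemma Cmod_triangle_sub (a b : C) : Cmod (a - b) <= Cmod a + Cmod b.
Proof. by rewrite -(Cmod_opp b); exact: Cmod_triangle. Qed.

Lemma cderiv_inv (a : C) : a <> RtoC 0 -> cderiv Cinv a (- / (a * a))%C.
Proof.
move=> Ha; apply/cderiv_eps => eps He.
have Ha' : 0 < Cmod a by apply/Cmod_gt_0.
set m := Cmod a in Ha' *.
(* [|v| < m / 2] keeps [|a + v|] above [m / 2]; the remainder [v^2 / (a^2 (a + v))] is then at most
   [2 |v|^2 / m^3]. *)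
exists (Rmin (m / 2) (eps * m ^ 3 / 2)); split.
  apply: Rmin_pos; first lra.
  apply: Rdiv_lt_0_compat; last lra.
  by apply: Rmult_lt_0_compat => //; apply: pow_lt.
move=> v Hv.
have Hv1 : Cmod v < m / 2 by apply: Rlt_le_trans Hv (Rmin_l _ _).
have Hv2 : Cmod v < eps * m ^ 3 / 2 by apply: Rlt_le_trans Hv (Rmin_r _ _).
have Hav : m / 2 <= Cmod (a + v).
  have := Cmod_triangle_inv a (- v).
  rewrite Cmod_opp; have -> : (a - - v = a + v)%C by ring.
  by rewrite -/m; lra.
have Hav0 : (a + v)%C <> RtoC 0 by apply/Cmod_gt_0; lra.
have -> : (/ (a + v) - / a - - / (a * a) * v = v * v / (a * a * (a + v)))%C
  by field; split.
rewrite Cmod_div; last by repeat apply: Cmult_neq_0.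
rewrite !Cmod_mult -/m.
have Hm : 0 < m * m * Cmod (a + v) by repeat apply: Rmult_lt_0_compat; lra.
apply: (Rmult_le_reg_r (m * m * Cmod (a + v))) => //.
have -> : Cmod v * Cmod v / (m * m * Cmod (a + v)) * (m * m * Cmod (a + v)) = Cmod v * Cmod v
  by field; lra.
have H0 := Cmod_ge_0 v.
have : eps * (m * m * (m / 2)) <= eps * (m * m * Cmod (a + v)).
  apply: Rmult_le_compat_l; first lra.
  by apply: Rmult_le_compat_l => //; nra.
nra.
Qed.

Lemma hol_inv {E : NormedModule C_AbsRing} (f : E -> C) (p : E) :
  hol f p -> f p <> RtoC 0 -> hol (fun q => (/ f q)%C) p.
Proof.
move=> Hf H0; apply: hol_comp => //.
by apply/hol_cderiv; eexists; exact: cderiv_inv.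
Qed.

Lemma hol_div {E : NormedModule C_AbsRing} (f g : E -> C) (p : E) :
  hol f p -> hol g p -> g p <> RtoC 0 -> hol (fun q => (f q / g q)%C) p.
Proof. by move=> Hf Hg H0; apply: hol_mult => //; apply: hol_inv. Qed.

Lemma Cminus_diag (z : C) : (z - z = RtoC 0)%C.
Proof. ring. Qed.

Lemma Cminus_0_r (z : C) : (z - RtoC 0 = z)%C.
Proof. ring. Qed.

Lemma choice_on {A B : Type} (b0 : B) (D : A -> Prop) (P : A -> B -> Prop) :
  (forall a, D a -> exists b, P a b) -> exists F, forall a, D a -> P a (F a).
Proof.
move=> H; exists (fun a => epsilon (inhabits b0) (P a)) => a /H.
exact: epsilon_spec.
Qed.

(** * Complex-valued curves and the mean value inequality *)

Definition rderiv (phi : R -> C) (t : R) (d : C) : Prop :=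
  is_derive (fun t => fst (phi t)) t (fst d) /\
  is_derive (fun t => snd (phi t)) t (snd d).

Lemma is_derive_eps (g : R -> R) (t d : R) :
  is_derive g t d <->
  forall eps, 0 < eps -> exists del, 0 < del /\ forall h, Rabs h < del ->
    Rabs (g (t + h) - g t - h * d) <= eps * Rabs h.
Proof.
split.
- by move=> /filterdiff_eps [_ H].
- move=> H; apply/filterdiff_eps; split; last exact: H.
  exact: (is_linear_scal_l (K := R_AbsRing) (V := R_NormedModule) d).
Qed.

Lemma Rabs_fst_le_Cmod (z : C) : Rabs (fst z) <= Cmod z.
Proof. exact: Rle_trans (Rmax_l _ _) (Rmax_Cmod z). Qed.

Lemma Rabs_snd_le_Cmod (z : C) : Rabs (snd z) <= Cmod z.
Proof. exact: Rle_trans (Rmax_r _ _) (Rmax_Cmod z). Qed.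

Lemma rderiv_eps (phi : R -> C) (t : R) (d : C) :
  (forall eps, 0 < eps -> exists del, 0 < del /\ forall h, Rabs h < del ->
    Cmod (phi (t + h)%R - phi t - RtoC h * d)%C <= eps * Rabs h) ->
  rderiv phi t d.
Proof.
move=> H; split; apply/is_derive_eps => eps /H [del [Hdel Hh]];
  exists del; split=> // h /Hh; apply: Rle_trans.
- apply: Rle_trans (Rabs_fst_le_Cmod _) => /=; right; congr Rabs; ring.
- apply: Rle_trans (Rabs_snd_le_Cmod _) => /=; right; congr Rabs; ring.
Qed.

Lemma rderiv_line {E : NormedModule C_AbsRing} (f : E -> C_NormedModule)
    (p v : E) (t : R) (l : E -> C_NormedModule) :
  filterdiff f (locally (plus p (scal (RtoC t) v))) l ->
  rderiv (fun t => f (plus p (scal (RtoC t) v))) t (l v).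
Proof.
move=> /filterdiff_eps [Hl H]; apply: rderiv_eps => eps He.
have Hv := norm_ge_0 v.
have He' : 0 < eps / (norm v + 1) by apply: Rdiv_lt_0_compat => //; lra.
have [d [Hd Hh]] := H _ He'.
exists (d / (norm v + 1)); split; first by apply: Rdiv_lt_0_compat => //; lra.
move=> h Hh'.
have Hn : norm (scal (RtoC h) v) <= Rabs h * norm v.
  by apply: Rle_trans (norm_scal _ _) _; right; rewrite /abs /= Cmod_R.
have Ha := Rabs_pos h.
have Hn' : norm (scal (RtoC h) v) < d.
  apply: Rle_lt_trans Hn _.
  have : Rabs h * (norm v + 1) < d.
    apply: (Rmult_lt_reg_r (/ (norm v + 1))); first by apply: Rinv_0_lt_compat; lra.
    by rewrite Rmult_assoc Rinv_r ?Rmult_1_r //; lra.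
  nra.
have := Hh _ Hn'.
have -> : plus (plus p (scal (RtoC t) v)) (scal (RtoC h) v) = plus p (scal (RtoC (t + h)) v).
  by rewrite -plus_assoc -scal_distr_r RtoC_plus.
rewrite (linear_scal l Hl) => HH.
apply: Rle_trans HH _.
apply: Rle_trans (Rmult_le_compat_l _ _ _ (Rlt_le _ _ He') Hn) _.
have -> : eps / (norm v + 1) * (Rabs h * norm v) = eps * Rabs h * (norm v / (norm v + 1)).
  by field; lra.
rewrite -{2}(Rmult_1_r (eps * Rabs h)).
apply: Rmult_le_compat_l; first by apply: Rmult_le_pos; lra.
apply: (Rmult_le_reg_r (norm v + 1)); first lra.
by rewrite /Rdiv Rmult_assoc Rinv_l; lra.
Qed.

Lemma derive_nonneg_le (g dg : R -> R) (a b : R) :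
  a <= b -> (forall t, a <= t <= b -> is_derive g t (dg t)) ->
  (forall t, a <= t <= b -> 0 <= dg t) -> g a <= g b.
Proof.
move=> Hab Hd Hp.
have Hmm : forall t, Rmin a b <= t <= Rmax a b -> a <= t <= b.
  by move=> t; rewrite Rmin_left // Rmax_right.
case: (MVT_gen g a b dg).
- by move=> x Hx; apply: Hd; apply: Hmm; lra.
- move=> x Hx; apply/continuity_pt_filterlim.
  by apply: ex_derive_continuous; eexists; apply: Hd; apply: Hmm.
- move=> c [Hc Heq].
  have := Hp c (Hmm c Hc); nra.
Qed.

(** Project the curve on the direction [w = phi b - phi a]: the real function
    [M t * |w| - <w, phi t>] is nondecreasing by Cauchy-Schwarz, which gives
    [|w|^2 <= (M b - M a) |w|]. *)
Lemma mean_value_inequality (phi dphi : R -> C) (M dM : R -> R) (a b : R) :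
  a <= b ->
  (forall t, a <= t <= b -> rderiv phi t (dphi t)) ->
  (forall t, a <= t <= b -> is_derive M t (dM t)) ->
  (forall t, a <= t <= b -> Cmod (dphi t) <= dM t) ->
  Cmod (phi b - phi a) <= M b - M a.
Proof.
move=> Hab Hphi HM Hle.
set w := (phi b - phi a)%C.
have H0 : M a <= M b.
  apply: (derive_nonneg_le M dM) => // t Ht.
  exact: Rle_trans (Cmod_ge_0 _) (Hle t Ht).
case: (Req_dec (Cmod w) 0) => [->|Hw]; first lra.
have Hw0 := Cmod_ge_0 w.
pose g t := M t * Cmod w - (fst w * fst (phi t) + snd w * snd (phi t)).
have Hg : g a <= g b.
  apply: (derive_nonneg_le g
    (fun t => dM t * Cmod w - (fst w * fst (dphi t) + snd w * snd (dphi t)))) => //.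
  - move=> t Ht; have [H1 H2] := Hphi t Ht; have H3 := HM t Ht.
    apply: (is_derive_minus (K := R_AbsRing) (V := R_NormedModule)).
    + apply: is_derive_ext (is_derive_scal_l (K:=R_AbsRing) (V:=R_NormedModule) M t (dM t) (Cmod w) H3) => s //.
    + apply: (is_derive_plus (K := R_AbsRing) (V := R_NormedModule)).
      * exact: (is_derive_scal (fun t => fst (phi t)) t (fst w) _ H1).
      * exact: (is_derive_scal (fun t => snd (phi t)) t (snd w) _ H2).
  - move=> t Ht.
    have := Hle t Ht.
    have : fst w * fst (dphi t) + snd w * snd (dphi t) <= Cmod w * Cmod (dphi t).
      have := Rabs_fst_le_Cmod (Cconj w * dphi t)%C.
      rewrite Cmod_mult Cmod_conj /= => H.
      move: H => /(Rle_trans _ _ _ (Rle_abs _)); lra.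
    nra.
have Hw2 : Cmod w * Cmod w = fst w * fst w + snd w * snd w.
  have := Cmod2_alt w; rewrite /Re /Im; lra.
have : Cmod w * Cmod w <= (M b - M a) * Cmod w.
  move: Hg; rewrite /g Hw2 /w /=; lra.
nra.
Qed.

(** * The complex exponential *)

Definition Cexp (z : C) : C := (exp (fst z) * cos (snd z), exp (fst z) * sin (snd z)).

Lemma Cexp_plus (z w : C) : Cexp (z + w) = (Cexp z * Cexp w)%C.
Proof.
rewrite /Cexp /= exp_plus cos_plus sin_plus; apply: injective_projections => /=; ring.
Qed.

Lemma Cexp_0 : Cexp (RtoC 0) = RtoC 1.
Proof. by rewrite /Cexp /= exp_0 cos_0 sin_0; apply: injective_projections => /=; ring. Qed.

Lemma Cmod_Cexp (z : C) : Cmod (Cexp z) = exp (fst z).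
Proof.
rewrite /Cmod /Cexp /=.
have -> : exp (fst z) * cos (snd z) * (exp (fst z) * cos (snd z) * 1) +
  exp (fst z) * sin (snd z) * (exp (fst z) * sin (snd z) * 1) =
  (exp (fst z))² * ((sin (snd z))² + (cos (snd z))²) by rewrite /Rsqr; ring.
rewrite sin2_cos2 Rmult_1_r sqrt_Rsqr //; apply: Rlt_le; exact: exp_pos.
Qed.

Lemma Cexp_neq_0 (z : C) : Cexp z <> RtoC 0.
Proof. by apply/Cmod_gt_0; rewrite Cmod_Cexp; exact: exp_pos. Qed.

Lemma Cexp_opp (z : C) : Cexp (- z) = (/ Cexp z)%C.
Proof.
have H : (Cexp z * Cexp (- z) = RtoC 1)%C.
  by rewrite -Cexp_plus Cplus_opp_r Cexp_0.
have Hz := Cexp_neq_0 z.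
have -> : (Cexp (- z) = / Cexp z * (Cexp z * Cexp (- z)))%C by field.
by rewrite H Cmult_1_r.
Qed.

Lemma Cexp_minus (z w : C) : Cexp (z - w) = (Cexp z / Cexp w)%C.
Proof. by rewrite Cexp_plus Cexp_opp. Qed.

Lemma rderiv_Cexp (h : C) (t : R) :
  rderiv (fun t => Cexp (RtoC t * h)) t (h * Cexp (RtoC t * h))%C.
Proof. by rewrite /rderiv /Cexp /=; split; auto_derive=> //; rewrite /Rminus; ring. Qed.

Lemma fst_le_Cmod (z : C) : fst z <= Cmod z.
Proof. exact: Rle_trans (Rle_abs _) (Rabs_fst_le_Cmod z). Qed.

Lemma exp_le_exp (x y : R) : x <= y -> exp x <= exp y.
Proof. by case=> [H|->]; [left; exact: exp_increasing|right]. Qed.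

Lemma Cmod_Cexp_minus_1 (h : C) : Cmod (Cexp h - 1) <= Cmod h * exp (Cmod h).
Proof.
have := mean_value_inequality (fun t => Cexp (RtoC t * h))
  (fun t => h * Cexp (RtoC t * h))%C
  (fun t => t * (Cmod h * exp (Cmod h))) (fun _ => Cmod h * exp (Cmod h)) 0 1.
rewrite Cmult_0_l Cmult_1_l Cexp_0.
have H0 := Cmod_ge_0 h.
move=> H; apply: Rle_trans (H _ _ _ _) _; last lra.
- lra.
- move=> t _; exact: rderiv_Cexp.
- by move=> t _; auto_derive=> //; ring.
- move=> t Ht; rewrite Cmod_mult Cmod_Cexp; apply: Rmult_le_compat_l => //.
  apply: exp_le_exp => /=.
  have := fst_le_Cmod h; have := Rabs_fst_le_Cmod h; have := Rle_abs (- fst h).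
  rewrite Rabs_Ropp; nra.
Qed.

Lemma cderiv_Cexp (z : C) : cderiv Cexp z (Cexp z).
Proof.
(* Second order remainder at 0: the mean value inequality for [exp (t h) - t h], whose derivative
   [h (exp (t h) - 1)] is already quadratic in [h]. *)
have key : forall h, Cmod h <= 1 -> Cmod (Cexp h - 1 - h) <= exp 1 * Cmod h * Cmod h.
  move=> h Hh; have H0 := Cmod_ge_0 h.
  have := mean_value_inequality (fun t => Cexp (RtoC t * h) - RtoC t * h)%C
    (fun t => h * Cexp (RtoC t * h) - h)%C
    (fun t => t * (exp 1 * Cmod h * Cmod h)) (fun _ => exp 1 * Cmod h * Cmod h) 0 1.
  rewrite Cmult_0_l Cmult_1_l Cexp_0 => H.
  have -> : (Cexp h - 1 - h = Cexp h - h - (1 - 0))%C by ring.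
  apply: Rle_trans (H _ _ _ _) _; last lra.
  - lra.
  - by move=> t _; rewrite /rderiv /Cexp /=; split; auto_derive=> //; rewrite /Rminus; ring.
  - by move=> t _; auto_derive=> //; ring.
  - move=> t Ht.
    have -> : (h * Cexp (RtoC t * h) - h = h * (Cexp (RtoC t * h) - 1))%C by ring.
    rewrite Cmod_mult.
    have Hc := Cmod_Cexp_minus_1 (RtoC t * h).
    have Ht' : Cmod (RtoC t * h) <= Cmod h.
      rewrite Cmod_mult Cmod_R Rabs_pos_eq; [nra|lra].
    have He : exp (Cmod (RtoC t * h)) <= exp 1 by apply: exp_le_exp; lra.
    have Hp := exp_pos (Cmod (RtoC t * h)).
    have Ht0 := Cmod_ge_0 (RtoC t * h).
    have : Cmod (RtoC t * h) * exp (Cmod (RtoC t * h)) <= Cmod h * exp 1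
      by apply: Rmult_le_compat; lra.
    nra.
apply/cderiv_eps => eps He.
have He1 := exp_pos 1; have Hz := exp_pos (fst z).
have HK : 0 < exp (fst z) * exp 1 by nra.
exists (Rmin 1 (eps / (exp (fst z) * exp 1))); split.
  by apply: Rmin_pos; [lra|exact: Rdiv_lt_0_compat].
move=> v Hv.
have Hv1 := Rlt_le_trans _ _ _ Hv (Rmin_l _ _).
have Hv2 := Rlt_le_trans _ _ _ Hv (Rmin_r _ _).
have H0 := Cmod_ge_0 v.
have -> : (Cexp (z + v) - Cexp z - Cexp z * v = Cexp z * (Cexp v - 1 - v))%C.
  by rewrite Cexp_plus; ring.
rewrite Cmod_mult Cmod_Cexp.
have Hk := key v (Rlt_le _ _ Hv1).
have Hk2 : Cmod v * (exp (fst z) * exp 1) <= eps.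
  apply: (Rmult_le_reg_r (/ (exp (fst z) * exp 1))); first exact: Rinv_0_lt_compat.
  by rewrite Rmult_assoc Rinv_r ?Rmult_1_r; [left|lra].
apply: Rle_trans (Rmult_le_compat_l _ _ _ (Rlt_le _ _ Hz) Hk) _.
have -> : exp (fst z) * (exp 1 * Cmod v * Cmod v) = Cmod v * (exp (fst z) * exp 1) * Cmod v by ring.
exact: Rmult_le_compat_r.
Qed.

Lemma hol_Cexp {E : NormedModule C_AbsRing} (f : E -> C) (p : E) :
  hol f p -> hol (fun q => Cexp (f q)) p.
Proof.
move=> Hf; apply: hol_comp => //.
by apply/hol_cderiv; eexists; exact: cderiv_Cexp.
Qed.

(** * Goursat and Cauchy estimates *)

Lemma hol_continuous_horizontal (q : C -> C) (x y : R) :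
  hol (E := C_NormedModule) q (x, y) ->
  continuous (fun x => fst (q (x, y))) x /\ continuous (fun x => snd (q (x, y))) x.
Proof.
move=> H.
have Hc := filterdiff_continuous _ _ H.
have Hp : continuous (fun x : R => q (x, y)) x.
  apply: (continuous_comp_2 (U:=R_UniformSpace) (V:=R_UniformSpace) (fun x => x) (fun _ => y) (fun a b => q (a, b))).
  - exact: continuous_id.
  - exact: continuous_const.
  - apply: continuous_ext (Hc); by case.
split; apply: continuous_comp Hp _; [exact: continuous_fst|exact: continuous_snd].
Qed.

Lemma hol_continuous_vertical (q : C -> C) (x y : R) :
  hol (E := C_NormedModule) q (x, y) ->
  continuous (fun y => fst (q (x, y))) y /\ continuous (fun y => snd (q (x, y))) y.
Proof.
move=> H.
have Hc := filterdiff_continuous _ _ H.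
have Hp : continuous (fun y : R => q (x, y)) y.
  apply: (continuous_comp_2 (U:=R_UniformSpace) (V:=R_UniformSpace) (fun _ => x) (fun y => y) (fun a b => q (a, b))).
  - exact: continuous_const.
  - exact: continuous_id.
  - apply: continuous_ext (Hc); by case.
split; apply: continuous_comp Hp _; [exact: continuous_fst|exact: continuous_snd].
Qed.

Lemma RInt_add (f g h : R -> R) (a b : R) :
  (forall x, h x = f x + g x) -> ex_RInt f a b -> ex_RInt g a b ->
  RInt h a b = RInt f a b + RInt g a b.
Proof.
move=> He Hf Hg.
rewrite (RInt_ext h (fun x => plus (f x) (g x))); last by move=> x _; exact: He.
exact: (RInt_plus (V := R_CompleteNormedModule)).
Qed.

(* Imaginary part of the integral of [q] along the boundary of
   [a,b] x [c,d]. *)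
Definition boundary_int (q : C -> C) (a b c d : R) : R :=
  RInt (fun x => snd (q (x, c)) - snd (q (x, d))) a b +
  RInt (fun y => fst (q (b, y)) - fst (q (a, y))) c d.

Definition hol_rect (q : C -> C) (a b c d : R) : Prop :=
  forall x y, a <= x <= b -> c <= y <= d -> hol (E := C_NormedModule) q (x, y).

Lemma ex_RInt_horizontal (q : C -> C) (a b c d : R) :
  a <= b -> c <= d -> hol_rect q a b c d ->
  ex_RInt (fun x => snd (q (x, c)) - snd (q (x, d))) a b.
Proof.
move=> Hab Hcd H; apply: ex_RInt_continuous => x; rewrite Rmin_left // Rmax_right // => Hx.
apply: (continuous_minus (V := R_NormedModule));
  apply: (fun h => proj2 (hol_continuous_horizontal q _ _ h)); apply: H; lra.
Qed.

Lemma ex_RInt_vertical (q : C -> C) (a b c d : R) :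
  a <= b -> c <= d -> hol_rect q a b c d ->
  ex_RInt (fun y => fst (q (b, y)) - fst (q (a, y))) c d.
Proof.
move=> Hab Hcd H; apply: ex_RInt_continuous => x; rewrite Rmin_left // Rmax_right // => Hx.
apply: (continuous_minus (V := R_NormedModule));
  apply: (fun h => proj1 (hol_continuous_vertical q _ _ h)); apply: H; lra.
Qed.

Lemma hol_rect_sub (q : C -> C) (a b c d a' b' c' d' : R) :
  hol_rect q a b c d -> a <= a' -> b' <= b -> c <= c' -> d' <= d ->
  hol_rect q a' b' c' d'.
Proof. by move=> H ? ? ? ? x y ? ?; apply: H; lra. Qed.

Lemma boundary_int_split_x (q : C -> C) (a m b c d : R) :
  a <= m <= b -> c <= d -> hol_rect q a b c d ->
  boundary_int q a b c d = boundary_int q a m c d + boundary_int q m b c d.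
Proof.
move=> Hm Hcd H.
have H1 : hol_rect q a m c d by apply: hol_rect_sub H _ _ _ _; lra.
have H2 : hol_rect q m b c d by apply: hol_rect_sub H _ _ _ _; lra.
rewrite /boundary_int.
rewrite -(RInt_Chasles _ a m b);
  [|apply: ex_RInt_horizontal => //; lra|apply: ex_RInt_horizontal => //; lra].
have -> : RInt (fun y => fst (q (b, y)) - fst (q (a, y))) c d =
  RInt (fun y => fst (q (m, y)) - fst (q (a, y))) c d +
  RInt (fun y => fst (q (b, y)) - fst (q (m, y))) c d.
  apply: RInt_add.
  - by move=> x; ring.
  - by apply: ex_RInt_vertical => //; lra.
  - by apply: ex_RInt_vertical => //; lra.
by rewrite /plus /=; ring.
Qed.

Lemma boundary_int_split_y (q : C -> C) (a b c m d : R) :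
  a <= b -> c <= m <= d -> hol_rect q a b c d ->
  boundary_int q a b c d = boundary_int q a b c m + boundary_int q a b m d.
Proof.
move=> Hab Hm H.
have H1 : hol_rect q a b c m by apply: hol_rect_sub H _ _ _ _; lra.
have H2 : hol_rect q a b m d by apply: hol_rect_sub H _ _ _ _; lra.
rewrite /boundary_int.
rewrite -(RInt_Chasles _ c m d);
  [|apply: ex_RInt_vertical => //; lra|apply: ex_RInt_vertical => //; lra].
have -> : RInt (fun x => snd (q (x, c)) - snd (q (x, d))) a b =
  RInt (fun x => snd (q (x, c)) - snd (q (x, m))) a b +
  RInt (fun x => snd (q (x, m)) - snd (q (x, d))) a b.
  apply: RInt_add.
  - by move=> x; ring.
  - by apply: ex_RInt_horizontal => //; lra.
  - by apply: ex_RInt_horizontal => //; lra.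
by rewrite /plus /=; ring.
Qed.

Lemma Cmod_le_abs (x y : R) : Cmod (x, y) <= Rabs x + Rabs y.
Proof.
have -> : ((x, y) : C) = (RtoC x + Ci * RtoC y)%C.
  by apply: injective_projections => /=; ring.
apply: Rle_trans (Cmod_triangle _ _) _.
by rewrite Cmod_mult Cmod_Ci !Cmod_R; lra.
Qed.

(** An affine function has zero boundary integral: its slope contributes [- m (d - c)] to the first
    integrand and [m (b - a)] to the second, and these cancel after integration. Only the error
    term, at most [eps] times the half perimeter, is left. *)
Lemma boundary_int_small (q : C -> C) (a b c d : R) (p l : C) (eps : R) :
  a <= b -> c <= d -> hol_rect q a b c d -> 0 <= eps ->
  a <= fst p <= b -> c <= snd p <= d ->
  (forall w : C, a <= fst w <= b -> c <= snd w <= d ->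
     Cmod (q w - q p - l * (w - p))%C <= eps * Cmod (w - p)) ->
  Rabs (boundary_int q a b c d) <= 2 * eps * (b - a + (d - c)) * (b - a + (d - c)).
Proof.
move=> Hab Hcd H Heps Hp1 Hp2 Happ.
set s := b - a + (d - c).
have Hbd : forall w : C, a <= fst w <= b -> c <= snd w <= d ->
     Cmod (q w - q p - l * (w - p))%C <= eps * s.
  move=> w Hw1 Hw2; apply: Rle_trans (Happ w Hw1 Hw2) _.
  apply: Rmult_le_compat_l => //.
  apply: Rle_trans (Cmod_le_abs (fst (w - p)%C) (snd (w - p)%C)) _ => /=.
  rewrite /s; apply: Rplus_le_compat; apply: Rabs_le; lra.
have E1 := ex_RInt_horizontal q a b c d Hab Hcd H.
have E2 := ex_RInt_vertical q a b c d Hab Hcd H.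
set m := fst l.
have -> : boundary_int q a b c d =
  RInt (fun x => plus (snd (q (x, c)) - snd (q (x, d))) (m * (d - c))) a b +
  RInt (fun y => plus (fst (q (b, y)) - fst (q (a, y))) (- (m * (b - a)))) c d.
  have -> : RInt (fun x => plus (snd (q (x, c)) - snd (q (x, d))) (m * (d - c))) a b =
    RInt (fun x => snd (q (x, c)) - snd (q (x, d))) a b + RInt (fun _ => m * (d - c)) a b
    by apply: RInt_add => //; exact: ex_RInt_const.
  have -> : RInt (fun y => plus (fst (q (b, y)) - fst (q (a, y))) (- (m * (b - a)))) c d =
    RInt (fun y => fst (q (b, y)) - fst (q (a, y))) c d + RInt (fun _ => - (m * (b - a))) c d
    by apply: RInt_add => //; exact: ex_RInt_const.
  rewrite !RInt_const /boundary_int /scal /= /mult /=; ring.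
have F1 : Rabs (RInt (fun x => plus (snd (q (x, c)) - snd (q (x, d))) (m * (d - c))) a b)
  <= (b - a) * (2 * eps * s).
  apply: abs_RInt_le_const => //.
    apply: (ex_RInt_plus (V := R_NormedModule)) => //; exact: ex_RInt_const.
  move=> x Hx.
  have G1 := Hbd (x, c) Hx ltac:(simpl; lra).
  have G2 := Hbd (x, d) Hx ltac:(simpl; lra).
  have G3 := Rle_trans _ _ _ (Rabs_snd_le_Cmod _) G1.
  have G4 := Rle_trans _ _ _ (Rabs_snd_le_Cmod _) G2.
  move: G3 G4; rewrite /plus /=.
  move=> /Rabs_le_between G3 /Rabs_le_between G4; apply/Rabs_le_between; rewrite /m; lra.
have F2 : Rabs (RInt (fun y => plus (fst (q (b, y)) - fst (q (a, y))) (- (m * (b - a)))) c d)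
  <= (d - c) * (2 * eps * s).
  apply: abs_RInt_le_const => //.
    apply: (ex_RInt_plus (V := R_NormedModule)) => //; exact: ex_RInt_const.
  move=> x Hx.
  have G1 := Hbd (b, x) ltac:(simpl; lra) Hx.
  have G2 := Hbd (a, x) ltac:(simpl; lra) Hx.
  have G3 := Rle_trans _ _ _ (Rabs_fst_le_Cmod _) G1.
  have G4 := Rle_trans _ _ _ (Rabs_fst_le_Cmod _) G2.
  move: G3 G4; rewrite /plus /=.
  move=> /Rabs_le_between G3 /Rabs_le_between G4; apply/Rabs_le_between; rewrite /m; lra.
apply: Rle_trans (Rabs_triang _ _) _.
rewrite /s in F1 F2 *; lra.
Qed.

(* Goursat: repeated quartering. *)
Lemma boundary_int_zero (q : C -> C) (a b c d : R) :
  a <= b -> c <= d -> hol_rect q a b c d -> boundary_int q a b c d = 0.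
Proof.
move=> Hab Hcd H.
set h := b - a; set k := d - c.
pose J (p : R * R) (n : nat) :=
  boundary_int q (fst p) (fst p + h / 2 ^ n) (snd p) (snd p + k / 2 ^ n).
pose inside (p : R * R) (n : nat) :=
  a <= fst p /\ fst p + h / 2 ^ n <= b /\ c <= snd p /\ snd p + k / 2 ^ n <= d.
have Hh : 0 <= h by rewrite /h; lra.
have Hk : 0 <= k by rewrite /k; lra.
have Hpow : forall n, 0 < 2 ^ n by move=> n; apply: pow_lt; lra.
have Hhn : forall n, 0 <= h / 2 ^ n by move=> n; apply: Rdiv_le_0_compat.
have Hkn : forall n, 0 <= k / 2 ^ n by move=> n; apply: Rdiv_le_0_compat.
have hS : forall z n, z / 2 ^ n = 2 * (z / 2 ^ S n).
  by move=> z n /=; field; have := Hpow n; lra.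
pose good (p' p : R * R) (n : nat) :=
  fst p <= fst p' <= fst p + h / 2 ^ S n /\
  snd p <= snd p' <= snd p + k / 2 ^ S n /\
  Rabs (J p n) <= 4 * Rabs (J p' (S n)).
have step : forall p n, inside p n -> exists p', good p' p n.
  move=> [x y] n [/= I1 [I2 [I3 I4]]].
  have e1 := hS h n; have e2 := hS k n.
  have h1 := Hhn (S n); have k1 := Hkn (S n).
  rewrite e1 in I2; rewrite e2 in I4.
  set h' := h / 2 ^ S n in e1 h1 I2; set k' := k / 2 ^ S n in e2 k1 I4.
  have HR : hol_rect q x (x + 2 * h') y (y + 2 * k')
    by apply: hol_rect_sub H _ _ _ _.
  have HJ : J (x, y) n = J (x, y) (S n) + J (x, y + k') (S n) +
      (J (x + h', y) (S n) + J (x + h', y + k') (S n)).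
    rewrite /J /= -/(2 ^ S n) -/h' -/k' e1 e2.
    have HR1 : hol_rect q x (x + h') y (y + 2 * k') by apply: hol_rect_sub HR _ _ _ _; lra.
    have HR2 : hol_rect q (x + h') (x + 2 * h') y (y + 2 * k') by apply: hol_rect_sub HR _ _ _ _; lra.
    have S1 := boundary_int_split_x q x (x + h') (x + 2 * h') y (y + 2 * k')
      ltac:(lra) ltac:(lra) HR.
    have S2 := boundary_int_split_y q x (x + h') y (y + k') (y + 2 * k')
      ltac:(lra) ltac:(lra) HR1.
    have S3 := boundary_int_split_y q (x + h') (x + 2 * h') y (y + k') (y + 2 * k')
      ltac:(lra) ltac:(lra) HR2.
    have -> : x + h' + h' = x + 2 * h' by ring.
    have -> : y + k' + k' = y + 2 * k' by ring.
    lra.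
  apply: NNPP => Hno.
  (* If every quarter carried less than a fourth of the modulus, the four pieces could not add up to
     [J (x, y) n]. *)
  have A : forall u v, (u = 0 \/ u = h') -> (v = 0 \/ v = k') ->
      4 * Rabs (J (x + u, y + v) (S n)) < Rabs (J (x, y) n).
    move=> u v Hu Hv; apply: Rnot_le_lt => Hle; apply: Hno.
    exists (x + u, y + v); rewrite /good [fst (_, _)]/= [snd (_, _)]/= -/h' -/k'.
    change (x <= x + u <= x + h' /\ y <= y + v <= y + k' /\ Rabs (J (x, y) n) <= 4 * Rabs (J (x + u, y + v) (S n))).    split; first by case: Hu => ->; lra.
    by split; first by case: Hv => ->; lra.
  have A1 := A 0 0 (or_introl eq_refl) (or_introl eq_refl).
  have A2 := A 0 k' (or_introl eq_refl) (or_intror eq_refl).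
  have A3 := A h' 0 (or_intror eq_refl) (or_introl eq_refl).
  have A4 := A h' k' (or_intror eq_refl) (or_intror eq_refl).
  rewrite !Rplus_0_r in A1 A2 A3.
  have := Rabs_triang (J (x, y) (S n) + J (x, y + k') (S n))
    (J (x + h', y) (S n) + J (x + h', y + k') (S n)).
  have := Rabs_triang (J (x, y) (S n)) (J (x, y + k') (S n)).
  have := Rabs_triang (J (x + h', y) (S n)) (J (x + h', y + k') (S n)).
  rewrite -HJ; lra.
pose next p n := ClassicalEpsilon.epsilon (inhabits p) (fun p' => good p' p n).
have Hnext : forall p n, inside p n -> good (next p n) p n.
  move=> p n /step; exact: ClassicalEpsilon.epsilon_spec.
pose s := fix s n := match n with O => (a, c) | S n => next (s n) n end.
have Hs : forall n, inside (s n) n /\ good (s (S n)) (s n) n.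
  have Hin : forall n, inside (s n) n.
    elim=> [|n IH].
      by rewrite /inside /= /h /k; repeat split; lra.
    have [G1 [G2 _]] := Hnext _ _ IH.
    have e1 := hS h n; have e2 := hS k n.
    have := Hhn (S n); have := Hkn (S n).
    move: IH; rewrite /inside -/(s (S n)) => [[? [? [? ?]]]].
    rewrite -/(s (S n)) in G1 G2.
    change (next (s n) n) with (s (S n)) in *.
    by repeat split; lra.
  by move=> n; split=> //; apply: Hnext.
have HJn : forall n, Rabs (J (s O) O) <= 4 ^ n * Rabs (J (s n) n).
  elim=> [|n IH]; first by rewrite /= Rmult_1_l; lra.
  have [_ [_ [_ G]]] := Hs n.
  apply: Rle_trans IH _ => /=.
  have : 0 < 4 ^ n by apply: pow_lt; lra.
  simpl in G; nra.
have lim : forall (u : nat -> R) (w : R), 0 <= w ->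
    (forall n, u n <= u (S n) <= u n + w / 2 ^ S n) ->
    exists X, forall n, u n <= X <= u n + w / 2 ^ n.
  move=> u w Hw Hu.
  have mono : forall m n, u n <= u (n + m)%nat.
    elim=> [|m IH] n; first by rewrite Nat.add_0_r; lra.
    rewrite Nat.add_succ_r; have := IH n; have := Hu (n + m)%nat; lra.
  have dec : forall m n, u (n + m)%nat + w / 2 ^ (n + m) <= u n + w / 2 ^ n.
    elim=> [|m IH] n; first by rewrite Nat.add_0_r; lra.
    rewrite Nat.add_succ_r; have := IH n; have := Hu (n + m)%nat.
    have := hS w (n + m)%nat; lra.
  have wn : forall n, 0 <= w / 2 ^ n by move=> n; apply: Rdiv_le_0_compat.
  have ub : forall m n, u m <= u n + w / 2 ^ n.
    move=> m n; case: (Nat.le_ge_cases m n) => Hmn.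
    - have := mono (n - m)%nat m; rewrite (Nat.add_comm m) Nat.sub_add //.
      have := wn n; lra.
    - have := dec (m - n)%nat n; rewrite (Nat.add_comm n) Nat.sub_add //.
      have := wn m; lra.
  case: (completeness (fun x => exists n, x = u n)).
  - by exists (u O + w / 2 ^ O) => x [n ->].
  - by exists (u O); exists O.
  - move=> X [HX1 HX2]; exists X => n; split.
    + by apply: HX1; exists n.
    + by apply: HX2 => x [m ->].
have [X HX] := lim (fun n => fst (s n)) h Hh (fun n => proj1 (proj2 (Hs n))).
have [Y HY] := lim (fun n => snd (s n)) k Hk (fun n => proj1 (proj2 (proj2 (Hs n)))).
have HXY : hol (E := C_NormedModule) q (X, Y).
  apply: H.
  - by have := HX O; rewrite /= /h; lra.
  - by have := HY O; rewrite /= /k; lra.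
case/hol_cderiv: HXY => l /cderiv_eps Hl.
have J0 : J (s O) O = boundary_int q a b c d.
  by rewrite /J /= /h /k; congr boundary_int; field.
apply: NNPP => Hne.
have Hpos : 0 < Rabs (boundary_int q a b c d) by apply: Rabs_pos_lt.
set S0 := h + k.
have HS0 : 0 <= S0 by rewrite /S0; lra.
(* The rectangle of generation [n] has integral at most [2 eps (S0 / 2^n)^2] and at least [4^-n]
   times the total, so the total would be at most [2 eps S0^2], less than half of itself; [+ 1]
   allows [S0 = 0]. *)
pose eps := Rabs (boundary_int q a b c d) / (4 * (S0 * S0 + 1)).
have Heps : 0 < eps by apply: Rdiv_lt_0_compat => //; nra.
have [del [Hdel Hv]] := Hl eps Heps.
have [n Hn] : exists n, S0 / 2 ^ n < del.
  have [N HN] := Pow_x_infinity 2 ltac:(rewrite Rabs_pos_eq; lra) ((S0 + 1) / del).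
  exists N.
  have := HN N (Nat.le_refl N); rewrite Rabs_pos_eq; last by left.
  move=> Hge.
  apply: (Rmult_lt_reg_r (2 ^ N)) => //.
  have -> : S0 / 2 ^ N * 2 ^ N = S0 by field; have := Hpow N; lra.
  have : (S0 + 1) / del * del <= 2 ^ N * del by apply: Rmult_le_compat_r; lra.
  have -> : (S0 + 1) / del * del = S0 + 1 by field; lra.
  lra.
have Hsum : h / 2 ^ n + k / 2 ^ n = S0 / 2 ^ n by rewrite /S0; field; have := Hpow n; lra.
have [[I1 [I2 [I3 I4]]] _] := Hs n.
have := boundary_int_small q (fst (s n)) (fst (s n) + h / 2 ^ n) (snd (s n)) (snd (s n) + k / 2 ^ n)
  (X, Y) l eps.
rewrite -/(J (s n) n) => HB.
have hn := Hhn n; have kn := Hkn n.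
have {}HB : Rabs (J (s n) n) <= 2 * eps * (S0 / 2 ^ n) * (S0 / 2 ^ n).
  rewrite -Hsum.
  have -> : h / 2 ^ n + k / 2 ^ n =
    fst (s n) + h / 2 ^ n - fst (s n) + (snd (s n) + k / 2 ^ n - snd (s n)) by ring.
  apply: HB; try lra.
  - by apply: hol_rect_sub H _ _ _ _.
  - exact: HX.
  - exact: HY.
  - move=> w Hw1 Hw2.
    have := Hv (w - (X, Y))%C.
    have -> : ((X, Y) + (w - (X, Y)) = w)%C by ring.
    apply.
    apply: Rle_lt_trans (Cmod_le_abs (fst (w - (X, Y))%C) (snd (w - (X, Y))%C)) _ => /=.
    apply: Rle_lt_trans Hn; rewrite -Hsum.
    have := HX n; have := HY n => HYn HXn.
    by apply: Rplus_le_compat; apply: Rabs_le; lra.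
have := HJn n; rewrite J0.
have -> : 4 ^ n = 2 ^ n * 2 ^ n by rewrite -Rpow_mult_distr; congr pow; ring.
have P2 := Hpow n.
have : 2 ^ n * 2 ^ n * Rabs (J (s n) n) <= 2 ^ n * 2 ^ n * (2 * eps * (S0 / 2 ^ n) * (S0 / 2 ^ n)).
  by apply: Rmult_le_compat_l => //; nra.
have -> : 2 ^ n * 2 ^ n * (2 * eps * (S0 / 2 ^ n) * (S0 / 2 ^ n)) = 2 * eps * (S0 * S0)
  by field; lra.
have : 2 * eps * (S0 * S0) < Rabs (boundary_int q a b c d).
  rewrite /eps; set B := Rabs _ in Hpos *.
  have -> : 2 * (B / (4 * (S0 * S0 + 1))) * (S0 * S0) = B * ((S0 * S0) / (2 * (S0 * S0 + 1)))
    by field; nra.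
  rewrite -{2}(Rmult_1_r B); apply: Rmult_lt_compat_l => //.
  apply: (Rmult_lt_reg_r (2 * (S0 * S0 + 1))); first nra.
  by rewrite /Rdiv Rmult_assoc Rinv_l; nra.
lra.
Qed.

Lemma Cexp_periodic (x y : R) : Cexp (x, y + 2 * PI) = Cexp (x, y).
Proof. by rewrite /Cexp /= cos_plus sin_plus cos_2PI sin_2PI; congr pair; ring. Qed.

(* The function [w => q (z + exp w)] is 2 i pi-periodic, so by Goursat the mean
   of [q] over the circles centred at [z] does not depend on the radius. *)
Lemma center_limit_bound (q : C -> C) (z l : C) (r rho M : R) :
  0 < rho < r ->
  (forall w : C, 0 < Cmod (w - z) < r -> hol (E := C_NormedModule) q w) ->
  (forall eps, 0 < eps -> exists d, 0 < d /\
     forall w : C, 0 < Cmod (w - z) < d -> Cmod (q w - l) < eps) ->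
  (forall w : C, Cmod (w - z) = rho -> Cmod (q w) <= M) ->
  Cmod l <= M.
Proof.
move=> Hrho Hq Hlim Hcirc.
apply: Rnot_lt_le => Hlt.
set L := Cmod l in Hlt *.
have HM : 0 <= M.
  apply: Rle_trans (Cmod_ge_0 _) (Hcirc (z + RtoC rho)%C _).
  have -> : (z + RtoC rho - z = RtoC rho)%C by ring.
  by rewrite Cmod_R Rabs_pos_eq; lra.
have [d [Hd Hld]] := Hlim ((L - M) / 2) ltac:(lra).
(* The factor [Cconj l] turns moduli into real parts: near [z] the real part of [Q] is close to
   [|l|^2], on the circle of radius [rho] it is at most [|l| M], and Goursat equates the two
   means. *)
pose Q (w : C) : C := (Cconj l * q (z + Cexp w)%C)%C.
pose u := ln (Rmin rho (d / 2)).
have Hm : 0 < Rmin rho (d / 2) by apply: Rmin_pos; lra.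
have Hu : u <= ln rho.
  have [H|H] : Rmin rho (d / 2) < rho \/ Rmin rho (d / 2) = rho
    by have := Rmin_l rho (d / 2); lra.
  - by left; apply: ln_increasing.
  - by right; rewrite /u H.
have Hmod : forall w : C, Cmod (z + Cexp w - z) = exp (fst w).
  move=> w; have -> : (z + Cexp w - z = Cexp w)%C by ring.
  exact: Cmod_Cexp.
have HQ : hol_rect Q u (ln rho) 0 (2 * PI).
  move=> x y Hx _.
  apply: hol_mult; first exact: hol_const.
  apply: (hol_comp (E := C_NormedModule) q).
    apply: hol_plus; first exact: hol_const.
    by apply: hol_Cexp; exact: hol_id.
  apply: Hq; rewrite Hmod /=; split; first exact: exp_pos.
  apply: Rle_lt_trans (exp_le_exp _ _ (proj2 Hx)) _.
  by rewrite exp_ln; lra.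
have HPI := PI_RGT_0.
have H0 := boundary_int_zero Q u (ln rho) 0 (2 * PI) Hu ltac:(lra) HQ.
move: H0; rewrite /boundary_int.
(* The horizontal sides cancel by periodicity of the exponential. *)
rewrite (RInt_ext (fun x => snd (Q (x, 0)) - snd (Q (x, 2 * PI))) (fun _ => 0)); last first.
  move=> x _; rewrite /Q.
  have -> : Cexp (x, 2 * PI) = Cexp (x, 0) by rewrite -(Cexp_periodic x 0) Rplus_0_l.
  by rewrite Rminus_diag.
rewrite RInt_const scal_zero_r Rplus_0_l => H0.
have Hb : forall y, 0 < y < 2 * PI ->
    fst (Q (ln rho, y)) - fst (Q (u, y)) <= L * ((M - L) / 2).
  move=> y _.
  have E1 : fst (Q (ln rho, y)) <= L * M.
    apply: Rle_trans (fst_le_Cmod _) _.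
    rewrite /Q Cmod_mult Cmod_conj -/L; apply: Rmult_le_compat_l; first exact: Cmod_ge_0.
    by apply: Hcirc; rewrite Hmod /= exp_ln; lra.
  have E2 : L * L - L * ((L - M) / 2) <= fst (Q (u, y)).
    have G : Cmod (q (z + Cexp (u, y))%C - l) < (L - M) / 2.
      apply: Hld; rewrite Hmod /= /u exp_ln //; split=> //.
      by have := Rmin_r rho (d / 2); lra.
    have E : Q (u, y) = (RtoC (L * L) - Cconj l * (l - q (z + Cexp (u, y))%C))%C.
      have -> : L * L = L ^ 2 by ring.
      by rewrite Cmod2_conj /Q; ring.
    rewrite E.
    have := fst_le_Cmod (Cconj l * (l - q (z + Cexp (u, y))%C))%C.
    rewrite Cmod_mult Cmod_conj -/L Cmod_sub_rev => G1.
    have L0 : 0 <= L by exact: Cmod_ge_0.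
    have : L * Cmod (q (z + Cexp (u, y))%C - l) <= L * ((L - M) / 2)
      by apply: Rmult_le_compat_l => //; lra.
    move: G1; set A := (Cconj l * (l - q (z + Cexp (u, y))%C))%C => G1.
    by have -> : fst (RtoC (L * L) - A)%C = L * L - fst A by []; lra.
  lra.
have := RInt_le _ (fun _ => L * ((M - L) / 2)) 0 (2 * PI) ltac:(lra)
  (ex_RInt_vertical Q u (ln rho) 0 (2 * PI) Hu ltac:(lra) HQ)
  (ex_RInt_const 0 (2 * PI) _) Hb.
have : 0 < PI * (L * (L - M)) by apply: Rmult_lt_0_compat => //; apply: Rmult_lt_0_compat; lra.
by rewrite H0 RInt_const /scal /= /mult /=; lra.
Qed.

(** The difference quotient has limit [l] at [z] and is at most [2 M / (r / 2)] on the circle of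
    radius [r / 2]. *)
Lemma cauchy_estimate (f : C -> C) (z l : C) (r M : R) :
  0 < r ->
  (forall w : C, Cmod (w - z) < r -> hol (E := C_NormedModule) f w) ->
  (forall w : C, Cmod (w - z) < r -> Cmod (f w) <= M) ->
  cderiv f z l -> Cmod l <= 4 * M / r.
Proof.
move=> HR Hf HM /cderiv_eps Hl.
apply: (center_limit_bound (fun w => (f w - f z) / (w - z))%C z l r (r / 2)); first lra.
- move=> w Hw; apply: hol_div.
  + by apply: hol_minus; [apply: Hf; lra|exact: hol_const].
  + by apply: hol_minus; [exact: hol_id|exact: hol_const].
  + by apply/Cmod_gt_0; lra.
- move=> eps He; have [d [Hd H]] := Hl (eps / 2) ltac:(lra).
  exists d; split=> // w Hw.
  have Hw0 : (w - z)%C <> RtoC 0 by apply/Cmod_gt_0; lra.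
  have := H (w - z)%C (proj2 Hw).
  have -> : (z + (w - z) = w)%C by ring.
  have -> : ((f w - f z) / (w - z) - l = (f w - f z - l * (w - z)) / (w - z))%C by field.
  rewrite Cmod_div // => H1.
  apply: (Rmult_lt_reg_r (Cmod (w - z))); first lra.
  rewrite /Rdiv Rmult_assoc Rinv_l; nra.
- move=> w Hw.
  have Hw0 : (w - z)%C <> RtoC 0 by apply/Cmod_gt_0; lra.
  rewrite Cmod_div // Hw.
  have := Cmod_triangle_sub (f w) (f z).
  have := HM w ltac:(lra).
  have := HM z ltac:(rewrite Cminus_diag Cmod_0; lra).
  move=> H1 H2 H3.
  apply: (Rmult_le_reg_r (r / 2)); first lra.
  have -> : Cmod (f w - f z) / (r / 2) * (r / 2) = Cmod (f w - f z) by field; lra.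
  have -> : 4 * M / r * (r / 2) = 2 * M by field; lra.
  lra.
Qed.

(** * Cauchy estimates and uniform limits in normed modules *)

Definition nball {E : NormedModule C_AbsRing} (p : E) (r : R) (q : E) : Prop :=
  norm (minus q p) < r.

Lemma nball_center {E : NormedModule C_AbsRing} (p : E) (r : R) : 0 < r -> nball p r p.
Proof. by rewrite /nball minus_eq_zero norm_zero. Qed.

Lemma nball_plus {E : NormedModule C_AbsRing} (p q v : E) (r s : R) :
  nball p r q -> norm v <= s -> nball p (r + s) (plus q v).
Proof.
rewrite /nball => H1 H2.
have -> : minus (plus q v) p = plus (minus q p) v.
  by rewrite /minus -!plus_assoc (plus_comm v).
apply: Rle_lt_trans (norm_triangle _ _) _; lra.
Qed.

Lemma nball_le {E : NormedModule C_AbsRing} (p q : E) (r s : R) :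
  nball p r q -> r <= s -> nball p s q.
Proof. rewrite /nball; lra. Qed.

Lemma nball_nball {E : NormedModule C_AbsRing} (p q w : E) (r s t : R) :
  nball p r q -> nball q s w -> r + s <= t -> nball p t w.
Proof.
move=> H1 H2 H3; rewrite -(plus_minus_eq q w).
by apply: nball_le (H3); apply: nball_plus => //; left.
Qed.

Lemma locally_nball {E : NormedModule C_AbsRing} (p : E) (P : E -> Prop) :
  locally p P <-> exists r, 0 < r /\ forall q, nball p r q -> P q.
Proof. exact: locally_norm_iff. Qed.

Lemma norm_scal_C {E : NormedModule C_AbsRing} (a : C) (v : E) :
  norm (scal a v) <= Cmod a * norm v.
Proof. exact: norm_scal. Qed.

Lemma norm_scal_R {E : NormedModule C_AbsRing} (t : R) (v : E) :
  norm (scal (RtoC t) v) <= Rabs t * norm v.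
Proof. by rewrite -Cmod_R; exact: norm_scal. Qed.

Lemma nball_segment {E : NormedModule C_AbsRing} (p q q' : E) (r t : R) :
  nball p r q -> nball p r q' -> 0 <= t <= 1 ->
  nball p r (plus q (scal (RtoC t) (minus q' q))).
Proof.
rewrite /nball => H1 H2 Ht.
have -> : minus (plus q (scal (RtoC t) (minus q' q))) p =
  plus (scal (RtoC (1 - t)) (minus q p)) (scal (RtoC t) (minus q' p)).
  have {1}-> : q = plus p (minus q p) by rewrite plus_minus_eq.
  have -> : minus q' q = minus (minus q' p) (minus q p).
    by rewrite /minus opp_plus opp_opp -plus_assoc (plus_assoc (opp p)) (plus_comm (opp p)) -(plus_assoc (opp q)) plus_opp_l plus_zero_r.
  set a := minus q p; set b := minus q' p.
  rewrite -plus_assoc plus_minus_l RtoC_minus.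
  change (RtoC 1 - RtoC t)%C with (minus (one : C_AbsRing) (RtoC t)).
  rewrite (scal_minus_distr_r (K := C_AbsRing)) scal_one /minus scal_distr_l scal_opp_r.
  by rewrite -!plus_assoc; rewrite (plus_comm (scal (RtoC t) b)).
apply: Rle_lt_trans (norm_triangle _ _) _.
have := norm_scal_R (1 - t) (minus q p).
have := norm_scal_R t (minus q' p).
rewrite !Rabs_pos_eq; [|lra|lra].
case: (Req_dec t 0) => [->|Ht0]; nra.
Qed.

Lemma hol_line {E : NormedModule C_AbsRing} (f : E -> C) (p v : E) (z : C) l :
  filterdiff (V := C_NormedModule) f (locally (plus p (scal z v))) l ->
  cderiv (fun z => f (plus p (scal z v))) z (l v).
Proof.
move=> Hl.
have Hlin := proj1 Hl.
have Hin : filterdiff (U := C_NormedModule) (fun z : C => plus p (scal z v)) (locally z)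
    (fun h : C => scal h v).
  apply/filterdiff_eps; split.
  - split.
    + move=> x y; exact: scal_distr_r.
    + move=> k x; by rewrite scal_assoc.
    + exists (norm v + 1); have := norm_ge_0 v; split; first lra.
      move=> x; have := norm_scal_C x v; rewrite /norm /= -/(norm _).
      have := Cmod_ge_0 x; rewrite -/norm => h1 h2.
      apply: Rle_trans h2 _; rewrite -/norm; nra.
  - move=> eps He; exists 1; split; first lra.
    move=> h _.
    have -> : minus (minus (plus p (scal (plus z h) v)) (plus p (scal z v))) (scal h v) = zero.
      rewrite scal_distr_r plus_assoc plus_minus_l; exact: minus_eq_zero.
    rewrite norm_zero; apply: Rmult_le_pos; [lra|exact: norm_ge_0].
have := filterdiff_comp' (U := C_NormedModule) _ _ z _ _ Hin Hl.
move=> HH; apply: (filterdiff_ext_lin _ _ _ HH) => h /=.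
by rewrite (linear_scal l Hlin) Cmult_comm.
Qed.

Definition hol_on {E : NormedModule C_AbsRing} (f : E -> C) (p : E) (r M : R) : Prop :=
  forall q, nball p r q -> hol f q /\ Cmod (f q) <= M.

Lemma hol_on_ge_0 {E : NormedModule C_AbsRing} (f : E -> C) (p : E) (r M : R) :
  0 < r -> hol_on f p r M -> 0 <= M.
Proof.
move=> HR H; exact: Rle_trans (Cmod_ge_0 _) (proj2 (H p (nball_center p r HR))).
Qed.

(** On the complex line through [p] directed by [v] this is the one variable estimate on a disc of
    radius [r / |v|]; nothing depends on the dimension of [E]. *)
Lemma cauchy_estimate_dir {E : NormedModule C_AbsRing} (f : E -> C) (p v : E) l (r M : R) :
  0 < r -> hol_on f p r M ->
  filterdiff (V := C_NormedModule) f (locally p) l ->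
  Cmod (l v) <= 4 * M / r * norm v.
Proof.
move=> HR Hf Hl.
have HM := hol_on_ge_0 f p r M HR Hf.
have Hv := norm_ge_0 v.
case: (Req_dec (norm v) 0) => Hv0.
  have -> : l v = RtoC 0.
    by rewrite (norm_eq_zero _ Hv0); exact: linear_zero (proj1 Hl).
  rewrite Cmod_0 Hv0; lra.
have Hin : forall w : C, Cmod (w - 0) < r / norm v -> nball p r (plus p (scal w v)).
  move=> w; rewrite Cminus_0_r /nball plus_minus_l => Hw.
  apply: Rle_lt_trans (norm_scal_C _ _) _.
  have : Cmod w * norm v < r / norm v * norm v by apply: Rmult_lt_compat_r; lra.
  have -> : r / norm v * norm v = r by field.
  by [].
have H := cauchy_estimate (fun z => f (plus p (scal z v))) (RtoC 0) (l v) (r / norm v) M.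
have -> : 4 * M / r * norm v = 4 * M / (r / norm v) by field; lra.
apply: H.
- by apply: Rdiv_lt_0_compat; lra.
- move=> w /Hin /Hf [[lw Hlw] _]; apply/hol_cderiv; eexists; exact: hol_line Hlw.
- by move=> w /Hin /Hf [].
- by apply: hol_line; rewrite (scal_zero_l (K := C_AbsRing)) plus_zero_r.
Qed.

Lemma hol_on_sub {E : NormedModule C_AbsRing} (f : E -> C) (p q : E) (r s M : R) :
  hol_on f p r M -> norm (minus q p) + s <= r -> hol_on f q s M.
Proof.
move=> H Hs w Hw; apply: H; rewrite /nball in Hw *.
have -> : minus w p = plus (minus w q) (minus q p) by rewrite -minus_trans.
apply: Rle_lt_trans (norm_triangle _ _) _; lra.
Qed.

(** A point of the half ball is the centre of a ball of radius [r / 2] inside the domain, whence the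
    derivative bound [4 M / (r / 2)] along the segment. *)
Lemma lipschitz_half_ball {E : NormedModule C_AbsRing} (f : E -> C) (p q q' : E) (r M : R) :
  0 < r -> hol_on f p r M -> nball p (r / 2) q -> nball p (r / 2) q' ->
  Cmod (f q' - f q) <= 8 * M / r * norm (minus q' q).
Proof.
move=> Hr Hf Hq Hq'.
set v := minus q' q.
pose c t := plus q (scal (RtoC t) v).
have Hc : forall t, 0 <= t <= 1 -> nball p (r / 2) (c t) by move=> t; exact: nball_segment.
have [dphi Hd] : exists dphi, forall t, 0 <= t <= 1 ->
    rderiv (fun t => f (c t)) t (dphi t) /\ Cmod (dphi t) <= 8 * M / r * norm v.
  apply: (choice_on (RtoC 0) (fun t => 0 <= t <= 1)
    (fun t d => rderiv (fun t => f (c t)) t d /\ Cmod d <= 8 * M / r * norm v)) => t /Hc Ht.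
  have [[l Hl] _] := Hf _ (nball_le _ _ _ r Ht ltac:(lra)).
  exists (l v); split; first exact: rderiv_line Hl.
  have -> : 8 * M / r = 4 * M / (r / 2) by field; lra.
  apply: (cauchy_estimate_dir f (c t) v l (r / 2) M) Hl; first lra.
  apply: hol_on_sub (Hf) _; rewrite /nball in Ht; lra.
have := mean_value_inequality (fun t => f (c t)) dphi
  (fun t => 8 * M / r * norm v * t) (fun _ => 8 * M / r * norm v) 0 1 ltac:(lra)
  (fun t Ht => proj1 (Hd t Ht)) _ (fun t Ht => proj2 (Hd t Ht)).
have -> : c 1 = q' by rewrite /c (scal_one (K := C_AbsRing)) plus_minus_eq.
have -> : c 0 = q by rewrite /c (scal_zero_l (K := C_AbsRing)) plus_zero_r.
rewrite Rmult_1_r Rmult_0_r Rminus_0_r; apply=> t _.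
by auto_derive=> //; ring.
Qed.

Lemma filterdiff_shift {E : NormedModule C_AbsRing} (f : E -> C) (p v : E) l :
  filterdiff (V := C_NormedModule) f (locally (plus p v)) l ->
  filterdiff (V := C_NormedModule) (fun q => f (plus q v)) (locally p) l.
Proof.
move=> /filterdiff_eps [Hl H]; apply/filterdiff_eps; split=> // eps /H [d [Hd Hv]].
exists d; split=> // w /Hv; by rewrite -!plus_assoc (plus_comm v).
Qed.

(** The differential at [p + t v] minus that at [p] is the differential at [p] of
    [f (q + t v) - f q]. On the ball of radius [r / 4] this difference is at most [8 M / r * |v|] by
    the Lipschitz bound, and the Cauchy estimate there supplies the second factor [|v|]. *)
Lemma second_order_remainder {E : NormedModule C_AbsRing} (f : E -> C) (p v : E) l (r M : R) :
  0 < r -> hol_on f p r M ->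
  filterdiff (V := C_NormedModule) f (locally p) l -> norm v < r / 4 ->
  Cmod (f (plus p v) - f p - l v) <= 128 * M / (r * r) * (norm v * norm v).
Proof.
move=> Hr Hf Hl Hv.
have HM := hol_on_ge_0 f p r M Hr Hf.
have Hv0 := norm_ge_0 v.
pose c t := plus p (scal (RtoC t) v).
set K := 128 * M / (r * r) * (norm v * norm v).
pose psi t := (f (c t) - RtoC t * l v)%C.
have [dpsi Hd] : exists dpsi, forall t, 0 <= t <= 1 ->
    rderiv psi t (dpsi t) /\ Cmod (dpsi t) <= K.
  apply: (choice_on (RtoC 0) (fun t => 0 <= t <= 1)
    (fun t d => rderiv psi t d /\ Cmod d <= K)) => t Ht.
  have Htv : norm (scal (RtoC t) v) <= norm v.
    apply: Rle_trans (norm_scal_R _ _) _; rewrite Rabs_pos_eq; nra.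
  have Hct : nball p r (c t) by rewrite /nball plus_minus_l; lra.
  have [[lt Hlt] _] := Hf _ Hct.
  exists (lt v - l v)%C; split.
    have [H1 H2] := rderiv_line f p v t lt Hlt.
    split.
    - apply: (is_derive_ext (fun s => minus (fst (f (c s))) (s * fst (l v)))).
        by move=> s; rewrite /psi /minus /plus /opp /=; ring.
      apply: (is_derive_minus (K := R_AbsRing) (V := R_NormedModule)); first exact: H1.
      by auto_derive=> //; ring.
    - apply: (is_derive_ext (fun s => minus (snd (f (c s))) (s * snd (l v)))).
        by move=> s; rewrite /psi /minus /plus /opp /=; ring.
      apply: (is_derive_minus (K := R_AbsRing) (V := R_NormedModule)); first exact: H2.
      by auto_derive=> //; ring.
  have Hg := filterdiff_minus_C _ _ p _ _ (filterdiff_shift f p (scal (RtoC t) v) lt Hlt) Hl.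
  have -> : K = 4 * (8 * M / r * norm v) / (r / 4) * norm v by rewrite /K; field; lra.
  apply: (cauchy_estimate_dir _ p v (fun v => lt v - l v)%C (r / 4) (8 * M / r * norm v)) Hg;
    first lra.
  move=> q Hq; split.
    apply: hol_minus.
    - have [[lq Hlq] _] : hol f (plus q (scal (RtoC t) v)) /\ Cmod (f (plus q (scal (RtoC t) v))) <= M.
        apply: Hf; apply: nball_le; first exact: (nball_plus _ _ _ _ _ Hq Htv).
        lra.
      by eexists; exact: filterdiff_shift Hlq.
    - by apply: (fun h => proj1 (Hf q h)); apply: nball_le (Hq) _; lra.
  apply: Rle_trans (lipschitz_half_ball f p q (plus q (scal (RtoC t) v)) r M Hr Hf _ _) _.
  - by apply: nball_le (Hq) _; lra.
  - by apply: nball_le; [exact: (nball_plus _ _ _ _ _ Hq Htv)|lra].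
  - rewrite plus_minus_l; apply: Rmult_le_compat_l => //.
    by apply: Rdiv_le_0_compat; lra.
have := mean_value_inequality psi dpsi (fun t => K * t) (fun _ => K) 0 1 ltac:(lra)
  (fun t Ht => proj1 (Hd t Ht)) _ (fun t Ht => proj2 (Hd t Ht)).
rewrite /psi.
have -> : c 1 = plus p v by rewrite /c (scal_one (K := C_AbsRing)).
have -> : c 0 = p by rewrite /c (scal_zero_l (K := C_AbsRing)) plus_zero_r.
have -> : (f (plus p v) - 1 * l v - (f p - 0 * l v) = f (plus p v) - f p - l v)%C by ring.
rewrite Rmult_1_r Rmult_0_r Rminus_0_r; apply=> t _.
by auto_derive=> //; ring.
Qed.

Lemma C_cauchy_complete (u : nat -> C) :
  (forall eps, 0 < eps -> exists N, forall n m, (N <= n)%nat -> (N <= m)%nat ->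
     Cmod (u n - u m) < eps) ->
  exists l : C, forall eps, 0 < eps -> exists N, forall n, (N <= n)%nat ->
     Cmod (u n - l) < eps.
Proof.
move=> H.
have [a Ha] : exists a, Un_cv (fun n => fst (u n)) a.
  case: (Rcomplete.R_complete (fun n => fst (u n))); last by move=> x; exists x.
  move=> eps /H [N HN]; exists N => n m Hn Hm; rewrite /Rdist.
  exact: Rle_lt_trans (Rabs_fst_le_Cmod (u n - u m)%C) (HN n m Hn Hm).
have [b Hb] : exists b, Un_cv (fun n => snd (u n)) b.
  case: (Rcomplete.R_complete (fun n => snd (u n))); last by move=> x; exists x.
  move=> eps /H [N HN]; exists N => n m Hn Hm; rewrite /Rdist.
  exact: Rle_lt_trans (Rabs_snd_le_Cmod (u n - u m)%C) (HN n m Hn Hm).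
exists (a, b) => eps He.
have [N1 H1] := Ha (eps / 2) ltac:(lra).
have [N2 H2] := Hb (eps / 2) ltac:(lra).
exists (max N1 N2) => n Hn.
apply: Rle_lt_trans (Cmod_le_abs (fst (u n - (a, b))%C) (snd (u n - (a, b))%C)) _.
have := H1 n ltac:(lia); have := H2 n ltac:(lia); rewrite /Rdist /= /Rminus; lra.
Qed.

Lemma Ceq_eps (a b : C) : (forall eps, 0 < eps -> Cmod (a - b) <= eps) -> a = b.
Proof.
move=> H; have H0 : (a - b = RtoC 0)%C.
  apply: Cmod_eq_0; apply: Rle_antisym; last exact: Cmod_ge_0.
  by apply: Rnot_lt_le => /Rlt_gt H0; have := H (Cmod (a - b) / 2) ltac:(lra); lra.
have -> : (a = a - b + b)%C by ring.
by rewrite H0 Cplus_0_l.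
Qed.

(** The Cauchy estimate on [G n - G m] makes the differentials at [p] a Cauchy sequence, and their
    limit is the differential of [f] because the increments of [G n] converge with an error
    proportional to [|v|]. *)
Lemma hol_unif_limit {E : NormedModule C_AbsRing} (f : E -> C) (p : E) (r : R) :
  0 < r ->
  (forall eps, 0 < eps -> exists g : E -> C, forall q, nball p r q ->
     hol g q /\ Cmod (g q - f q) <= eps) ->
  hol f p.
Proof.
move=> Hr Happ.
have Hp : nball p r p by exact: nball_center.
pose e n := / (INR n + 1).
have Hen : forall n, 0 < e n by move=> n; apply: Rinv_0_lt_compat; have := pos_INR n; lra.
have Hsmall : forall eps, 0 < eps -> exists N, forall n, (N <= n)%nat -> e n < eps.
  move=> eps He; have [N HN] := INR_unbounded (/ eps).
  exists N => n Hn; rewrite -(Rinv_inv eps); apply: Rinv_lt_contravar.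
    by apply: Rmult_lt_0_compat; [exact: Rinv_0_lt_compat|have := pos_INR n; lra].
  have := le_INR _ _ Hn; lra.
have [G HG'] : exists G : nat -> E -> C, forall n, True -> forall q, nball p r q ->
    hol (G n) q /\ Cmod (G n q - f q) <= e n.
  apply: (choice_on f (fun _ => True) (fun n g => forall q, nball p r q ->
    hol g q /\ Cmod (g q - f q) <= e n)) => n _; exact: Happ.
have {HG'} HG := fun n => HG' n I.
have Hdiff : forall n m, hol_on (fun q => G n q - G m q)%C p r (e n + e m).
  move=> n m q Hq; have [H1 H2] := HG n q Hq; have [H3 H4] := HG m q Hq.
  split; first exact: hol_minus.
  have -> : (G n q - G m q = G n q - f q - (G m q - f q))%C by ring.
  by apply: Rle_trans (Cmod_triangle_sub _ _) _; lra.
have [L HL'] : exists L, forall n, True ->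
    filterdiff (V := C_NormedModule) (G n) (locally p) (L n).
  apply: (choice_on f (fun _ => True)
    (fun n l => filterdiff (V := C_NormedModule) (G n) (locally p) l)) => n _.
  exact: (proj1 (HG n p Hp)).
have {HL'} HL := fun n => HL' n I.
have HLd : forall n m v, Cmod (L n v - L m v) <= 4 * (e n + e m) / r * norm v.
  move=> n m v; apply: (cauchy_estimate_dir _ p v (fun v => L n v - L m v)%C r _ Hr (Hdiff n m)).
  exact: filterdiff_minus_C.
have [l Hl'] : exists l : E -> C, forall v, True -> forall eps, 0 < eps ->
    exists N, forall n, (N <= n)%nat -> Cmod (L n v - l v) < eps.
  apply: (choice_on (RtoC 0) (fun _ => True) (fun v lv => forall eps, 0 < eps ->
    exists N, forall n, (N <= n)%nat -> Cmod (L n v - lv) < eps)) => v _; apply: C_cauchy_complete => eps He.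
  have Hv := norm_ge_0 v.
  have [N HN] := Hsmall (eps * r / (8 * (norm v + 1))) ltac:(apply: Rdiv_lt_0_compat; nra).
  exists N => n m Hn Hm; apply: Rle_lt_trans (HLd n m v) _.
  have H1 := HN n Hn; have H2 := HN m Hm.
  have H3 : e n + e m < eps * r / (4 * (norm v + 1)).
    have -> : eps * r / (4 * (norm v + 1)) = eps * r / (8 * (norm v + 1)) + eps * r / (8 * (norm v + 1))
      by field; lra.
    lra.
  have H4 : (e n + e m) * (4 * (norm v + 1)) < eps * r.
    have -> : eps * r = eps * r / (4 * (norm v + 1)) * (4 * (norm v + 1)) by field; lra.
    apply: Rmult_lt_compat_r => //; lra.
  apply: (Rmult_lt_reg_r r) => //.
  have -> : 4 * (e n + e m) / r * norm v * r = (e n + e m) * (4 * norm v) by field; lra.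
  have := Hen n; have := Hen m; nra.
have {Hl'} Hl := fun v => Hl' v I.
have Hll : forall n v, Cmod (L n v - l v) <= 4 * e n / r * norm v.
  move=> n v; apply: le_epsilon => eps He.
  have Hv := norm_ge_0 v.
  have [N1 HN1] := Hl v (eps / 2) ltac:(lra).
  have [N2 HN2] := Hsmall (eps * r / (8 * (norm v + 1))) ltac:(apply: Rdiv_lt_0_compat; nra).
  pose m := max N1 N2.
  have H1 := HN1 m ltac:(lia); have H2 := HN2 m ltac:(lia).
  have -> : (L n v - l v = L n v - L m v + (L m v - l v))%C by ring.
  apply: Rle_trans (Cmod_triangle _ _) _.
  have H3 := HLd n m v.
  have H4 : 4 * e m / r * norm v <= eps / 2.
    apply: (Rmult_le_reg_r (r * (norm v + 1))); first by apply: Rmult_lt_0_compat; lra.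
    have -> : 4 * e m / r * norm v * (r * (norm v + 1)) = 4 * (norm v + 1) * norm v * e m by field; lra.
    have H5 : 8 * (norm v + 1) * e m <= eps * r.
      have -> : eps * r = 8 * (norm v + 1) * (eps * r / (8 * (norm v + 1))) by field; lra.
      by apply: Rmult_le_compat_l; lra.
    nra.
  have -> : 4 * e n / r * norm v = 4 * (e n + e m) / r * norm v - 4 * e m / r * norm v by field; lra.
  lra.
exists l; apply/filterdiff_eps; split.
- split.
  + move=> x y; apply: Ceq_eps => eps He.
    have [N1 H1] := Hl x (eps / 3) ltac:(lra).
    have [N2 H2] := Hl y (eps / 3) ltac:(lra).
    have [N3 H3] := Hl (plus x y) (eps / 3) ltac:(lra).
    pose n := max N1 (max N2 N3).
    have K1 := H1 n ltac:(lia); have K2 := H2 n ltac:(lia); have K3 := H3 n ltac:(lia).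
    have -> : (l (plus x y) - plus (l x) (l y) = (L n x - l x) + (L n y - l y) - (L n (plus x y) - l (plus x y)))%C.
      rewrite (linear_plus _ (proj1 (HL n))) /plus /=; ring.
    apply: Rle_trans (Cmod_triangle_sub _ _) _.
    have := Cmod_triangle (L n x - l x) (L n y - l y); lra.
  + move=> k x; apply: Ceq_eps => eps He.
    have Hk := Cmod_ge_0 k.
    have [N1 H1] := Hl x (eps / (2 * (Cmod k + 1))) ltac:(apply: Rdiv_lt_0_compat; lra).
    have [N2 H2] := Hl (scal k x) (eps / 2) ltac:(lra).
    pose n := max N1 N2.
    have K1 := H1 n ltac:(lia); have K2 := H2 n ltac:(lia).
    have -> : (l (scal k x) - scal k (l x) = k * (L n x - l x) - (L n (scal k x) - l (scal k x)))%C.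
      rewrite (linear_scal _ (proj1 (HL n))) /scal /= /mult /=; ring.
    apply: Rle_trans (Cmod_triangle_sub _ _) _.
    rewrite Cmod_mult.
    have : Cmod (L n x - l x) * (2 * (Cmod k + 1)) <= eps.
      have -> : eps = eps / (2 * (Cmod k + 1)) * (2 * (Cmod k + 1)) by field; lra.
      by apply: Rmult_le_compat_r; lra.
    have := Cmod_ge_0 (L n x - l x); nra.
  + have [M [HM HLM]] := linear_norm _ (proj1 (HL O)).
    exists (M + 4 * e O / r); split.
      have : 0 < 4 * e O / r by apply: Rdiv_lt_0_compat => //; have := Hen O; lra.
      lra.
    move=> v; have H1 := HLM v; have H2 := Hll O v.
    have -> : l v = (L O v - (L O v - l v))%C by ring.
    apply: Rle_trans (Cmod_triangle_sub _ _) _.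
    rewrite Rmult_plus_distr_r; apply: Rplus_le_compat => //.
- move=> eps He.
  have [n Hn] : exists n, e n < eps * r / 24.
    have [N HN] := Hsmall (eps * r / 24) ltac:(nra).
    by exists N; apply: HN.
  have /filterdiff_eps [_ Hdn] := HL n.
  have [d [Hd Hdv]] := Hdn (eps / 3) ltac:(lra).
  exists (Rmin d (r / 2)); split; first by apply: Rmin_pos; lra.
  move=> v Hv.
  have Hv1 := Rlt_le_trans _ _ _ Hv (Rmin_l _ _).
  have Hv2 := Rlt_le_trans _ _ _ Hv (Rmin_r _ _).
  have Hv0 := norm_ge_0 v.
  have A1 := Hdv v Hv1.
  have A2 := Hll n v.
  (* The Lipschitz bound for [G m - G n], in the limit of large [m]. *)
  have A3 : Cmod ((f (plus p v) - f p) - (G n (plus p v) - G n p)) <= 8 * e n / r * norm v.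
    apply: le_epsilon => eps' He'.
    have [m Hm] : exists m, e m < eps' / 10.
      have [N HN] := Hsmall (eps' / 10) ltac:(lra).
      by exists N; apply: HN.
    have Hpv : nball p (r / 2) (plus p v) by rewrite /nball plus_minus_l.
    have B1 := lipschitz_half_ball _ p p (plus p v) r _ Hr (Hdiff m n)
      (nball_center p (r / 2) ltac:(lra)) Hpv.
    rewrite plus_minus_l in B1.
    have B2 := proj2 (HG m p Hp).
    have B3 := proj2 (HG m (plus p v) (nball_le _ _ _ r Hpv ltac:(lra))).
    have -> : ((f (plus p v) - f p) - (G n (plus p v) - G n p) =
      (G m (plus p v) - G n (plus p v) - (G m p - G n p)) + ((G m p - f p) - (G m (plus p v) - f (plus p v))))%C
      by ring.
    apply: Rle_trans (Cmod_triangle _ _) _.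
    have B4 := Cmod_triangle_sub (G m p - f p) (G m (plus p v) - f (plus p v)).
    have B5 : 8 * (e m + e n) / r * norm v <= 8 * e n / r * norm v + 4 * e m.
      have -> : 8 * (e m + e n) / r * norm v = 8 * e n / r * norm v + 4 * e m * (2 * norm v / r) by field; lra.
      have : 2 * norm v / r <= 1.
        apply: (Rmult_le_reg_r r) => //.
        have -> : 2 * norm v / r * r = 2 * norm v by field; lra.
        lra.
      have := Hen m; nra.
    lra.
  change (Cmod (f (plus p v) - f p - l v) <= eps * norm v).
  change (Cmod (G n (plus p v) - G n p - L n v) <= eps / 3 * norm v) in A1.
  have -> : (f (plus p v) - f p - l v = ((f (plus p v) - f p) - (G n (plus p v) - G n p))
    + (G n (plus p v) - G n p - L n v) + (L n v - l v))%C by ring.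
  apply: Rle_trans (Cmod_triangle _ _) _.
  have T := Cmod_triangle ((f (plus p v) - f p) - (G n (plus p v) - G n p)) (G n (plus p v) - G n p - L n v).
  have A4 : 8 * e n / r * norm v <= eps / 3 * norm v.
    apply: Rmult_le_compat_r => //.
    apply: (Rmult_le_reg_r r) => //.
    have -> : 8 * e n / r * r = 8 * e n by field; lra.
    lra.
  have A5 : 4 * e n / r * norm v <= 8 * e n / r * norm v.
    apply: Rmult_le_compat_r => //; apply: Rmult_le_compat_r; last by have := Hen n; lra.
    by left; exact: Rinv_0_lt_compat.
  lra.
Qed.

Lemma hol_bounded_near {E : NormedModule C_AbsRing} (f : E -> C) (p : E) (r : R) :
  0 < r -> (forall q, nball p r q -> hol f q) ->
  exists s M, 0 < s <= r /\ 0 <= M /\ hol_on f p s M.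
Proof.
move=> Hr Hf.
have [d [Hd H]] := hol_continuous f p (Hf p (nball_center p r Hr)) 1 ltac:(lra).
exists (Rmin r d), (Cmod (f p) + 1); split; last split.
- by split; [apply: Rmin_pos|exact: Rmin_l].
- by have := Cmod_ge_0 (f p); lra.
- move=> q Hq; split.
  + by apply: Hf; apply: nball_le Hq (Rmin_l _ _).
  + have H1 := H q (nball_le _ _ _ _ Hq (Rmin_r _ _)).
    have := Cmod_triangle (f q - f p) (f p).
    have -> : (f q - f p + f p = f q)%C by ring.
    lra.
Qed.

(** Difference quotients with a fixed small step [a] are holomorphic in [q] and, by the quadratic
    remainder, uniformly close to [df]. *)
Lemma hol_partial {E : NormedModule C_AbsRing} (f df : E -> C) (p v : E) (r : R) :
  0 < r ->
  (forall q, nball p r q -> exists l,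
     filterdiff (V := C_NormedModule) f (locally q) l /\ df q = l v) ->
  hol df p.
Proof.
move=> Hr Hdf.
have [s [M [Hs [HM Hon]]]] : exists s M, 0 < s <= r /\ 0 <= M /\ hol_on f p s M.
  apply: hol_bounded_near => // q /Hdf [l [Hl _]]; by exists l.
apply: (hol_unif_limit df p (s / 2)); first lra.
move=> eps He.
have Hv := norm_ge_0 v.
set K := 512 * M / (s * s) * (norm v * norm v).
have HK : 0 <= K.
  apply: Rmult_le_pos; last nra.
  by apply: Rdiv_le_0_compat; nra.
set a := Rmin (eps / (K + 1)) (s / (8 * (norm v + 1))).
have Ha : 0 < a by apply: Rmin_pos; apply: Rdiv_lt_0_compat; lra.
have Ha1 : a * (K + 1) <= eps.
  have -> : eps = eps / (K + 1) * (K + 1) by field; lra.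
  by apply: Rmult_le_compat_r; [lra|exact: Rmin_l].
have Ha2 : a * (8 * (norm v + 1)) <= s.
  have -> : s = s / (8 * (norm v + 1)) * (8 * (norm v + 1)) by field; lra.
  by apply: Rmult_le_compat_r; [lra|exact: Rmin_r].
have Hav : norm (scal (RtoC a) v) <= a * norm v.
  by apply: Rle_trans (norm_scal_R _ _) _; rewrite Rabs_pos_eq; lra.
exists (fun q => (f (plus q (scal (RtoC a) v)) - f q) * / RtoC a)%C => q Hq.
have Hcq : forall w, norm w < s / 2 -> hol f (plus q w).
  move=> w Hw; apply: (fun h => proj1 (Hon _ h)).
  have -> : s = s / 2 + s / 2 by field.
  by apply: nball_plus => //; left.
have Ha0 : RtoC a <> RtoC 0 by move=> /RtoC_inj; lra.
split.
- apply: hol_mult; last exact: hol_const.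
  apply: hol_minus.
  + have [l Hl] := Hcq (scal (RtoC a) v) ltac:(nra).
    by exists l; exact: filterdiff_shift.
  + by apply: (fun h => proj1 (Hon _ h)); apply: nball_le (Hq) _; lra.
- have [l [Hl ->]] := Hdf q (nball_le p q (s / 2) r Hq ltac:(lra)).
  have H := second_order_remainder f q (scal (RtoC a) v) l (s / 2) M ltac:(lra) _ Hl ltac:(nra).
  have {}H : Cmod (f (plus q (scal (RtoC a) v)) - f q - l (scal (RtoC a) v)) <= a * (a * K).
    apply: Rle_trans (H _) _.
      apply: hol_on_sub (Hon) _; rewrite /nball in Hq; lra.
    have -> : a * (a * K) = 512 * M / (s * s) * ((a * norm v) * (a * norm v)) by rewrite /K; ring.
    have -> : 128 * M / (s / 2 * (s / 2)) = 512 * M / (s * s) by field; lra.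
    apply: Rmult_le_compat_l; first by apply: Rdiv_le_0_compat; nra.
    by apply: Rmult_le_compat => //; exact: norm_ge_0.
  have El : l (scal (RtoC a) v) = (RtoC a * l v)%C by exact: linear_scal (proj1 Hl) _ _.
  rewrite El in H.
  have -> : ((f (plus q (scal (RtoC a) v)) - f q) * / RtoC a - l v =
     (f (plus q (scal (RtoC a) v)) - f q - RtoC a * l v) * / RtoC a)%C by field.
  rewrite Cmod_mult Cmod_inv // Cmod_R (Rabs_pos_eq a); last lra.
  apply: (Rmult_le_reg_r a) => //.
  rewrite Rmult_assoc Rinv_l; nra.
Qed.

(* Coordinates on [C2], with the type [C] rather than the carrier of a
   normed module. *)
Notation X p := (@fst C C p).
Notation Y p := (@snd C C p).

Lemma norm_C2_le (v : C2) : norm v <= Cmod (X v) + Cmod (Y v).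
Proof.
change (norm v) with (sqrt (Cmod (X v) ^ 2 + Cmod (Y v) ^ 2)).
have H1 := Cmod_ge_0 (X v); have H2 := Cmod_ge_0 (Y v).
rewrite -(sqrt_Rsqr (Cmod (X v) + Cmod (Y v))); last lra.
apply: sqrt_le_1_alt; rewrite /Rsqr; nra.
Qed.

Lemma Cmod_fst_le (v : C2) : Cmod (X v) <= norm v.
Proof.
change (norm v) with (sqrt (Cmod (X v) ^ 2 + Cmod (Y v) ^ 2)).
rewrite -{1}(sqrt_Rsqr (Cmod (X v))); last exact: Cmod_ge_0.
apply: sqrt_le_1_alt; rewrite /Rsqr; have := Cmod_ge_0 (Y v); nra.
Qed.

Lemma Cmod_snd_le (v : C2) : Cmod (Y v) <= norm v.
Proof.
change (norm v) with (sqrt (Cmod (X v) ^ 2 + Cmod (Y v) ^ 2)).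
rewrite -{1}(sqrt_Rsqr (Cmod (Y v))); last exact: Cmod_ge_0.
apply: sqrt_le_1_alt; rewrite /Rsqr; have := Cmod_ge_0 (X v); nra.
Qed.

Lemma is_linear_fst_C2 : is_linear (U := C2) (V := C_NormedModule) (fun p => X p).
Proof.
split=> //; exists 1; split; first lra.
move=> x; rewrite Rmult_1_l; exact: Cmod_fst_le.
Qed.

Lemma is_linear_snd_C2 : is_linear (U := C2) (V := C_NormedModule) (fun p => Y p).
Proof.
split=> //; exists 1; split; first lra.
move=> x; rewrite Rmult_1_l; exact: Cmod_snd_le.
Qed.

Lemma filterdiff_pair {E : NormedModule C_AbsRing} (f g : E -> C) (p : E) lf lg :
  filterdiff (V := C_NormedModule) f (locally p) lf ->
  filterdiff (V := C_NormedModule) g (locally p) lg ->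
  filterdiff (V := C2) (fun q => (f q, g q)) (locally p) (fun v => (lf v, lg v)).
Proof.
move=> Hf Hg.
apply: (filterdiff_comp'_2 (U := C_NormedModule) (V := C_NormedModule) (W := C2)
  f g (fun a b => (a, b)) p lf lg (fun a b => (a, b)) Hf Hg).
apply: (filterdiff_ext (U := C2) (V := C2) (fun q => q)); first by case.
apply: (filterdiff_ext_lin (U := C2) (V := C2) _ (fun q => q)); last by case.
exact: filterdiff_id.
Qed.

Lemma hol_pair_comp {E : NormedModule C_AbsRing} (F : C2 -> C) (f g : E -> C) (p : E) :
  hol f p -> hol g p -> hol (E := C2) F (f p, g p) -> hol (fun q => F (f q, g q)) p.
Proof.
move=> [lf Hf] [lg Hg] [lF HF]; eexists.
exact: (filterdiff_comp' (V := C2) (fun q => (f q, g q)) F p _ _ (filterdiff_pair f g p lf lg Hf Hg) HF).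
Qed.

Lemma filterdiff_fst (p : C2) : filterdiff (U := C2) (V := C_NormedModule) (fun p => X p) (locally p) (fun p => X p).
Proof. exact: filterdiff_linear is_linear_fst_C2. Qed.

Lemma filterdiff_snd (p : C2) : filterdiff (U := C2) (V := C_NormedModule) (fun p => Y p) (locally p) (fun p => Y p).
Proof. exact: filterdiff_linear is_linear_snd_C2. Qed.

Lemma hol_fst (p : C2) : hol (E := C2) (fun p => X p) p.
Proof. by eexists; exact: filterdiff_fst. Qed.

Lemma hol_snd (p : C2) : hol (E := C2) (fun p => Y p) p.
Proof. by eexists; exact: filterdiff_snd. Qed.

Fixpoint csum (u : nat -> C) (n : nat) : C :=
  match n with O => RtoC 0 | S n => (csum u n + u n)%C end.

Lemma hol_csum {E : NormedModule C_AbsRing} (u : nat -> E -> C) (n : nat) (p : E) :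
  (forall j, (j < n)%nat -> hol (u j) p) -> hol (fun q => csum (fun j => u j q) n) p.
Proof.
elim: n => [|n IH] H /=; first exact: hol_const.
by apply: hol_plus; [apply: IH => j Hj; apply: H; lia|apply: H; lia].
Qed.

Lemma riemann_sum_error (phi : R -> R) (h kappa : R) (n : nat) :
  0 < h -> INR n * h <= 1 ->
  (forall t, 0 <= t <= 1 -> continuous phi t) ->
  (forall t t', 0 <= t <= 1 -> 0 <= t' <= 1 -> Rabs (t - t') <= h ->
     Rabs (phi t - phi t') <= kappa) ->
  forall S : nat -> R, S O = 0 ->
  (forall j, (j < n)%nat -> S (Datatypes.S j) = S j + phi (INR j * h)) ->
  Rabs (RInt phi 0 (INR n * h) - h * S n) <= INR n * h * kappa.
Proof.
move=> Hh Hn Hc Hk S S0 HS.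
have Hex : forall a b, 0 <= a -> a <= b -> b <= 1 -> ex_RInt phi a b.
  move=> a b Ha Hab Hb; apply: ex_RInt_continuous => t.
  rewrite Rmin_left // Rmax_right // => Ht; apply: Hc; lra.
elim: n Hn HS => [|n IH] Hn HS.
  rewrite S0 /= !Rmult_0_l Rmult_0_r RInt_point /zero /= Rminus_0_r Rabs_R0; lra.
rewrite S_INR in Hn *.
have Hn0 := pos_INR n.
have Hnh : 0 <= INR n * h by apply: Rmult_le_pos; lra.
have {}IH := IH ltac:(lra) ltac:(move=> j Hj; apply: HS; lia).
rewrite HS; last lia.
have -> : (INR n + 1) * h = INR n * h + h by ring.
have HC := RInt_Chasles phi 0 (INR n * h) (INR n * h + h)
  (Hex 0 (INR n * h) ltac:(lra) Hnh ltac:(lra)) (Hex (INR n * h) (INR n * h + h) Hnh ltac:(lra) ltac:(lra)).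
rewrite -HC /plus /=.
have B : Rabs (RInt phi (INR n * h) (INR n * h + h) - h * phi (INR n * h)) <= h * kappa.
  have -> : RInt phi (INR n * h) (INR n * h + h) - h * phi (INR n * h) =
    RInt (fun t => phi t - phi (INR n * h)) (INR n * h) (INR n * h + h).
    symmetry; rewrite (RInt_add phi (fun _ => - phi (INR n * h))); first last.
    - exact: ex_RInt_const.
    - by apply: Hex; lra.
    - by [].
    rewrite RInt_const /scal /= /mult /=; ring.
  have -> : h * kappa = (INR n * h + h - INR n * h) * kappa by ring.
  apply: abs_RInt_le_const; first lra.
    by apply: (ex_RInt_minus (V := R_NormedModule)); [apply: Hex; lra|exact: ex_RInt_const].
  move=> t Ht; apply: Hk; try lra.
  by rewrite Rabs_pos_eq; lra.
set A := RInt phi 0 (INR n * h) in IH *.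
set A' := RInt phi (INR n * h) (INR n * h + h) in B *.
have -> : A + A' - h * (S n + phi (INR n * h)) = (A - h * S n) + (A' - h * phi (INR n * h)) by ring.
apply: Rle_trans (Rabs_triang _ _) _; lra.
Qed.

(** * Primitives and extension of holomorphic functions *)

(** The paths of integration are horizontal segments issued from the line [X = a]; the second
    coordinate is a parameter. *)
Definition star (a : C) (t : R) (p : C2) : C2 :=
  ((a + RtoC t * (X p - a))%C, Y p).

Lemma minus_C2 (p q : C2) : minus p q = ((X p - X q)%C, (Y p - Y q)%C).
Proof. by []. Qed.

Lemma norm_star_le (a : C) (t t' : R) (p q : C2) :
  0 <= t' <= 1 ->
  norm (minus (star a t' q) (star a t p)) <= 2 * norm (minus q p) + Rabs (t' - t) * Cmod (X p - a).
Proof.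
move=> Ht.
apply: Rle_trans (norm_C2_le _) _; rewrite minus_C2 [fst (_, _)]/= [snd (_, _)]/=.
have H1 : Cmod (X q - X p) <= norm (minus q p) := Cmod_fst_le (minus q p).
have H2 : Cmod (Y q - Y p) <= norm (minus q p) := Cmod_snd_le (minus q p).
have -> : (a + t' * (X q - a) - (a + t * (X p - a)) = t' * (X q - X p) + RtoC (t' - t) * (X p - a))%C.
  by rewrite RtoC_minus; ring.
have T := Cmod_triangle (t' * (X q - X p)) (RtoC (t' - t) * (X p - a)).
rewrite !Cmod_mult !Cmod_R (Rabs_pos_eq t') in T; last lra.
apply: Rle_trans (Rplus_le_compat _ _ _ _ T H2) _.
have T1 : t' * Cmod (X q - X p) <= norm (minus q p).
  apply: Rle_trans (_ : 1 * Cmod (X q - X p) <= _); last by rewrite Rmult_1_l.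
  by apply: Rmult_le_compat_r; [exact: Cmod_ge_0|lra].
move: T1; set c := t' * _; set N := norm _; lra.
Qed.

Lemma star_uniform_nbhd (D : C2 -> Prop) (a : C) (g : C2 -> C) (p : C2) :
  open D -> (forall t, 0 <= t <= 1 -> D (star a t p)) -> (forall q, D q -> hol g q) ->
  exists eps M, 0 < eps /\ 0 <= M /\ forall q t, nball p eps q -> 0 <= t <= 1 ->
    hol_on g (star a t q) eps M /\ forall w, nball (star a t q) eps w -> D w.
Proof.
move=> HD Hstar Hg.
(* Moving the point and the time by at most [d], then moving by [d] again, displaces [star a t p] by
   at most [2 d + d |X p - a| + d = K d]. *)
set K := 3 + Cmod (X p - a).
have HK : 3 <= K by have := Cmod_ge_0 (X p - a); rewrite /K; lra.
have Hex : forall t, 0 <= t <= 1 -> exists d, 0 < d /\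
    forall w, nball (star a t p) (K * d) w -> D w /\ hol g w /\ Cmod (g w) <= / d.
  move=> t Ht.
  have /locally_nball [r [Hr HrD]] := HD _ (Hstar t Ht).
  have [s [M [Hs [HM Hon]]]] := hol_bounded_near g (star a t p) r Hr (fun q Hq => Hg q (HrD q Hq)).
  (* One number serves as a radius and, inverted, as a bound for [g], so that compactness of
     [[0, 1]] makes both uniform at once. *)
  exists (Rmin (s / K) (/ (M + 1))).
  have Hd : 0 < Rmin (s / K) (/ (M + 1)).
    by apply: Rmin_pos; [apply: Rdiv_lt_0_compat; lra|apply: Rinv_0_lt_compat; lra].
  split=> // w Hw.
  have Hw' : nball (star a t p) s w.
    apply: nball_le Hw _.
    apply: Rle_trans (Rmult_le_compat_l K _ _ _ (Rmin_l _ _)) _; first lra.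
    by right; field; lra.
  have [H1 H2] := Hon w Hw'.
  split; first by apply: HrD; apply: nball_le Hw' _; lra.
  split=> //; apply: Rle_trans H2 _.
  have : / (/ (M + 1)) <= / Rmin (s / K) (/ (M + 1)) by apply: Rinv_le_contravar => //; exact: Rmin_r.
  rewrite Rinv_inv; lra.
have [F HF] := choice_on 1 (fun t => 0 <= t <= 1) _ Hex.
have [del Hdel] : exists del : R -> posreal, forall t, 0 <= t <= 1 -> pos (del t) = F t.
  apply: (choice_on (mkposreal 1 Rlt_0_1) (fun t => 0 <= t <= 1) (fun t (d : posreal) => pos d = F t)) => t Ht.
  by exists (mkposreal (F t) (proj1 (HF t Ht))).
have [d Hd] := compactness_value_1d 0 1 del.
exists d, (/ d); split; first exact: cond_pos.
split; first by left; apply: Rinv_0_lt_compat; exact: cond_pos.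
move=> q t Hq Ht.
have key : forall w, nball (star a t q) d w -> D w /\ hol g w /\ Cmod (g w) <= / d.
  move=> w Hw; apply: NNPP => Hno; apply: (Hd t Ht) => [[u [Hu [Htu Hdu]]]].
  apply: Hno; rewrite (Hdel u Hu) in Htu Hdu.
  have [HF1 HF2] := HF u Hu.
  have [A1 [A2 A3]] : D w /\ hol g w /\ Cmod (g w) <= / F u.
    apply: HF2.
    have N := norm_star_le a u t p q Ht.
    apply: (nball_nball _ (star a t q) _ (2 * d + F u * Cmod (X p - a)) d) => //; last by rewrite /K; lra.
    rewrite /nball in Hq *.
    have := Cmod_ge_0 (X p - a); nra.
  split=> //; split=> //; apply: Rle_trans A3 _.
  by apply: Rinv_le_contravar => //; exact: cond_pos.
by split=> w /key [H1 [H2 H3]].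
Qed.

(** The horizontal primitive of [g] from the line [X = a], divided by [X p - a]; in this form it
    also makes sense on that line, where it equals [g]. *)
Definition star_mean (a : C) (g : C2 -> C) (p : C2) : C :=
  (RInt (fun t => fst (g (star a t p))) 0 1, RInt (fun t => snd (g (star a t p))) 0 1).

Lemma hol_continuous_star (g : C2 -> C) (a : C) (p : C2) (t : R) :
  hol g (star a t p) ->
  continuous (fun t => fst (g (star a t p))) t /\ continuous (fun t => snd (g (star a t p))) t.
Proof.
move=> [l Hl].
pose v : C2 := ((X p - a)%C, RtoC 0).
pose p0 : C2 := (a, Y p).
have E : forall t, star a t p = plus p0 (scal (RtoC t) v).
  move=> s; apply: injective_projections => /=; first by [].
  by rewrite /scal /plus /= /mult /=; ring.
rewrite E in Hl.
have [H1 H2] := rderiv_line g p0 v t l Hl.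
split.
- apply: (continuous_ext (fun t => fst (g (plus p0 (scal (RtoC t) v))))) => [s|]; first by rewrite E.
  by apply: ex_derive_continuous; eexists; exact: H1.
- apply: (continuous_ext (fun t => snd (g (plus p0 (scal (RtoC t) v))))) => [s|]; first by rewrite E.
  by apply: ex_derive_continuous; eexists; exact: H2.
Qed.

Lemma hol_star (a : C) (t : R) (g : C2 -> C) (p : C2) :
  hol g (star a t p) -> hol (E := C2) (fun q => g (star a t q)) p.
Proof.
move=> H; apply: hol_pair_comp => //; last exact: hol_snd.
apply: hol_plus; first exact: hol_const.
apply: hol_mult; first exact: hol_const.
by apply: hol_minus; [exact: hol_fst|exact: hol_const].
Qed.

Lemma csum_fst (u : nat -> C) n : fst (csum u (S n)) = fst (csum u n) + fst (u n).
Proof. by []. Qed.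

Lemma csum_snd (u : nat -> C) n : snd (csum u (S n)) = snd (csum u n) + snd (u n).
Proof. by []. Qed.

(** A uniform limit of Riemann sums, each of them holomorphic; compactness of the segment makes the
    Lipschitz constant of [g] along it uniform in [q]. *)
Lemma hol_star_mean (D : C2 -> Prop) (a : C) (g : C2 -> C) (p : C2) :
  open D -> (forall t, 0 <= t <= 1 -> D (star a t p)) -> (forall q, D q -> hol g q) ->
  hol (star_mean a g) p.
Proof.
move=> HD Hstar Hg.
have [r [M [Hr [HM Hun]]]] := star_uniform_nbhd D a g p HD Hstar Hg.
set B := Cmod (X p - a) + r.
have HB : 0 < B by have := Cmod_ge_0 (X p - a); rewrite /B; lra.
have HBq : forall q, nball p r q -> Cmod (X q - a) <= B.
  move=> q Hq; have -> : (X q - a = (X q - X p) + (X p - a))%C by ring.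
  apply: Rle_trans (Cmod_triangle _ _) _.
  have : Cmod (X q - X p) <= norm (minus q p) := Cmod_fst_le (minus q p).
  rewrite /nball in Hq; rewrite /B; lra.
apply: (hol_unif_limit _ p r Hr) => eps He.
set K := 8 * M / r * B.
have HK : 0 <= K by apply: Rmult_le_pos; [apply: Rdiv_le_0_compat|]; lra.
have [n Hn] := INR_unbounded (Rmax (2 * K / eps) (2 * B / r)).
have Hn1 := Rle_lt_trans _ _ _ (Rmax_l _ _) Hn.
have Hn2 := Rle_lt_trans _ _ _ (Rmax_r _ _) Hn.
have Hn0 : 0 < INR n.
  by apply: Rle_lt_trans Hn2; apply: Rdiv_le_0_compat; lra.
set h := / INR n.
have Hh : 0 < h by exact: Rinv_0_lt_compat.
have Hnh : INR n * h = 1 by rewrite /h Rinv_r; lra.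
have HhK : 2 * (K * h) <= eps.
  apply: (Rmult_le_reg_r (INR n)) => //.
  have -> : 2 * (K * h) * INR n = 2 * K * (INR n * h) by ring.
  rewrite Hnh.
  have : 2 * K / eps * eps <= INR n * eps by apply: Rmult_le_compat_r; lra.
  have -> : 2 * K / eps * eps = 2 * K by field; lra.
  lra.
have HhB : B * h <= r / 2.
  apply: (Rmult_le_reg_r (INR n)) => //.
  have -> : B * h * INR n = B * (INR n * h) by ring.
  rewrite Hnh.
  have : 2 * B / r * r <= INR n * r by apply: Rmult_le_compat_r; lra.
  have -> : 2 * B / r * r = 2 * B by field; lra.
  lra.
exists (fun q => (RtoC h * csum (fun j => g (star a (INR j * h) q)) n)%C) => q Hq.
have Hjh : forall j, (j < n)%nat -> 0 <= INR j * h <= 1.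
  move=> j Hj; split; first by apply: Rmult_le_pos; [exact: pos_INR|lra].
  rewrite -Hnh; apply: Rmult_le_compat_r; [lra|apply: le_INR; lia].
have Hhol : forall t, 0 <= t <= 1 -> hol g (star a t q).
  by move=> t Ht; apply: (fun h => proj1 (proj1 (Hun q t Hq Ht) _ h)); exact: nball_center.
split.
  apply: hol_mult; first exact: hol_const.
  by apply: (hol_csum (fun j q => g (star a (INR j * h) q))) => j /Hjh /Hhol; exact: hol_star.
have Hlip : forall t t', 0 <= t <= 1 -> 0 <= t' <= 1 -> Rabs (t - t') <= h ->
    Cmod (g (star a t q) - g (star a t' q)) <= K * h.
  move=> t t' Ht Ht' Htt.
  have N := norm_star_le a t' t q q Ht.
  rewrite minus_eq_zero norm_zero in N.
  have N2 : norm (minus (star a t q) (star a t' q)) <= h * B.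
    have := HBq q Hq; have := Rabs_pos (t - t'); have := Cmod_ge_0 (X q - a); nra.
  have Hs := lipschitz_half_ball g (star a t' q) (star a t' q) (star a t q) r M Hr
    (proj1 (Hun q t' Hq Ht')) (nball_center (star a t' q) (r / 2) ltac:(lra)).
  (* The displacement may equal [r / 2], which the open half ball excludes; there [|g| <= M] is
     enough. *)
  have [E|E] : norm (minus (star a t q) (star a t' q)) < r / 2 \/ r / 2 <= norm (minus (star a t q) (star a t' q)) by lra.
  - apply: Rle_trans (Hs E) _.
    have -> : K * h = 8 * M / r * (h * B) by rewrite /K; ring.
    by apply: Rmult_le_compat_l => //; apply: Rdiv_le_0_compat; lra.
  - have E2 : norm (minus (star a t q) (star a t' q)) < r by lra.
    have G1 := proj2 (proj1 (Hun q t' Hq Ht') _ E2).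
    have G2 := proj2 (proj1 (Hun q t' Hq Ht') _ (nball_center _ _ Hr)).
    apply: Rle_trans (Cmod_triangle_sub _ _) _.
    have -> : K * h = 8 * M / r * (h * B) by rewrite /K; ring.
    have : 8 * M / r * (r / 2) <= 8 * M / r * (h * B)
      by apply: Rmult_le_compat_l; [apply: Rdiv_le_0_compat|]; lra.
    have -> : 8 * M / r * (r / 2) = 4 * M by field; lra.
    lra.
have R1 := riemann_sum_error (fun t => fst (g (star a t q))) h (K * h) n Hh ltac:(lra)
  (fun t Ht => proj1 (hol_continuous_star g a q t (Hhol t Ht)))
  (fun t t' Ht Ht' H => Rle_trans _ _ _ (Rabs_fst_le_Cmod (g (star a t q) - g (star a t' q))%C) (Hlip t t' Ht Ht' H))
  (fun j => fst (csum (fun j => g (star a (INR j * h) q)) j)) eq_refl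
  (fun j _ => csum_fst _ j).
have R2 := riemann_sum_error (fun t => snd (g (star a t q))) h (K * h) n Hh ltac:(lra)
  (fun t Ht => proj2 (hol_continuous_star g a q t (Hhol t Ht)))
  (fun t t' Ht Ht' H => Rle_trans _ _ _ (Rabs_snd_le_Cmod (g (star a t q) - g (star a t' q))%C) (Hlip t t' Ht Ht' H))
  (fun j => snd (csum (fun j => g (star a (INR j * h) q)) j)) eq_refl
  (fun j _ => csum_snd _ j).
rewrite Hnh Rmult_1_l in R1; rewrite Hnh Rmult_1_l in R2.
set Z := csum _ n in R1 R2 *.
rewrite Cmod_sub_rev.
apply: Rle_trans (Cmod_le_abs (fst (star_mean a g q - RtoC h * Z)%C) (snd (star_mean a g q - RtoC h * Z)%C)) _.
have -> : fst (star_mean a g q - RtoC h * Z)%C = fst (star_mean a g q) - h * fst Z by simpl; ring.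
have -> : snd (star_mean a g q - RtoC h * Z)%C = snd (star_mean a g q) - h * snd Z by simpl; ring.
rewrite [fst (star_mean _ _ _)]/= [snd (star_mean _ _ _)]/=; lra.
Qed.

Notation e1 := ((RtoC 1, RtoC 0) : C2).
Notation e2 := ((RtoC 0, RtoC 1) : C2).

Lemma linear_C2 (l : C2 -> C) (v : C2) :
  is_linear (U := C2) (V := C_NormedModule) l ->
  l v = (X v * l e1 + Y v * l e2)%C.
Proof.
move=> Hl.
have E : v = plus (scal (X v) e1) (scal (Y v) e2).
  apply: injective_projections.
  - change (X v = X v * RtoC 1 + Y v * RtoC 0)%C; ring.
  - change (Y v = X v * RtoC 0 + Y v * RtoC 1)%C; ring.
rewrite {1}E (linear_plus l Hl) !(linear_scal l Hl) //.
Qed.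

Definition primitive (a : C) (g : C2 -> C) (p : C2) : C :=
  ((X p - a) * star_mean a g p)%C.

Lemma rderiv_unique (phi : R -> C) (t : R) (d d' : C) :
  rderiv phi t d -> rderiv phi t d' -> d = d'.
Proof.
move=> [H1 H2] [H1' H2']; apply: injective_projections.
- by rewrite -(is_derive_unique _ _ _ H1) (is_derive_unique _ _ _ H1').
- by rewrite -(is_derive_unique _ _ _ H2) (is_derive_unique _ _ _ H2').
Qed.

Lemma star_1 (a : C) (p : C2) : star a 1 p = p.
Proof. apply: injective_projections => //=; ring. Qed.

Lemma star_star (a : C) (s t : R) (p : C2) : star a t (star a s p) = star a (t * s) p.
Proof. apply: injective_projections => //=; rewrite RtoC_mult; ring. Qed.

Lemma open_star_nbhd (D : C2 -> Prop) (a : C) (p : C2) :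
  open D -> D p -> exists d, 0 < d /\ forall s, Rabs (s - 1) < d -> D (star a s p).
Proof.
move=> HD Hp.
have /locally_nball [r [Hr Hrp]] := HD p Hp.
have H0 := Cmod_ge_0 (X p - a).
exists (r / (Cmod (X p - a) + 1)); split; first by apply: Rdiv_lt_0_compat; lra.
move=> s Hs; apply: Hrp; rewrite /nball.
apply: Rle_lt_trans (norm_C2_le _) _.
have -> : X (minus (star a s p) p) = (RtoC (s - 1) * (X p - a))%C.
  by rewrite RtoC_minus /= /minus /plus /opp /=; ring.
have -> : Y (minus (star a s p) p) = RtoC 0.
  by rewrite /= /minus /plus /opp /=; ring.
rewrite Cmod_0 Rplus_0_r Cmod_mult Cmod_R.
have : Rabs (s - 1) * (Cmod (X p - a) + 1) < r.
  have -> : r = r / (Cmod (X p - a) + 1) * (Cmod (X p - a) + 1) by field; lra.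
  by apply: Rmult_lt_compat_r; lra.
have := Rabs_pos (s - 1); nra.
Qed.

Lemma primitive_star_eq (a : C) (g : C2 -> C) (p : C2) (s : R) :
  0 <= s -> (forall t, 0 <= t <= 1 -> hol g (star a (t * s) p)) ->
  primitive a g (star a s p) =
  ((X p - a) * (RInt (fun t => fst (g (star a t p))) 0 s, RInt (fun t => snd (g (star a t p))) 0 s))%C.
Proof.
move=> Hs Hg.
have E : forall f : R -> R, (forall t, 0 <= t <= 1 -> continuous f (t * s)) ->
    s * RInt (fun t => f (t * s)) 0 1 = RInt f 0 s.
  move=> f Hf.
  have H := RInt_comp_lin (V := R_CompleteNormedModule) f s 0 0 1.
  rewrite Rmult_0_r Rplus_0_l Rmult_1_r Rplus_0_r in H.
  rewrite -H; last first.
    case: (Req_dec s 0) => [->|Hs0]; first exact: ex_RInt_point.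
    apply: ex_RInt_continuous => t; rewrite Rmin_left // Rmax_right // => Ht.
    have -> : t = (t / s) * s by field.
    apply: Hf; split; first by apply: Rdiv_le_0_compat; lra.
    apply: (Rmult_le_reg_r s); first lra.
    have -> : t / s * s = t by field.
    lra.
  rewrite RInt_scal; last first.
    apply: ex_RInt_continuous => t; rewrite Rmin_left ?Rmax_right; try lra; move=> Ht.
    apply: (continuous_ext (fun t => f (t * s))) => [u|]; first by congr f; ring.
    apply: (continuous_comp (fun t => t * s) f); last exact: Hf.
    apply: (continuous_mult (K := R_AbsRing)); [exact: continuous_id|exact: continuous_const].
  rewrite /scal /= /mult /=; congr Rmult; apply: RInt_ext => t _; congr f; ring.
rewrite /primitive /star_mean.
have -> : (X (star a s p) - a = RtoC s * (X p - a))%C by simpl; ring.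
rewrite -(E (fun t => fst (g (star a t p)))); last first.
  by move=> t Ht; apply: (fun h => proj1 (hol_continuous_star g a p (t * s) h)); exact: Hg.
rewrite -(E (fun t => snd (g (star a t p)))); last first.
  by move=> t Ht; apply: (fun h => proj2 (hol_continuous_star g a p (t * s) h)); exact: Hg.
rewrite (RInt_ext (fun t => fst (g (star a t (star a s p)))) (fun t => fst (g (star a (t * s) p)))); last by move=> t _; rewrite star_star.
rewrite (RInt_ext (fun t => snd (g (star a t (star a s p)))) (fun t => snd (g (star a (t * s) p)))); last by move=> t _; rewrite star_star.
by apply: injective_projections => /=; ring.
Qed.

Lemma RInt_derive_at (f : R -> R) (b : R) (d : R) :
  0 < b -> 0 < d -> (forall t, 0 <= t < b + d -> continuous f t) ->
  is_derive (fun s => RInt f 0 s) b (f b).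
Proof.
move=> Hb Hd Hf; apply: (is_derive_RInt f (fun s => RInt f 0 s) 0); last by apply: Hf; lra.
have Hm : 0 < Rmin b d by apply: Rmin_pos.
exists (mkposreal _ Hm) => s; rewrite /ball /= /AbsRing_ball /abs /= /minus /plus /opp /= => Hs.
have := Rmin_l b d; have := Rmin_r b d => M1 M2.
have [Hs1 Hs2] := Rabs_def2 _ _ Hs.
apply: RInt_correct; apply: ex_RInt_continuous => t.
rewrite Rmin_left ?Rmax_right; try lra; move=> Ht; apply: Hf; lra.
Qed.

(** Holomorphy comes from the product with [star_mean]. The value on [e1] is read off the real
    derivative along the segment, which gives [l] on [(X p - a) e1]; when [X p = a] the product rule
    gives it directly. *)
Lemma filterdiff_primitive (D : C2 -> Prop) (a : C) (g : C2 -> C) (p : C2) :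
  open D -> (forall q t, D q -> 0 <= t <= 1 -> D (star a t q)) ->
  (forall q, D q -> hol g q) -> D p ->
  exists l, filterdiff (U := C2) (V := C_NormedModule) (primitive a g) (locally p) l /\
    l e1 = g p.
Proof.
move=> HD Hstar Hg Hp.
have [lq Hlq] := hol_star_mean D a g p HD (fun t Ht => Hstar p t Hp Ht) Hg.
have H1 := filterdiff_minus_C _ _ p _ _ (filterdiff_fst p) (filterdiff_const_C a p).
have Hl := filterdiff_mult_C _ _ p _ _ H1 Hlq.
set l := (fun v : C2 => ((X v - 0) * star_mean a g p + (X p - a) * lq v)%C).
change (filterdiff (U := C2) (V := C_NormedModule) (primitive a g) (locally p) l) in Hl.
exists l; split=> //.
case: (Req_dec (Cmod (X p - a)) 0) => Hpa.
  have Ea : X p = a.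
    have := Cmod_eq_0 _ Hpa => E.
    have -> : X p = (X p - a + a)%C by ring.
    by rewrite E; ring.
  rewrite /l [X e1]/= Ea Cminus_diag.
  have -> : star_mean a g p = g p; last by cring.
  have E : forall t, star a t p = p.
    by move=> t; apply: injective_projections => //=; rewrite -Ea; ring.
  rewrite /star_mean (RInt_ext _ (fun _ => fst (g p))); last by move=> t _; rewrite E.
  rewrite (RInt_ext (fun t => snd _) (fun _ => snd (g p))); last by move=> t _; rewrite E.
  by rewrite !RInt_const /scal /= /mult /=; apply: injective_projections => /=; ring.
have [d [Hd Hdp]] := open_star_nbhd D a p HD Hp.
have Dt : forall t, 0 <= t < 1 + d -> D (star a t p).
  move=> t Ht; case: (Rle_lt_dec t 1) => Ht1; first by apply: Hstar => //; lra.
  by apply: Hdp; rewrite Rabs_pos_eq; lra.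
have R1 : rderiv (fun s => primitive a g (star a s p)) 1 ((X p - a) * g p)%C.
  have F1 := RInt_derive_at (fun t => fst (g (star a t p))) 1 d ltac:(lra) Hd
    (fun t Ht => proj1 (hol_continuous_star g a p t (Hg _ (Dt t Ht)))).
  have F2 := RInt_derive_at (fun t => snd (g (star a t p))) 1 d ltac:(lra) Hd
    (fun t Ht => proj2 (hol_continuous_star g a p t (Hg _ (Dt t Ht)))).
  rewrite star_1 in F1; rewrite star_1 in F2.
  have Eloc : locally 1 (fun s => ((X p - a) * (RInt (fun t => fst (g (star a t p))) 0 s, RInt (fun t => snd (g (star a t p))) 0 s))%C = primitive a g (star a s p)).
    have Hm : 0 < Rmin 1 d by apply: Rmin_pos; lra.
    exists (mkposreal _ Hm) => s; rewrite /ball /= /AbsRing_ball /abs /= /minus /plus /opp /= => Hs.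
    have := Rmin_l 1 d; have := Rmin_r 1 d => M1 M2.
    have [Hs1 Hs2] := Rabs_def2 _ _ Hs.
    symmetry; apply: primitive_star_eq; first lra.
    move=> t Ht; apply: Hg; apply: Dt; nra.
  set c := (X p - a)%C in Eloc *.
  split.
  - apply: (is_derive_ext_loc (fun s => fst c * RInt (fun t => fst (g (star a t p))) 0 s - snd c * RInt (fun t => snd (g (star a t p))) 0 s)).
      by apply: filter_imp Eloc => s <-.
    apply: (is_derive_minus (K := R_AbsRing) (V := R_NormedModule)); exact: is_derive_scal.
  - apply: (is_derive_ext_loc (fun s => fst c * RInt (fun t => snd (g (star a t p))) 0 s + snd c * RInt (fun t => fst (g (star a t p))) 0 s)).
      by apply: filter_imp Eloc => s <-.
    apply: (is_derive_plus (K := R_AbsRing) (V := R_NormedModule)); exact: is_derive_scal.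
pose v : C2 := ((X p - a)%C, RtoC 0).
pose p0 : C2 := (a, Y p).
have E : forall t, star a t p = plus p0 (scal (RtoC t) v).
  move=> s; apply: injective_projections => /=; first by [].
  by rewrite /scal /plus /= /mult /=; ring.
have R2 : rderiv (fun s => primitive a g (star a s p)) 1 (l v).
  have Hl' : filterdiff (U := C2) (V := C_NormedModule) (primitive a g) (locally (plus p0 (scal (RtoC 1) v))) l.
    by rewrite -E star_1.
  have [G1 G2] := rderiv_line (primitive a g) p0 v 1 l Hl'.
  by split; [apply: is_derive_ext G1 => s; rewrite E|apply: is_derive_ext G2 => s; rewrite E].
have := rderiv_unique _ _ _ _ R1 R2.
rewrite (linear_C2 l v (proj1 Hl)) [X v]/= [Y v]/= => Eq.
have Hne : (X p - a)%C <> RtoC 0 by move=> H; apply: Hpa; rewrite H Cmod_0.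
have -> : g p = ((X p - a) * g p / (X p - a))%C by cfield.
by rewrite Eq; cfield.
Qed.

Lemma constant_on_segment {E : NormedModule C_AbsRing} (F : E -> C) (p v : E) :
  (forall t, 0 <= t <= 1 -> exists l,
     filterdiff (V := C_NormedModule) F (locally (plus p (scal (RtoC t) v))) l /\ l v = RtoC 0) ->
  F (plus p v) = F p.
Proof.
move=> H.
have := mean_value_inequality (fun t => F (plus p (scal (RtoC t) v))) (fun _ => RtoC 0)
  (fun _ => 0) (fun _ => 0) 0 1 ltac:(lra).
rewrite (scal_one (K := C_AbsRing)) (scal_zero_l (K := C_AbsRing)) plus_zero_r => HH.
apply: Ceq_eps => eps He; apply: Rle_trans (HH _ _ _) _; last lra.
- by move=> t /H [l [Hl <-]]; exact: rderiv_line Hl.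
- by move=> t _; exact: is_derive_const.
- by move=> t _; rewrite Cmod_0; lra.
Qed.

Lemma filterdiff_locally_unique {E : NormedModule C_AbsRing} (F : E -> C) (p v : E) l l' :
  filterdiff (V := C_NormedModule) F (locally p) l ->
  filterdiff (V := C_NormedModule) F (locally p) l' -> l v = l' v.
Proof.
move=> H H'.
have E0 : p = plus p (scal (RtoC 0) v) by rewrite (scal_zero_l (K := C_AbsRing)) plus_zero_r.
rewrite {1}E0 in H; rewrite {1}E0 in H'.
exact: rderiv_unique (rderiv_line F p v 0 l H) (rderiv_line F p v 0 l' H').
Qed.

(** * Polydiscs and removable singularities *)

Lemma open_polydisc (p : C2) (D : C2 -> Prop) :
  locally p D -> exists r, 0 < r /\ forall q : C2, Cmod (X q - X p) < r -> Cmod (Y q - Y p) < r -> D q.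
Proof.
move=> /locally_nball [r [Hr H]]; exists (r / 2); split; first lra.
move=> q H1 H2; apply: H; rewrite /nball.
apply: Rle_lt_trans (norm_C2_le _) _.
change (Cmod (X q - X p) + Cmod (Y q - Y p) < r); lra.
Qed.

Lemma locally_polydisc (p : C2) (r : R) (D : C2 -> Prop) :
  0 < r -> (forall q : C2, Cmod (X q - X p) < r -> Cmod (Y q - Y p) < r -> D q) -> locally p D.
Proof.
move=> Hr H; apply/locally_nball; exists r; split=> // q Hq; apply: H.
- exact: Rle_lt_trans (Cmod_fst_le (minus q p)) Hq.
- exact: Rle_lt_trans (Cmod_snd_le (minus q p)) Hq.
Qed.

Lemma open_polydisc_open (a b : C) (r s : R) :
  open (fun q : C2 => Cmod (X q - a) < r /\ Cmod (Y q - b) < s).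
Proof.
move=> p [H1 H2].
apply: (locally_polydisc p (Rmin (r - Cmod (X p - a)) (s - Cmod (Y p - b)))).
  by apply: Rmin_pos; lra.
move=> q Hx Hy.
have Hx' := Rlt_le_trans _ _ _ Hx (Rmin_l _ _).
have Hy' := Rlt_le_trans _ _ _ Hy (Rmin_r _ _).
split.
- have := Cmod_triangle (X q - X p) (X p - a).
  have -> : (X q - X p + (X p - a) = X q - a)%C by ring.
  lra.
- have := Cmod_triangle (Y q - Y p) (Y p - b).
  have -> : (Y q - Y p + (Y p - b) = Y q - b)%C by ring.
  lra.
Qed.

(** The quotient is [h / X] off the line [X = 0] and the horizontal derivative of [h] on it. Near
    the line [h] is the horizontal primitive of this derivative, so the quotient is the [star_mean]
    of the derivative, which is holomorphic across the line. *)
Lemma quotient_fst (D : C2 -> Prop) (h : C2 -> C) :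
  open D -> (forall p, D p -> hol (E := C2) h p) -> (forall p, D p -> X p = RtoC 0 -> h p = RtoC 0) ->
  exists q, forall p, D p -> hol (E := C2) q p /\ h p = (X p * q p)%C.
Proof.
move=> HD Hh H0.
have [dh Hdh] := choice_on (RtoC 0) D (fun p d => exists l,
  filterdiff (U := C2) (V := C_NormedModule) h (locally p) l /\ d = l e1)
  (fun p Hp => match Hh p Hp with ex_intro l Hl => ex_intro _ (l e1) (ex_intro _ l (conj Hl eq_refl)) end).
have Hdhol : forall p, D p -> hol dh p.
  move=> p /HD /locally_nball [r [Hr Hrp]].
  by apply: (hol_partial h dh p e1 r Hr) => q /Hrp /Hdh.
pose q (p : C2) : C := match excluded_middle_informative (X p = RtoC 0) with left _ => dh p | right _ => (h p / X p)%C end.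
have Hq : forall p, D p -> h p = (X p * q p)%C.
  move=> p Hp; rewrite /q; case: excluded_middle_informative => E; first by rewrite E H0 // Cmult_0_l.
  by field.
exists q => p Hp; split; last exact: Hq.
have [r [Hr Hrp]] := open_polydisc p D (HD p Hp).
case: (excluded_middle_informative (X p = RtoC 0)) => Ep.
- pose D' (w : C2) := Cmod (X w - RtoC 0) < r /\ Cmod (Y w - Y p) < r.
  have HD' : open D' by exact: open_polydisc_open.
  have HDD : forall w, D' w -> D w by move=> w [H1 H2]; apply: Hrp => //; rewrite Ep.
  have Hst : forall w t, D' w -> 0 <= t <= 1 -> D' (star (RtoC 0) t w).
    move=> w t [H1 H2] Ht; split=> //.
    have -> : (X (star (RtoC 0) t w) - RtoC 0 = RtoC t * (X w - RtoC 0))%C by simpl; ring.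
    rewrite Cmod_mult Cmod_R Rabs_pos_eq; last lra.
    have := Cmod_ge_0 (X w - RtoC 0); nra.
  have Hdh' : forall w, D' w -> hol dh w by move=> w /HDD; exact: Hdhol.
  have Hp' : D' p by rewrite /D' Ep !Cminus_diag Cmod_0.
  have Hprim : forall w, D' w -> h w = primitive (RtoC 0) dh w.
    move=> w Hw.
    pose w0 : C2 := (RtoC 0, Y w); pose v : C2 := (X w, RtoC 0).
    have Est : forall t, plus w0 (scal (RtoC t) v) = star (RtoC 0) t w.
      move=> t; apply: injective_projections.
      - change (@eq C (RtoC 0 + RtoC t * X w)%C (RtoC 0 + RtoC t * (X w - RtoC 0))%C); ring.
      - change (@eq C (Y w + RtoC t * RtoC 0)%C (Y w)); ring.
    have Ew : plus w0 v = w.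
      apply: injective_projections.
      - change (@eq C (RtoC 0 + X w)%C (X w)); ring.
      - change (@eq C (Y w + RtoC 0)%C (Y w)); ring.
    have Hw0 : D' w0.
      have := Hst w 0 Hw ltac:(lra); congr D'.
      apply: injective_projections => //=; ring.
    have C0 := constant_on_segment (fun w => h w - primitive (RtoC 0) dh w)%C w0 v.
    rewrite Ew in C0.
    have P0 : primitive (RtoC 0) dh w0 = RtoC 0 by rewrite /primitive /=; ring.
    have h0 : h w0 = RtoC 0 by apply: H0 => //; exact: HDD.
    rewrite P0 h0 in C0.
    have -> : h w = (h w - primitive (RtoC 0) dh w + primitive (RtoC 0) dh w)%C by ring.
    rewrite C0; first ring.
    move=> t Ht; rewrite Est.
    have Ds := Hst w t Hw Ht.
    have [l1 [Hl1 El1]] := filterdiff_primitive D' (RtoC 0) dh (star (RtoC 0) t w) HD' Hst Hdh' Ds.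
    have [l2 [Hl2 El2]] := Hdh _ (HDD _ Ds).
    have Hd := filterdiff_minus_C _ _ _ _ _ Hl2 Hl1.
    eexists; split; first exact: Hd.
    change ((l2 v - l1 v)%C = RtoC 0).
    rewrite (linear_C2 l1 v (proj1 Hl1)) (linear_C2 l2 v (proj1 Hl2)) El1 -El2 /=; cring.
  apply: (hol_ext_loc (star_mean (RtoC 0) dh)); last first.
    by apply: (hol_star_mean D') => // t Ht; exact: Hst.
  have : locally p D' by exact: HD'.
  apply: filter_imp => w Hw.
  rewrite /q; case: excluded_middle_informative => Ew.
  + have Es : forall t, star (RtoC 0) t w = w.
      by move=> t; apply: injective_projections => //=; rewrite Ew; ring.
    rewrite /star_mean (RInt_ext _ (fun _ => fst (dh w))); last by move=> t _; rewrite Es.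
    rewrite (RInt_ext (fun t => snd _) (fun _ => snd (dh w))); last by move=> t _; rewrite Es.
    by rewrite !RInt_const /scal /= /mult /=; apply: injective_projections => /=; ring.
  + by rewrite (Hprim w Hw) /primitive Cminus_0_r; field.
- apply: (hol_ext_loc (fun w => h w / X w)%C).
    have Hx : 0 < Cmod (X p) by apply/Cmod_gt_0.
    apply: (locally_polydisc p (Cmod (X p)) _ Hx) => w Hw _.
    rewrite /q; case: excluded_middle_informative => // Ew.
    rewrite Ew in Hw.
    have E0 : (RtoC 0 - X p = - X p)%C by ring.
    rewrite E0 Cmod_opp in Hw; lra.
  by apply: hol_div => //; [exact: Hh|exact: hol_fst].
Qed.

(* Riemann: [x^2 g] extends with value and differential 0, then is divided
   twice by [x]. *)
Lemma removable_fst (D : C2 -> Prop) (g : C2 -> C) :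
  open D -> (forall p, D p -> X p <> RtoC 0 -> hol (E := C2) g p) ->
  (forall p, D p -> exists M, locally p (fun q : C2 => X q <> RtoC 0 -> Cmod (g q) <= M)) ->
  exists G, forall p, D p -> hol (E := C2) G p /\ (X p <> RtoC 0 -> G p = g p).
Proof.
move=> HD Hg Hb.
pose h (p : C2) : C := match excluded_middle_informative (X p = RtoC 0) with left _ => RtoC 0 | right _ => (X p * X p * g p)%C end.
have hE : forall p : C2, X p <> RtoC 0 -> h p = (X p * X p * g p)%C.
  by move=> p Hp; rewrite /h; case: excluded_middle_informative.
have h0 : forall p : C2, X p = RtoC 0 -> h p = RtoC 0.
  by move=> p Hp; rewrite /h; case: excluded_middle_informative.
have Hnz : forall p : C2, X p <> RtoC 0 -> locally p (fun w : C2 => X w <> RtoC 0).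
  move=> p Hp; have Hx : 0 < Cmod (X p) by apply/Cmod_gt_0.
  apply: (locally_polydisc p (Cmod (X p)) _ Hx) => w Hw _ Ew.
  rewrite Ew in Hw.
  have E0 : (RtoC 0 - X p = - X p)%C by ring.
  rewrite E0 Cmod_opp in Hw; lra.
have Hhol : forall p, D p -> hol (E := C2) h p.
  move=> p Hp; case: (excluded_middle_informative (X p = RtoC 0)) => Ep.
  - exists (fun _ => RtoC 0); apply/filterdiff_eps; split; first exact: is_linear_zero.
    move=> eps He.
    have [M /locally_nball [r [Hr HM]]] := Hb p Hp.
    have HM0 := Rabs_pos M.
    exists (Rmin r (eps / (Rabs M + 1))); split.
      by apply: Rmin_pos => //; apply: Rdiv_lt_0_compat; lra.
    move=> v Hv.
    have Hv1 := Rlt_le_trans _ _ _ Hv (Rmin_l _ _).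
    have Hv2 := Rlt_le_trans _ _ _ Hv (Rmin_r _ _).
    have Hv0 := norm_ge_0 v.
    rewrite (h0 p Ep).
    change (Cmod (h (plus p v) - RtoC 0 - RtoC 0) <= eps * norm v).
    rewrite !Cminus_0_r.
    case: (excluded_middle_informative (X (plus p v) = RtoC 0)) => Epv.
      by rewrite (h0 _ Epv) Cmod_0; nra.
    have Ex : X (plus p v) = X v.
      by change ((X p + X v)%C = X v); rewrite Ep; ring.
    have Hn : nball p r (plus p v) by rewrite /nball plus_minus_l.
    have Hgb := HM _ Hn Epv.
    rewrite (hE _ Epv) !Cmod_mult Ex.
    have Hxv := Cmod_fst_le v; have Hx0 := Cmod_ge_0 (X v).
    have Hgb' : Cmod (g (plus p v)) <= Rabs M + 1 by have := Rle_abs M; lra.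
    have Hg0 := Cmod_ge_0 (g (plus p v)).
    have Hv3 : norm v * (Rabs M + 1) <= eps.
      have -> : eps = eps / (Rabs M + 1) * (Rabs M + 1) by field; lra.
      by apply: Rmult_le_compat_r; lra.
    have T1 : Cmod (X v) * Cmod (g (plus p v)) <= norm v * (Rabs M + 1).
      by apply: Rmult_le_compat.
    have T2 : Cmod (X v) * (Cmod (X v) * Cmod (g (plus p v))) <= norm v * eps.
      apply: Rmult_le_compat => //; last lra.
      exact: Rmult_le_pos.
    by rewrite Rmult_assoc; apply: Rle_trans T2 _; lra.
  - apply: (hol_ext_loc (fun w : C2 => X w * X w * g w)%C).
      by apply: filter_imp (Hnz p Ep) => w /hE.
    apply: hol_mult; last exact: Hg.
    by apply: hol_mult; exact: hol_fst.
have [q1 Hq1] := quotient_fst D h HD Hhol (fun p _ => h0 p).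
have Hq1g : forall p : C2, D p -> X p <> RtoC 0 -> q1 p = (X p * g p)%C.
  move=> p Hp Ep; have := proj2 (Hq1 p Hp); rewrite (hE p Ep) => E.
  have -> : q1 p = (X p * q1 p / X p)%C by field.
  by rewrite -E; field.
(* Off the line [q1] is [X g] with [g] bounded, so by continuity it vanishes on the line. *)
have Hq10 : forall p : C2, D p -> X p = RtoC 0 -> q1 p = RtoC 0.
  move=> p Hp Ep.
  rewrite -(Cminus_0_r (q1 p)); apply: Ceq_eps => eps He.
  rewrite !Cminus_0_r.
  have [M /locally_nball [r [Hr HM]]] := Hb p Hp.
  have [d [Hd Hc]] := hol_continuous q1 p (proj1 (Hq1 p Hp)) (eps / 2) ltac:(lra).
  have /locally_nball [s [Hs HsD]] := HD p Hp.
  have HM0 := Rabs_pos M.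
  pose t := Rmin (Rmin r (Rmin s d)) (eps / (4 * (Rabs M + 1))).
  have Ht : 0 < t.
    by rewrite /t; repeat apply: Rmin_pos => //; apply: Rdiv_lt_0_compat; lra.
  have Ht1 : t <= Rmin r (Rmin s d) by exact: Rmin_l.
  have Ht2 : t <= eps / (4 * (Rabs M + 1)) by exact: Rmin_r.
  have := Rmin_l r (Rmin s d); have := Rmin_r r (Rmin s d).
  have := Rmin_l s d; have := Rmin_r s d => M1 M2 M3 M4.
  pose w : C2 := plus p (scal (RtoC (t / 2)) e1).
  have Ew : X w = RtoC (t / 2).
    by change ((X p + RtoC (t / 2) * RtoC 1)%C = RtoC (t / 2)); rewrite Ep; ring.
  have Hwt : norm (minus w p) < t.
    rewrite /w plus_minus_l; apply: Rle_lt_trans (norm_C2_le _) _.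
    change (Cmod (RtoC (t / 2) * RtoC 1) + Cmod (RtoC (t / 2) * RtoC 0) < t).
    rewrite Cmult_1_r Cmult_0_r Cmod_0 Cmod_R Rabs_pos_eq; lra.
  have Ew0 : X w <> RtoC 0 by rewrite Ew => /RtoC_inj; lra.
  have B1 := Hc w ltac:(lra).
  have B2 := HM w ltac:(rewrite /nball; lra) Ew0.
  have B3 := Hq1g w (HsD w ltac:(rewrite /nball; lra)) Ew0.
  have B4 : Cmod (q1 w) <= eps / 2.
    rewrite B3 Cmod_mult Ew Cmod_R Rabs_pos_eq; last lra.
    have : t * (4 * (Rabs M + 1)) <= eps.
      have -> : eps = eps / (4 * (Rabs M + 1)) * (4 * (Rabs M + 1)) by field; lra.
      by apply: Rmult_le_compat_r; lra.
    have := Rle_abs M; have := Cmod_ge_0 (g w); nra.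
  have := Cmod_triangle_sub (q1 w) (q1 w - q1 p).
  have -> : (q1 w - (q1 w - q1 p) = q1 p)%C by ring.
  lra.
have [q2 Hq2] := quotient_fst D q1 HD (fun p Hp => proj1 (Hq1 p Hp)) Hq10.
exists q2 => p Hp; split; first exact: (proj1 (Hq2 p Hp)).
move=> Ep; have := proj2 (Hq2 p Hp); rewrite (Hq1g p Hp Ep) => E.
have -> : q2 p = (X p * q2 p / X p)%C by field.
by rewrite -E; field.
Qed.

(** * Holomorphic fixed points and local inverses *)

Lemma hol_pow {E : NormedModule C_AbsRing} (f : E -> C) (p : E) (n : nat) :
  hol f p -> hol (fun q => Cpow (f q) n) p.
Proof.
move=> Hf; elim: n => [|n IH] /=; first exact: hol_const.
exact: hol_mult.
Qed.

Lemma geometric_small (a eps : R) : 0 <= a -> 0 < eps -> exists n, a * (2 / 3) ^ n < eps.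
Proof.
move=> Ha He.
have [N HN] := pow_lt_1_zero (2 / 3) ltac:(rewrite Rabs_pos_eq; lra) (eps / (a + 1)) ltac:(apply: Rdiv_lt_0_compat; lra).
exists N; have := HN N (Nat.le_refl N).
have Hp : 0 < (2 / 3) ^ N by apply: pow_lt; lra.
rewrite Rabs_pos_eq; last lra.
move=> H.
have : (2 / 3) ^ N * (a + 1) < eps.
  have -> : eps = eps / (a + 1) * (a + 1) by field; lra.
  by apply: Rmult_lt_compat_r; lra.
nra.
Qed.

(* [phi z / z^n] is holomorphic since [phi] vanishes near 0; on the circle of
   centre 1 and radius 5/2 one has [|z| >= 3/2]. *)
Lemma vanishing_at_1 (phi : C -> C) (d M : R) :
  0 < d -> (forall z : C, Cmod z < 4 -> hol (E := C_NormedModule) phi z /\ Cmod (phi z) <= M) ->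
  (forall z : C, Cmod z < d -> phi z = RtoC 0) -> phi (RtoC 1) = RtoC 0.
Proof.
move=> Hd Hphi H0.
have HM : 0 <= M.
  by apply: Rle_trans (Cmod_ge_0 _) (proj2 (Hphi (RtoC 0) _)); rewrite Cmod_0; lra.
rewrite -(Cminus_0_r (phi _)); apply: Ceq_eps => eps He; rewrite !Cminus_0_r.
have [n Hn] := geometric_small M eps HM He.
apply: Rle_trans (_ : M * (2 / 3) ^ n <= _); last lra.
have Hpow : forall z : C, z <> RtoC 0 -> Cpow z n <> RtoC 0.
  move=> z Hz /(f_equal Cmod); rewrite Cmod_pow Cmod_0.
  by apply: pow_nonzero => /Cmod_eq_0.
have Hq : forall w : C, Cmod w < 4 -> hol (E := C_NormedModule) (fun w : C => phi w / Cpow w n)%C w.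
  move=> w Hw; case: (excluded_middle_informative (w = RtoC 0)) => Ew.
  - apply: (hol_ext_loc (fun _ => RtoC 0)); last exact: hol_const.
    apply/locally_nball; exists d; split=> // z Hz.
    have {}Hz : Cmod (z - w) < d := Hz.
    rewrite Ew Cminus_0_r in Hz.
    by rewrite H0 // /Cdiv Cmult_0_l.
  - apply: hol_div; [exact: (proj1 (Hphi w Hw))|apply: hol_pow; exact: hol_id|exact: Hpow].
have Hsh : forall w : C, Cmod w <= Cmod (w - 1) + 1.
  move=> w; have := Cmod_triangle (w - 1) 1.
  have -> : (w - 1 + 1 = w)%C by ring.
  rewrite Cmod_1; lra.
apply: (center_limit_bound (fun w : C => phi w / Cpow w n)%C (RtoC 1) _ 3 (5 / 2)); first lra.
- by move=> w Hw; apply: Hq; have := Hsh w; lra.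
- move=> eps' He'.
  have [d' [Hd' Hc]] := hol_continuous _ _ (Hq (RtoC 1) ltac:(rewrite Cmod_1; lra)) eps' He'.
  exists d'; split=> // w Hw.
  have := Hc w (proj2 Hw).
  have -> : Cpow (RtoC 1) n = RtoC 1.
    by elim: n {Hn Hpow Hq Hc} => //= m ->; ring.
  have -> : (phi (RtoC 1) / RtoC 1 = phi (RtoC 1))%C by field; move=> /RtoC_inj; lra.
  by [].
- move=> w Hw.
  have Hw4 : Cmod w < 4 by have := Hsh w; lra.
  have Hw3 : 3 / 2 <= Cmod w.
    have := Cmod_triangle_sub w 1; rewrite Cmod_1; lra.
  have Hw0 : w <> RtoC 0 by apply/Cmod_gt_0; lra.
  rewrite Cmod_div; last exact: Hpow.
  rewrite Cmod_pow.
  apply: Rmult_le_compat; [exact: Cmod_ge_0|left; apply: Rinv_0_lt_compat; apply: pow_lt; lra|exact: (proj2 (Hphi w Hw4))|].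
  have -> : 2 / 3 = / (3 / 2) by field.
  rewrite pow_inv; apply: Rinv_le_contravar; first by apply: pow_lt; lra.
  by apply: pow_incr; lra.
Qed.

(** Restrict [f] to the complex line from [b] to [a]: since [|a - b| < r / 4], the parameter runs
    over a disc of radius 4, as [vanishing_at_1] asks. *)
Lemma identity_quarter_ball {E : NormedModule C_AbsRing} (f : E -> C) (b : E) (r M d : R) :
  0 < r -> 0 < d -> hol_on f b r M -> (forall q, nball b d q -> f q = RtoC 0) ->
  forall a, nball b (r / 4) a -> f a = RtoC 0.
Proof.
move=> Hr Hd Hf H0 a Ha.
set v := minus a b.
have Ev : plus b (scal (RtoC 1) v) = a by rewrite (scal_one (K := C_AbsRing)) plus_minus_eq.
rewrite -Ev.
have Hv : norm v < r / 4 by exact: Ha.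
have Hv0 := norm_ge_0 v.
apply: (vanishing_at_1 (fun z => f (plus b (scal z v))) (d / (norm v + 1)) M).
- by apply: Rdiv_lt_0_compat; lra.
- move=> z Hz.
  have Hb : nball b r (plus b (scal z v)).
    rewrite /nball plus_minus_l; apply: Rle_lt_trans (norm_scal_C _ _) _.
    have := Cmod_ge_0 z; nra.
  have [[l Hl] HM] := Hf _ Hb.
  by split=> //; apply/hol_cderiv; eexists; exact: hol_line Hl.
- move=> z Hz; apply: H0; rewrite /nball plus_minus_l.
  apply: Rle_lt_trans (norm_scal_C _ _) _.
  have : Cmod z * (norm v + 1) < d.
    have -> : d = d / (norm v + 1) * (norm v + 1) by field; lra.
    by apply: Rmult_lt_compat_r; lra.
  have := Cmod_ge_0 z; nra.
Qed.

Definition hol_bounded {E : NormedModule C_AbsRing} (D : E -> Prop) (k : R) (u : E -> C) : Prop :=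
  forall p, D p -> hol u p /\ Cmod (u p) <= k.

(** Picard iteration from 0. Convergence is uniform on [D], so the limit is holomorphic in all the
    variables, parameters included. *)
Lemma hol_fixed_point {E : NormedModule C_AbsRing} (D : E -> Prop) (k : R)
    (B : (E -> C) -> E -> C) :
  open D -> 0 <= k ->
  (forall u, hol_bounded D k u -> hol_bounded D k (B u)) ->
  (forall u w e, 0 <= e -> hol_bounded D k u -> hol_bounded D k w ->
     (forall p, D p -> Cmod (u p - w p) <= e) ->
     forall p, D p -> Cmod (B u p - B w p) <= e / 2) ->
  exists u, hol_bounded D k u /\ forall p, D p -> u p = B u p.
Proof.
move=> HD Hk HB Hc.
pose u n := Nat.iter n B (fun _ => RtoC 0).
have Hu : forall n, hol_bounded D k (u n).
  elim=> [|n IH]; last exact: HB.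
  by move=> p Hp; split; [exact: hol_const|rewrite Cmod_0].
have Hpow : forall n, 0 < (/ 2) ^ n by move=> n; apply: pow_lt; lra.
have Hstep : forall n p, D p -> Cmod (u (S n) p - u n p) <= k * (/ 2) ^ n.
  elim=> [|n IH] p Hp.
  - have := proj2 (Hu 1%nat p Hp); rewrite /= Cminus_0_r; lra.
  - have -> : k * (/ 2) ^ S n = k * (/ 2) ^ n / 2 by simpl; field.
    apply: (Hc (u (S n)) (u n)) => //.
    by apply: Rmult_le_pos => //; left.
have Hdist : forall m n p, D p -> Cmod (u (n + m)%nat p - u n p) <= 2 * k * (/ 2) ^ n * (1 - (/ 2) ^ m).
  elim=> [|m IH] n p Hp.
    by rewrite Nat.add_0_r Cminus_diag Cmod_0 /=; lra.
  rewrite Nat.add_succ_r.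
  have -> : (u (S (n + m)) p - u n p = (u (S (n + m)) p - u (n + m)%nat p) + (u (n + m)%nat p - u n p))%C by ring.
  apply: Rle_trans (Cmod_triangle _ _) _.
  have H1 := Hstep (n + m)%nat p Hp; have H2 := IH n p Hp.
  rewrite pow_add in H1.
  have -> : (/ 2) ^ S m = / 2 * (/ 2) ^ m by [].
  have -> : 2 * k * (/ 2) ^ n * (1 - / 2 * (/ 2) ^ m) = k * ((/ 2) ^ n * (/ 2) ^ m) + 2 * k * (/ 2) ^ n * (1 - (/ 2) ^ m) by field.
  lra.
have Hdist2 : forall n m p, (n <= m)%nat -> D p -> Cmod (u m p - u n p) <= 2 * k * (/ 2) ^ n.
  move=> n m p Hnm Hp.
  have := Hdist (m - n)%nat n p Hp; rewrite (Nat.add_comm n) Nat.sub_add // => H.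
  apply: Rle_trans H _.
  have H1 := Hpow n; have H2 := Hpow (m - n)%nat.
  have : 0 <= 2 * k * (/ 2) ^ n by apply: Rmult_le_pos; lra.
  nra.
have Hsmall : forall eps, 0 < eps -> exists n, 2 * k * (/ 2) ^ n < eps.
  move=> eps He; have [n Hn] := geometric_small (2 * k) eps ltac:(lra) He.
  exists n; apply: Rle_lt_trans Hn; apply: Rmult_le_compat_l; first lra.
  by apply: pow_incr; lra.
have [w Hw] : exists w : E -> C, forall p, D p -> forall n, Cmod (u n p - w p) <= 2 * k * (/ 2) ^ n.
  apply: (choice_on (RtoC 0) D (fun p wp => forall n, Cmod (u n p - wp) <= 2 * k * (/ 2) ^ n)) => p Hp.
  have [l Hl] : exists l : C, forall eps, 0 < eps -> exists N, forall n, (N <= n)%nat -> Cmod (u n p - l) < eps.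
    apply: C_cauchy_complete => eps He.
    have [N HN] := Hsmall (eps / 2) ltac:(lra).
    exists N => n m Hn Hm.
    have -> : (u n p - u m p = (u n p - u N p) - (u m p - u N p))%C by ring.
    apply: Rle_lt_trans (Cmod_triangle_sub _ _) _.
    have := Hdist2 N n p Hn Hp; have := Hdist2 N m p Hm Hp; lra.
  exists l => n; apply: le_epsilon => eps He.
  have [N HN] := Hl eps He.
  have H1 := HN (max n N) ltac:(lia); have H2 := Hdist2 n (max n N) p ltac:(lia) Hp.
  have -> : (u n p - l = (u (max n N) p - l) - (u (max n N) p - u n p))%C by ring.
  by apply: Rle_trans (Cmod_triangle_sub _ _) _; lra.
have Hwb : hol_bounded D k w.
  move=> p Hp; split.
  - have /locally_nball [r [Hr HrD]] := HD p Hp.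
    apply: (hol_unif_limit w p r Hr) => eps He.
    have [n Hn] := Hsmall eps He.
    exists (u n) => q /HrD Hq; split; first exact: (proj1 (Hu n q Hq)).
    by apply: Rle_trans (Hw q Hq n) _; lra.
  - apply: le_epsilon => eps He; have [n Hn] := Hsmall eps He.
    have H1 := Hw p Hp n; have H2 := proj2 (Hu n p Hp).
    have -> : w p = (u n p - (u n p - w p))%C by ring.
    by apply: Rle_trans (Cmod_triangle_sub _ _) _; lra.
exists w; split=> // p Hp; apply: Ceq_eps => eps He.
have [n Hn] := Hsmall (eps / 2) ltac:(lra).
have H1 := Hw p Hp (S n).
have H2 : Cmod (u (S n) p - B w p) <= 2 * k * (/ 2) ^ n / 2.
  apply: (Hc (u n) w) => //.
  - by apply: Rmult_le_pos; [lra|left].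
  - by move=> q Hq; exact: Hw.
have -> : (w p - B w p = (u (S n) p - B w p) - (u (S n) p - w p))%C by ring.
apply: Rle_trans (Cmod_triangle_sub _ _) _.
have -> : eps = eps / 2 + eps / 2 by field.
have H3 : 2 * k * (/ 2) ^ S n = 2 * k * (/ 2) ^ n / 2 by simpl; field.
have := Hpow n; nra.
Qed.

(** With [N] the quadratic remainder of [f] at [a], the equation [f (a + w) = z] reads
    [w = (z - f a) / b - N w / b]. Solving it among functions of [z] yields an inverse that is
    holomorphic by construction. *)
Lemma local_inverse (f : C -> C) (a b : C) (r : R) :
  0 < r -> (forall z : C, Cmod (z - a) < r -> hol (E := C_NormedModule) f z) ->
  cderiv f a b -> b <> RtoC 0 ->
  exists (g : C -> C) (eps del : R), 0 < eps /\ 0 < del <= r /\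
    (forall z : C, Cmod (z - f a) < eps ->
       hol (E := C_NormedModule) g z /\ Cmod (g z - a) < del /\ f (g z) = z) /\
    (forall y : C, Cmod (y - a) < del -> Cmod (f y - f a) < eps -> g (f y) = y).
Proof.
move=> Hr Hf Hb Hb0.
have [s [M [Hs [HM Hon]]]] := hol_bounded_near (E := C_NormedModule) f a r Hr Hf.
have Hbp : 0 < Cmod b by apply/Cmod_gt_0.
pose N (w : C) : C := (f (a + w) - f a - b * w)%C.
set K := 128 * M / (s * s).
have HK : 0 <= K by apply: Rdiv_le_0_compat; [lra|nra].
have HN : forall w : C, Cmod w < s / 4 -> Cmod (N w) <= K * (Cmod w * Cmod w).
  by move=> w Hw; exact: (second_order_remainder (E := C_NormedModule) f a w _ s M (proj1 Hs) Hon Hb Hw).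
(* Makes [N] Lipschitz on the half ball with constant [8 K rho <= |b| / 4]. *)
set rho := Rmin (s / 4) (Cmod b / (32 * (K + 1))).
have Hrho : 0 < rho by apply: Rmin_pos; [lra|apply: Rdiv_lt_0_compat; lra].
have Hrho1 : rho <= s / 4 by exact: Rmin_l.
have Hrho2 : rho * (32 * (K + 1)) <= Cmod b.
  have -> : Cmod b = Cmod b / (32 * (K + 1)) * (32 * (K + 1)) by field; lra.
  by apply: Rmult_le_compat_r; [lra|exact: Rmin_r].
have Hfh : forall w : C, Cmod w < s -> hol (E := C_NormedModule) f (a + w)%C.
  move=> w Hw; apply: (fun h => proj1 (Hon _ h)).
  by change (Cmod (a + w - a) < s); have -> : (a + w - a = w)%C by ring.
have Hshift : forall w : C, hol (E := C_NormedModule) (fun w : C => a + w)%C w.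
  by move=> w; apply: hol_plus; [exact: hol_const|exact: hol_id].
have HNon : hol_on (E := C_NormedModule) N (RtoC 0) rho (K * (rho * rho)).
  move=> w Hw0; have {}Hw0 : Cmod (w - RtoC 0) < rho := Hw0.
  rewrite Cminus_0_r in Hw0; split.
  - apply: hol_minus; last by apply: hol_mult; [exact: hol_const|exact: hol_id].
    apply: hol_minus; last exact: hol_const.
    by apply: (hol_comp (E := C_NormedModule) f) => //; apply: Hfh; lra.
  - apply: Rle_trans (HN w _) _; first lra.
    apply: Rmult_le_compat_l => //.
    have := Cmod_ge_0 w; nra.
have HNlip : forall w w' : C, Cmod w < rho / 2 -> Cmod w' < rho / 2 ->
    Cmod (N w - N w') <= Cmod b / 2 * Cmod (w - w').
  move=> w w' Hw Hw'.
  have Hb1 : nball (E := C_NormedModule) (RtoC 0) (rho / 2) w.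
    by change (Cmod (w - RtoC 0) < rho / 2); rewrite Cminus_0_r.
  have Hb2 : nball (E := C_NormedModule) (RtoC 0) (rho / 2) w'.
    by change (Cmod (w' - RtoC 0) < rho / 2); rewrite Cminus_0_r.
  apply: Rle_trans (lipschitz_half_ball (E := C_NormedModule) N (RtoC 0) w' w rho _ Hrho HNon Hb2 Hb1) _.
  apply: Rmult_le_compat_r; first exact: Cmod_ge_0.
  have -> : 8 * (K * (rho * rho)) / rho = 8 * K * rho by field; lra.
  nra.
have HfN : forall w : C, f (a + w)%C = (f a + b * w + N w)%C by move=> w; rewrite /N; ring.
(* [|z - f a| < eps] contributes at most [del / 4] and [N] at most half of [7 / 8 del], so the bound
   [7 / 8 del] is preserved; being below [del], it gives the strict inequality on [g z]. *)
pose del := rho / 4; pose eps := Cmod b * del / 4.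
have Hdel : 0 < del by rewrite /del; lra.
have Heps : 0 < eps by rewrite /eps; nra.
have HN0 : N (RtoC 0) = RtoC 0 by rewrite /N Cplus_0_r; ring.
have Huniq : forall w w' : C, Cmod w < rho / 2 -> Cmod w' < rho / 2 -> f (a + w)%C = f (a + w')%C -> w = w'.
  move=> w w' Hw Hw' E.
  have HL := HNlip w w' Hw Hw'.
  have E2 : (N w - N w' = - (b * (w - w')))%C.
    rewrite !HfN in E.
    have -> : (N w - N w' = (f a + b * w + N w) - (f a + b * w' + N w') - b * (w - w'))%C by ring.
    by rewrite E; ring.
  rewrite E2 Cmod_opp Cmod_mult in HL.
  have : Cmod (w - w') = 0.
    have := Cmod_ge_0 (w - w'); nra.
  move=> /Cmod_eq_0 E3.
  have -> : w = (w - w' + w')%C by ring.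
  by rewrite E3; ring.
pose D (z : C) := Cmod (z - f a) < eps.
pose B (u : C -> C) (z : C) : C := ((z - f a) / b - N (u z) / b)%C.
have HD : open (T := C_NormedModule) D.
  move=> z Hz; apply/locally_nball; exists (eps - Cmod (z - f a)).
  split; first by rewrite /D in Hz; lra.
  move=> w Hw; have {}Hw : Cmod (w - z) < eps - Cmod (z - f a) := Hw.
  rewrite /D; have := Cmod_triangle (w - z) (z - f a).
  have -> : (w - z + (z - f a) = w - f a)%C by ring.
  lra.
have Hdiv : forall x : C, Cmod (x / b) = Cmod x / Cmod b by move=> x; rewrite Cmod_div.
have Hz0 : Cmod (RtoC 0) < rho / 2 by rewrite Cmod_0; lra.
have HB1 : forall u, hol_bounded (E := C_NormedModule) D (7 / 8 * del) u ->
    hol_bounded (E := C_NormedModule) D (7 / 8 * del) (B u).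
  move=> u Hu z Hz; have [Hu1 Hu2] := Hu z Hz; split.
  - apply: hol_minus.
    + apply: hol_mult; last exact: hol_const.
      by apply: hol_minus; [exact: hol_id|exact: hol_const].
    + apply: hol_mult; last exact: hol_const.
      apply: (hol_comp (E := C_NormedModule) N) => //.
      apply: (fun h => proj1 (HNon _ h)).
      by change (Cmod (u z - RtoC 0) < rho); rewrite Cminus_0_r; rewrite /del in Hu2; lra.
  - rewrite /B; apply: Rle_trans (Cmod_triangle_sub _ _) _.
    rewrite !Hdiv.
    have HL := HNlip (u z) (RtoC 0) ltac:(rewrite /del in Hu2; lra) Hz0.
    rewrite HN0 !Cminus_0_r in HL.
    apply: (Rmult_le_reg_r (Cmod b)) => //.
    have -> : (Cmod (z - f a) / Cmod b + Cmod (N (u z)) / Cmod b) * Cmod b =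
      Cmod (z - f a) + Cmod (N (u z)) by field; lra.
    rewrite /D /eps in Hz; nra.
have HB2 : forall u w e, 0 <= e -> hol_bounded (E := C_NormedModule) D (7 / 8 * del) u ->
    hol_bounded (E := C_NormedModule) D (7 / 8 * del) w ->
    (forall z, D z -> Cmod (u z - w z) <= e) ->
    forall z, D z -> Cmod (B u z - B w z) <= e / 2.
  move=> u w e He Hu Hw Hd z Hz.
  have Hu2 := proj2 (Hu z Hz); have Hw2 := proj2 (Hw z Hz); have Hd2 := Hd z Hz.
  have -> : (B u z - B w z = - ((N (u z) - N (w z)) / b))%C by rewrite /B; field.
  rewrite Cmod_opp Hdiv.
  have HL := HNlip (u z) (w z) ltac:(rewrite /del in Hu2; lra) ltac:(rewrite /del in Hw2; lra).
  apply: (Rmult_le_reg_r (Cmod b)) => //.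
  have -> : Cmod (N (u z) - N (w z)) / Cmod b * Cmod b = Cmod (N (u z) - N (w z)) by field; lra.
  nra.
have Hk : 0 <= 7 / 8 * del by lra.
have [u [Hu Hfix]] := hol_fixed_point (E := C_NormedModule) D (7 / 8 * del) B HD Hk HB1 HB2.
have Hsol : forall z : C, D z -> f (a + u z)%C = z.
  by move=> z Hz; rewrite HfN {1}(Hfix z Hz) /B; field.
exists (fun z => a + u z)%C, eps, del; split=> //; split; first by split=> //; rewrite /del; lra.
split.
- move=> z Hz; have [Hu1 Hu2] := Hu z Hz; split; last split.
  + by apply: hol_plus => //; exact: hol_const.
  + have -> : (a + u z - a = u z)%C by ring.
    lra.
  + exact: Hsol.
- move=> y Hy Hfy.
  have E : (y - a)%C = u (f y).
    apply: Huniq; first by rewrite /del in Hy; lra.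
      by have := proj2 (Hu (f y) Hfy); rewrite {1}/del; lra.
    rewrite Hsol //; congr f; ring.
  rewrite -E; ring.
Qed.

(** * Leaves in the logarithmic coordinate *)

Lemma Cexp_lipschitz (u w : C) :
  Cmod u <= 1 -> Cmod w <= 1 -> Cmod (Cexp u - Cexp w) <= exp 1 * Cmod (u - w).
Proof.
move=> Hu Hw.
have H := mean_value_inequality (fun t => Cexp (w + RtoC t * (u - w)))
  (fun t => (u - w) * Cexp (w + RtoC t * (u - w)))%C
  (fun t => exp 1 * Cmod (u - w) * t) (fun _ => exp 1 * Cmod (u - w)) 0 1 ltac:(lra) _ _ _.
have E1 : (w + RtoC 1 * (u - w) = u)%C by ring.
have E0 : (w + RtoC 0 * (u - w) = w)%C by ring.
rewrite E1 E0 in H; apply: Rle_trans (H _ _ _) _; last lra.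
- move=> t _.
  have [H1 H2] := rderiv_Cexp (u - w) t.
  have Ew : forall s, Cexp (w + RtoC s * (u - w)) = (Cexp w * Cexp (RtoC s * (u - w)))%C.
    by move=> s; rewrite Cexp_plus.
  by rewrite /rderiv /Cexp /=; split; auto_derive=> //; rewrite /Rminus; ring.
- by move=> t _; auto_derive=> //; ring.
- move=> t Ht; rewrite Cmod_mult Cmod_Cexp Rmult_comm.
  apply: Rmult_le_compat_r; first exact: Cmod_ge_0.
  apply: exp_le_exp; apply: Rle_trans (fst_le_Cmod _) _.
  have -> : (w + RtoC t * (u - w) = RtoC t * u + RtoC (1 - t) * w)%C by rewrite RtoC_minus; ring.
  apply: Rle_trans (Cmod_triangle _ _) _.
  rewrite !Cmod_mult !Cmod_R !Rabs_pos_eq; nra.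
Qed.

Lemma open_hol_lt {E : NormedModule C_AbsRing} (h : E -> C) (k : R) :
  (forall p, hol h p) -> open (fun p => Cmod (h p) < k).
Proof.
move=> Hh p Hp; apply/locally_nball.
have [d [Hd H]] := hol_continuous h p (Hh p) (k - Cmod (h p)) ltac:(lra).
exists d; split=> // q Hq.
have := H q Hq; have := Cmod_triangle (h q - h p) (h p).
have -> : (h q - h p + h p = h q)%C by ring.
lra.
Qed.

Lemma primitive_diff_bound (D : C2 -> Prop) (a : C) (g1 g2 : C2 -> C) (p : C2) (M dM : R -> R) :
  open D -> (forall q t, D q -> 0 <= t <= 1 -> D (star a t q)) ->
  (forall q, D q -> hol g1 q) -> (forall q, D q -> hol g2 q) -> D p ->
  (forall t, 0 <= t <= 1 -> is_derive M t (dM t)) ->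
  (forall t, 0 <= t <= 1 ->
     Cmod (X p - a) * Cmod (g1 (star a t p) - g2 (star a t p)) <= dM t) ->
  Cmod (primitive a g1 p - primitive a g2 p) <= M 1 - M 0.
Proof.
move=> HD Hst H1 H2 Hp HM Hle.
pose v : C2 := ((X p - a)%C, RtoC 0).
pose p0 : C2 := (a, Y p).
have E : forall t, star a t p = plus p0 (scal (RtoC t) v).
  move=> t; apply: injective_projections.
  - by [].
  - change (@eq C (Y p) (Y p + RtoC t * RtoC 0)%C); ring.
have H := mean_value_inequality
  (fun t => primitive a g1 (star a t p) - primitive a g2 (star a t p))%C
  (fun t => (X p - a) * (g1 (star a t p) - g2 (star a t p)))%C M dM 0 1 ltac:(lra) _ HM _.
have E0 : (primitive a g1 (star a 0 p) - primitive a g2 (star a 0 p))%C = RtoC 0.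
  by rewrite /primitive /=; ring.
rewrite star_1 E0 Cminus_0_r in H; apply: H.
- move=> t Ht.
  have Dt := Hst p t Hp Ht.
  have [l1 [Hl1 El1]] := filterdiff_primitive D a g1 _ HD Hst H1 Dt.
  have [l2 [Hl2 El2]] := filterdiff_primitive D a g2 _ HD Hst H2 Dt.
  have Hl := filterdiff_minus_C _ _ _ _ _ Hl1 Hl2.
  rewrite E in Hl.
  have [G1 G2] := rderiv_line _ p0 v t _ Hl.
  have El : (l1 v - l2 v = (X p - a) * (g1 (star a t p) - g2 (star a t p)))%C.
    rewrite (linear_C2 l1 v (proj1 Hl1)) (linear_C2 l2 v (proj1 Hl2)) El1 El2 /=; ring.
  rewrite El in G1 G2.
  split; [apply: is_derive_ext G1|apply: is_derive_ext G2] => s; by rewrite E.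
- by move=> t Ht; rewrite Cmod_mult; exact: Hle.
Qed.

(* Boxes [|x| < rho, |y| < del] on which [f] is defined and bounded by 1; [A]
   is the set of the pairs [(rho, del)] in use, [exp s0] the base point. *)
Definition tame (A : R -> R -> Prop) (r : R) (s0 : C) (f : C2 -> C) : Prop :=
  forall rho del, A rho del ->
    Cmod (Cexp s0) < rho <= r /\ 0 < del <= 1 /\
    forall x y : C, Cmod x < rho -> Cmod y < del ->
      hol (E := C2) f (x, y) /\ Cmod (f (x, y)) <= 1 /\ f (x, RtoC 0) = RtoC 0.

Definition strip (L : R) (s0 s : C) : Prop := Rabs (snd s - snd s0) < L.

(* The flow [exp (lambda (s - s0))] of the linear part of [omega] in the
   coordinate [s = log x]. *)
Definition lin (lambda : R) (s0 s : C) : C := Cexp (RtoC lambda * (s - s0)).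

(* Coordinates [(s, c)] where [c] is the value at [s0] of the leaf. *)
Definition leaf_dom (lambda L : R) (A : R -> R -> Prop) (s0 : C) (eta : R) (p : C2) : Prop :=
  strip L s0 (X p) /\ exists rho del, A rho del /\ Cmod (Cexp (X p)) < rho /\
    Cmod (Y p) < eta * del /\ Cmod (Y p * lin lambda s0 (X p)) < eta * del.

(** [u] is the logarithm of the correction to the linear flow: the leaf equation
    [y' = (lambda + f) y] becomes [u' = f] along the leaf. *)
Definition leaf (lambda : R) (s0 : C) (u : C2 -> C) (p : C2) : C :=
  (Y p * lin lambda s0 (X p) * Cexp (u p))%C.

Lemma hol_lin {E : NormedModule C_AbsRing} (lambda : R) (s0 : C) (f : E -> C) (p : E) :
  hol f p -> hol (fun q => lin lambda s0 (f q)) p.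
Proof.
move=> Hf; apply: hol_Cexp; apply: hol_mult; first exact: hol_const.
by apply: hol_minus => //; exact: hol_const.
Qed.

Lemma Cmod_lin (lambda : R) (s0 s : C) :
  Cmod (lin lambda s0 s) = exp (lambda * (fst s - fst s0)).
Proof. by rewrite /lin Cmod_Cexp /=; congr exp; ring. Qed.

Lemma strip_open (L : R) (s0 : C) (p : C2) : strip L s0 (X p) -> locally p (fun q : C2 => strip L s0 (X q)).
Proof.
rewrite /strip => H.
apply: (locally_polydisc p (L - Rabs (snd (X p) - snd s0))); first lra.
move=> q Hq _.
have := Rle_lt_trans _ _ _ (Rabs_snd_le_Cmod (X q - X p)%C) Hq.
have := Rabs_triang (snd (X q - X p)%C) (snd (X p) - snd s0).
have -> : snd (X q - X p)%C + (snd (X p) - snd s0) = snd (X q) - snd s0 by simpl; ring.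
lra.
Qed.

Lemma leaf_dom_open lambda L A s0 eta : open (leaf_dom lambda L A s0 eta).
Proof.
move=> p [Hs [rho [del [HA [H1 [H2 H3]]]]]].
have L1 : locally p (fun q : C2 => Cmod (Cexp (X q)) < rho).
  by apply: (open_hol_lt (E := C2) (fun q => Cexp (X q))) => // q; apply: hol_Cexp; exact: hol_fst.
have L2 : locally p (fun q : C2 => Cmod (Y q) < eta * del).
  by apply: (open_hol_lt (E := C2) (fun q => Y q)) => // q; exact: hol_snd.
have L3 : locally p (fun q : C2 => Cmod (Y q * lin lambda s0 (X q)) < eta * del).
  apply: (open_hol_lt (E := C2) (fun q => Y q * lin lambda s0 (X q))%C) => // q.
  by apply: hol_mult; [exact: hol_snd|apply: hol_lin; exact: hol_fst].
have L0 := strip_open L s0 p Hs.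
apply: filter_imp (filter_and _ _ (filter_and _ _ L0 L1) (filter_and _ _ L2 L3)).
by move=> q [[? ?] [? ?]]; split=> //; exists rho, del.
Qed.

Lemma exp_between (a t : R) : 0 <= t <= 1 -> exp (t * a) <= Rmax 1 (exp a).
Proof.
move=> Ht; case: (Rle_lt_dec 0 a) => Ha.
- by apply: Rle_trans (Rmax_r _ _); apply: exp_le_exp; nra.
- by apply: Rle_trans (Rmax_l _ _); rewrite -exp_0; apply: exp_le_exp; nra.
Qed.

Lemma fst_star_fst (s0 : C) (t : R) (p : C2) : fst (X (star s0 t p)) - fst s0 = t * (fst (X p) - fst s0).
Proof. by rewrite /star /=; ring. Qed.

(** At an intermediate time the weight is at most the larger of its end values [1] and [|lin|]. This
    is why [leaf_dom] bounds the second coordinate both alone and multiplied by [lin]. *)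
Lemma leaf_dom_star lambda L A r s0 f eta p t :
  tame A r s0 f -> leaf_dom lambda L A s0 eta p -> 0 <= t <= 1 ->
  leaf_dom lambda L A s0 eta (star s0 t p).
Proof.
move=> Ht [Hs [rho [del [HA [H1 [H2 H3]]]]]] Ht01.
have [[Hr _] _] := Ht rho del HA.
have H20 := Cmod_ge_0 (Y p).
split.
  rewrite /strip.
  have -> : snd (X (star s0 t p)) - snd s0 = t * (snd (X p) - snd s0) by rewrite /star /=; ring.
  rewrite Rabs_mult (Rabs_pos_eq t); last lra.
  rewrite /strip in Hs; have := Rabs_pos (snd (X p) - snd s0); nra.
exists rho, del; split=> //; split; last split.
- rewrite !Cmod_Cexp in H1 Hr *.
  have -> : fst (X (star s0 t p)) = fst s0 + t * (fst (X p) - fst s0) by rewrite /star /=; ring.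
  case: (Rle_lt_dec (fst s0) (fst (X p))) => Hc.
  + by apply: Rle_lt_trans H1; apply: exp_le_exp; nra.
  + by apply: Rle_lt_trans Hr; apply: exp_le_exp; nra.
- exact: H2.
- rewrite Cmod_mult Cmod_lin in H3; rewrite Cmod_mult Cmod_lin fst_star_fst.
  change (Y (star s0 t p)) with (Y p).
  have -> : lambda * (t * (fst (X p) - fst s0)) = t * (lambda * (fst (X p) - fst s0)) by ring.
  have := exp_between (lambda * (fst (X p) - fst s0)) t Ht01.
  move: H3; set e := exp (lambda * _) => H3 He.
  have [E|E] : Rmax 1 e = 1 \/ Rmax 1 e = e by rewrite /Rmax; case: Rle_dec; tauto.
  + rewrite E in He; nra.
  + rewrite E in He; nra.
Qed.

(* The integral of [|ds| exp (lambda Re (s - s0))] along the segment from [s0]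
   to [s], inside a strip, is bounded by its largest endpoint value, uniformly
   in the length: this is where [lambda <> 0] is used. *)
Lemma primitive_weight_bound lambda L A r s0 f eta (g1 g2 : C2 -> C) (p : C2) (k : R) :
  lambda < 0 -> 0 < L -> tame A r s0 f -> leaf_dom lambda L A s0 eta p ->
  (forall q, leaf_dom lambda L A s0 eta q -> hol g1 q) ->
  (forall q, leaf_dom lambda L A s0 eta q -> hol g2 q) -> 0 <= k ->
  (forall t, 0 <= t <= 1 -> Cmod (g1 (star s0 t p) - g2 (star s0 t p)) <=
     k * exp (t * (lambda * (fst (X p) - fst s0)))) ->
  Cmod (primitive s0 g1 p - primitive s0 g2 p) <=
    k * (/ - lambda + L) * Rmax 1 (exp (lambda * (fst (X p) - fst s0))).
Proof.
move=> Hla HL Ht Hp Hg1 Hg2 Hk Hle.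
set De := fst (X p) - fst s0 in Hle *.
set m := Rmax 1 _.
have Hm1 : 1 <= m by exact: Rmax_l.
have Hm2 : exp (lambda * De) <= m by exact: Rmax_r.
have HX : Cmod (X p - s0) <= Rabs De + L.
  apply: Rle_trans (Cmod_le_abs (fst (X p - s0)%C) (snd (X p - s0)%C)) _.
  apply: Rplus_le_compat; first by right.
  by left; exact: (proj1 Hp).
have key : forall sg, Rabs De = sg * (- De) -> (sg = 1 \/ sg = -1) ->
  Cmod (primitive s0 g1 p - primitive s0 g2 p) <=
    k * (sg * (exp (lambda * De) - 1) / - lambda + L * m).
  move=> sg Hsg Hsg1.
  (* The real part of the segment is integrated exactly; the imaginary part, of length at most [L],
     is taken against the maximal weight [m]. The sign [sg] encodes the absolute value of [De]. *)
  pose M t := k * (sg * exp (t * (lambda * De)) / - lambda + L * m * t).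
  pose dM t := k * (sg * (lambda * De * exp (t * (lambda * De))) / - lambda + L * m).
  have := primitive_diff_bound (leaf_dom lambda L A s0 eta) s0 g1 g2 p M dM
    (leaf_dom_open lambda L A s0 eta) (fun q t Hq Ht01 => leaf_dom_star lambda L A r s0 f eta q t Ht Hq Ht01)
    Hg1 Hg2 Hp.
  have -> : M 1 - M 0 = k * (sg * (exp (lambda * De) - 1) / - lambda + L * m).
    rewrite /M Rmult_0_l Rmult_1_l exp_0; field; lra.
  apply.
  - move=> t _; rewrite /M /dM; auto_derive; first by repeat split; lra.
    by field; lra.
  - move=> t Ht01; rewrite /dM.
    apply: Rle_trans (Rmult_le_compat _ _ _ _ (Cmod_ge_0 _) (Cmod_ge_0 _) HX (Hle t Ht01)) _.
    have He := exp_between (lambda * De) t Ht01; rewrite -/m in He.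
    have Hp0 := exp_pos (t * (lambda * De)).
    set e := exp _ in He Hp0 *.
    have -> : k * (sg * (lambda * De * e) / - lambda + L * m) = k * ((sg * - De) * e + L * m) by field; lra.
    rewrite -Hsg.
    have : L * e <= L * m by apply: Rmult_le_compat_l; lra.
    nra.
have Hil : 0 < / - lambda by apply: Rinv_0_lt_compat; lra.
have He0 := exp_pos (lambda * De).
case: (Rle_lt_dec 0 De) => HDe.
- apply: Rle_trans (key (-1) _ (or_intror eq_refl)) _; first by rewrite Rabs_pos_eq; lra.
  rewrite Rmult_assoc; apply: Rmult_le_compat_l => //.
  have -> : -1 * (exp (lambda * De) - 1) / - lambda = / - lambda * (1 - exp (lambda * De)) by field; lra.
  nra.
- apply: Rle_trans (key 1 _ (or_introl eq_refl)) _; first by rewrite Rabs_left; lra.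
  rewrite Rmult_assoc; apply: Rmult_le_compat_l => //.
  have -> : 1 * (exp (lambda * De) - 1) / - lambda = / - lambda * (exp (lambda * De) - 1) by field; lra.
  nra.
Qed.

Lemma tame_lipschitz A r s0 f rho del (x y y' : C) :
  tame A r s0 f -> A rho del -> Cmod x < rho -> Cmod y < del / 2 -> Cmod y' < del / 2 ->
  Cmod (f (x, y') - f (x, y)) <= 8 / del * Cmod (y' - y).
Proof.
move=> Ht HA Hx Hy Hy'.
have [_ [Hd Hf]] := Ht rho del HA.
have Hon : hol_on (E := C_NormedModule) (fun y => f (x, y)) (RtoC 0) del 1.
  move=> w Hw0; have {}Hw0 : Cmod (w - RtoC 0) < del := Hw0.
  rewrite Cminus_0_r in Hw0.
  have [H1 [H2 _]] := Hf x w Hx Hw0; split=> //.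
  by apply: (hol_pair_comp (E := C_NormedModule) f (fun _ => x) (fun y => y)) => //; [exact: hol_const|exact: hol_id].
have B : nball (E := C_NormedModule) (RtoC 0) (del / 2) y.
  by change (Cmod (y - RtoC 0) < del / 2); rewrite Cminus_0_r.
have B' : nball (E := C_NormedModule) (RtoC 0) (del / 2) y'.
  by change (Cmod (y' - RtoC 0) < del / 2); rewrite Cminus_0_r.
have := lipschitz_half_ball (E := C_NormedModule) (fun y => f (x, y)) (RtoC 0) y y' del 1 ltac:(lra) Hon B B'.
by rewrite Rmult_1_r.
Qed.

Lemma Cexp_le_3 (u : C) : Cmod u <= 1 -> Cmod (Cexp u) <= 3.
Proof.
move=> Hu; rewrite Cmod_Cexp; apply: Rle_trans exp_le_3; apply: exp_le_exp.
exact: Rle_trans (fst_le_Cmod u) Hu.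
Qed.

Lemma Cexp_lipschitz_3 (u w : C) :
  Cmod u <= 1 -> Cmod w <= 1 -> Cmod (Cexp u - Cexp w) <= 3 * Cmod (u - w).
Proof.
move=> Hu Hw; apply: Rle_trans (Cexp_lipschitz u w Hu Hw) _.
by apply: Rmult_le_compat_r; [exact: Cmod_ge_0|exact: exp_le_3].
Qed.

Lemma Rmult_Rmax_lt (c e k : R) : c < k -> c * e < k -> c * Rmax 1 e < k.
Proof. by rewrite /Rmax; case: Rle_dec => _ H1 H2; rewrite ?Rmult_1_r. Qed.

(** Fixed point of the map sending [u] to the primitive of [f] along the leaf with correction [u].
    The Lipschitz constant [8 / del] of [f] meets leaves of size at most [3 eta del], so the
    contraction factor is the same for all pairs [(rho, del)]. *)
Lemma leaf_exists lambda L A r s0 f :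
  lambda < 0 -> 0 < L -> tame A r s0 f ->
  exists eta u, 0 < eta <= 1 /\ forall p, leaf_dom lambda L A s0 eta p ->
    hol (E := C2) u p /\ Cmod (u p) <= 1 /\
    (exists l, filterdiff (U := C2) (V := C_NormedModule) u (locally p) l /\
       l e1 = f (Cexp (X p), leaf lambda s0 u p)) /\
    (X p = s0 -> u p = RtoC 0) /\ (Y p = RtoC 0 -> u p = RtoC 0).
Proof.
move=> Hla HL Ht.
set Q := / - lambda + L.
have HQ : 0 < Q by rewrite /Q; have := Rinv_0_lt_compat (- lambda) ltac:(lra); lra.
(* [48 Q] makes the contraction factor [24 eta Q] at most [1 / 2]; [6] keeps leaves, of size at most
   [3 eta del], below [del / 2], where [f] is Lipschitz. *)
set eta := / (48 * Q + 6).
have Heta : 0 < eta by apply: Rinv_0_lt_compat; lra.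
have HetaE : eta * (48 * Q + 6) = 1 by rewrite /eta Rinv_l; lra.
have HetaQ : 0 < eta * Q by nra.
pose D := leaf_dom lambda L A s0 eta.
pose g (u : C2 -> C) (p : C2) := f (Cexp (X p), leaf lambda s0 u p).
have Dopen : open D by exact: leaf_dom_open.
have Dstar : forall q t, D q -> 0 <= t <= 1 -> D (star s0 t q).
  by move=> q t Hq; exact: (leaf_dom_star lambda L A r s0 f eta q t Ht Hq).
have Hleaf : forall (u : C2 -> C) (p : C2) del, Cmod (u p) <= 1 ->
    Cmod (Y p * lin lambda s0 (X p)) < eta * del -> Cmod (leaf lambda s0 u p) < del / 2.
  move=> u p del Hu Hp; rewrite /leaf Cmod_mult.
  have H3 := Cexp_le_3 _ Hu; have H30 := Cmod_ge_0 (Cexp (u p)).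
  have H0 := Cmod_ge_0 (Y p * lin lambda s0 (X p)).
  have : Cmod (Y p * lin lambda s0 (X p)) * Cmod (Cexp (u p)) <= Cmod (Y p * lin lambda s0 (X p)) * 3.
    exact: Rmult_le_compat_l.
  have : 6 * eta <= 1 by nra.
  nra.
have Hg : forall u, hol_bounded D 1 u -> forall p, D p -> hol (E := C2) (g u) p.
  move=> u Hu p Hp; have [Hu1 Hu2] := Hu p Hp.
  have [_ [rho [del [HA [H1 [H2 H3]]]]]] := Hp.
  have Hl := Hleaf u p del Hu2 H3.
  have [_ [Hd Hf]] := Ht rho del HA.
  apply: (hol_pair_comp f).
  - by apply: hol_Cexp; exact: hol_fst.
  - apply: hol_mult; last exact: hol_Cexp.
    by apply: hol_mult; [exact: hol_snd|apply: hol_lin; exact: hol_fst].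
  - by apply: (fun h => proj1 (Hf _ _ H1 h)); lra.
have Hzero : forall p, hol (E := C2) (fun _ => RtoC 0) p by move=> p; exact: hol_const.
have Hprim0 : forall p, primitive s0 (fun _ => RtoC 0) p = RtoC 0.
  move=> p; rewrite /primitive /star_mean !RInt_const /scal /= /mult /=.
  by apply: injective_projections => /=; ring.
(* [24 = 8 * 3]: the Lipschitz constant of [f] times the constant of the exponential on the unit
   disc. The factor [1 / del] is absorbed by [|Y p| < eta * del]. *)
have estim : forall g1 g2 p k, (forall q, D q -> hol (E := C2) g1 q) -> (forall q, D q -> hol (E := C2) g2 q) ->
    D p -> 0 <= k -> 
    (forall rho del, A rho del -> Cmod (Cexp (X p)) < rho -> Cmod (Y p) < eta * del ->
       Cmod (Y p * lin lambda s0 (X p)) < eta * del ->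
       forall t, 0 <= t <= 1 -> Cmod (g1 (star s0 t p) - g2 (star s0 t p)) <=
         24 / del * k * Cmod (Y p * lin lambda s0 (X (star s0 t p)))) ->
    Cmod (primitive s0 g1 p - primitive s0 g2 p) <= k / 2.
  move=> g1 g2 p k Hg1 Hg2 Hp Hk Hle.
  have [_ [rho [del [HA [H1 [H2 H3]]]]]] := Hp.
  have [_ [Hd _]] := Ht rho del HA.
  have HY := Cmod_ge_0 (Y p).
  have K0 : 0 <= 24 / del * k * Cmod (Y p).
    apply: Rmult_le_pos => //; apply: Rmult_le_pos => //; apply: Rdiv_le_0_compat; lra.
  have := primitive_weight_bound lambda L A r s0 f eta g1 g2 p (24 / del * k * Cmod (Y p)) Hla HL Ht Hp Hg1 Hg2 K0.
  rewrite -/Q => HH; apply: Rle_trans (HH _) _.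
  - move=> t Ht01; apply: Rle_trans (Hle rho del HA H1 H2 H3 t Ht01) _.
    rewrite Cmod_mult Cmod_lin fst_star_fst.
    have -> : lambda * (t * (fst (X p) - fst s0)) = t * (lambda * (fst (X p) - fst s0)) by ring.
    by right; ring.
  - rewrite Cmod_mult Cmod_lin in H3.
    have := Rmult_Rmax_lt _ _ _ H2 H3; set m := Rmax _ _ => Hm.
    have -> : 24 / del * k * Cmod (Y p) * Q * m = 24 * Q * k / del * (Cmod (Y p) * m) by field; lra.
    apply: Rle_trans (_ : 24 * Q * k / del * (eta * del) <= _).
      apply: Rmult_le_compat_l; last lra.
      by apply: Rdiv_le_0_compat; [nra|lra].
    have -> : 24 * Q * k / del * (eta * del) = 24 * (eta * Q) * k by field; lra.
    nra.
have Hst_dom : forall p rho del t, A rho del -> D p -> Cmod (Cexp (X p)) < rho -> Cmod (Y p) < eta * del ->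
    Cmod (Y p * lin lambda s0 (X p)) < eta * del -> 0 <= t <= 1 ->
    Cmod (Cexp (X (star s0 t p))) < rho /\ Cmod (Y p * lin lambda s0 (X (star s0 t p))) < eta * del.
  move=> p rho del t HA Hp H1 H2 H3 Ht01.
  (* Reducing the set of pairs to the given one makes [leaf_dom_star] return the same [rho] and
     [del]. *)
  have Ht1 : tame (fun a b => a = rho /\ b = del) r s0 f by move=> a b [-> ->]; exact: Ht.
  have [_ [a [b [[-> ->] [G1 [_ G3]]]]]] :
    leaf_dom lambda L (fun a b => a = rho /\ b = del) s0 eta (star s0 t p).
    apply: (leaf_dom_star _ _ _ _ _ _ _ _ _ Ht1) => //; split; first exact: (proj1 Hp).
    by exists rho, del.
  by split.
have Hsub0 : forall z : C, (z - RtoC 0)%C = z := Cminus_0_r.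
have Bbound : forall u, hol_bounded D 1 u -> forall p, D p -> Cmod (primitive s0 (g u) p) <= 1 / 2.
  move=> u Hu p Hp.
  rewrite -(Hsub0 (primitive s0 (g u) p)) -(Hprim0 p).
  apply: estim => //; first exact: Hg; first lra.
  move=> rho del HA H1 H2 H3 t Ht01; rewrite Hsub0.
  have [G1 G2] := Hst_dom p rho del t HA Hp H1 H2 H3 Ht01.
  have [_ [Hd Hf]] := Ht rho del HA.
  have Hus := proj2 (Hu _ (Dstar p t Hp Ht01)).
  have Hlf := Hleaf u (star s0 t p) del Hus G2.
  have Hf0 := proj2 (proj2 (Hf (Cexp (X (star s0 t p))) (RtoC 0) G1 ltac:(rewrite Cmod_0; lra))).
  have := tame_lipschitz A r s0 f rho del (Cexp (X (star s0 t p))) (RtoC 0) (leaf lambda s0 u (star s0 t p)) Ht HA G1 ltac:(rewrite Cmod_0; lra) Hlf.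
  rewrite Hf0 !Hsub0 => HH; apply: Rle_trans HH _.
  rewrite /leaf Cmod_mult.
  have H3' := Cexp_le_3 _ Hus.
  have H0 := Cmod_ge_0 (Y p * lin lambda s0 (X (star s0 t p))).
  change (Y (star s0 t p)) with (Y p).
  have : Cmod (Y p * lin lambda s0 (X (star s0 t p))) * Cmod (Cexp (u (star s0 t p))) <=
    Cmod (Y p * lin lambda s0 (X (star s0 t p))) * 3 by exact: Rmult_le_compat_l.
  have -> : 24 / del * 1 * Cmod (Y p * lin lambda s0 (X (star s0 t p))) =
    8 / del * (Cmod (Y p * lin lambda s0 (X (star s0 t p))) * 3) by field; lra.
  by apply: Rmult_le_compat_l; apply: Rdiv_le_0_compat; lra.
have HB1 : forall u, hol_bounded D 1 u -> hol_bounded D 1 (primitive s0 (g u)).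
  move=> u Hu p Hp; split; last by have := Bbound u Hu p Hp; lra.
  have [l [Hl _]] := filterdiff_primitive D s0 (g u) p Dopen Dstar (Hg u Hu) Hp.
  by exists l.
have HB2 : forall u w e, 0 <= e -> hol_bounded D 1 u -> hol_bounded D 1 w ->
    (forall p, D p -> Cmod (u p - w p) <= e) ->
    forall p, D p -> Cmod (primitive s0 (g u) p - primitive s0 (g w) p) <= e / 2.
  move=> u w e He Hu Hw Hd p Hp.
  apply: estim => //; [exact: Hg|exact: Hg|].
  move=> rho del HA H1 H2 H3 t Ht01.
  have [G1 G2] := Hst_dom p rho del t HA Hp H1 H2 H3 Ht01.
  have [_ [Hdel Hf]] := Ht rho del HA.
  have Ds := Dstar p t Hp Ht01.
  have Hus := proj2 (Hu _ Ds); have Hws := proj2 (Hw _ Ds).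
  have Hlf := Hleaf u (star s0 t p) del Hus G2.
  have Hlw := Hleaf w (star s0 t p) del Hws G2.
  have HH := tame_lipschitz A r s0 f rho del (Cexp (X (star s0 t p))) _ _ Ht HA G1 Hlw Hlf.
  apply: Rle_trans HH _.
  have -> : (leaf lambda s0 u (star s0 t p) - leaf lambda s0 w (star s0 t p) =
    Y p * lin lambda s0 (X (star s0 t p)) * (Cexp (u (star s0 t p)) - Cexp (w (star s0 t p))))%C
    by rewrite /leaf; change (Y (star s0 t p)) with (Y p); ring.
  rewrite Cmod_mult.
  have H0 := Cmod_ge_0 (Y p * lin lambda s0 (X (star s0 t p))).
  have HL3 := Cexp_lipschitz_3 _ _ Hus Hws.
  have Hd2 := Hd _ Ds.
  have -> : 24 / del * e * Cmod (Y p * lin lambda s0 (X (star s0 t p))) =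
    8 / del * (Cmod (Y p * lin lambda s0 (X (star s0 t p))) * (3 * e)) by field; lra.
  apply: Rmult_le_compat_l; first by apply: Rdiv_le_0_compat; lra.
  by apply: Rmult_le_compat_l => //; lra.
have [u [Hu Hfix]] := hol_fixed_point D 1 (fun u => primitive s0 (g u)) Dopen ltac:(lra) HB1 HB2.
exists eta, u; split; first by split=> //; nra.
move=> p Hp; have [Hu1 Hu2] := Hu p Hp.
split=> //; split=> //; split; last split.
- have [l [Hl El]] := filterdiff_primitive D s0 (g u) p Dopen Dstar (Hg u Hu) Hp.
  exists l; split; last exact: El.
  apply: filterdiff_ext_locally Hl.
  by apply: filter_imp (Dopen p Hp) => q Hq; rewrite -Hfix.
- by move=> E; rewrite (Hfix p Hp) /primitive E; ring.
- move=> E; rewrite (Hfix p Hp).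
  apply: Cmod_eq_0; apply: Rle_antisym; last exact: Cmod_ge_0.
  (* [estim] with [k = 0]: the integrand vanishes along the leaf [y = 0]. *)
  have -> : 0 = 0 / 2 by field.
  rewrite -(Hsub0 (primitive s0 (g u) p)) -(Hprim0 p).
  apply: estim => //; first exact: Hg; first lra.
  move=> rho del HA H1 H2 H3 t Ht01; rewrite Hsub0.
  have [G1 G2] := Hst_dom p rho del t HA Hp H1 H2 H3 Ht01.
  have [_ [Hdel Hf]] := Ht rho del HA.
  have -> : g u (star s0 t p) = RtoC 0.
    rewrite /g /leaf; change (Y (star s0 t p)) with (Y p); rewrite E !Cmult_0_l.
    by apply: (fun h => proj2 (proj2 (Hf _ (RtoC 0) G1 h))); rewrite Cmod_0; lra.
  rewrite Cmod_0 E Cmult_0_l Cmod_0; lra.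
Qed.

(** Only the size of [y] over [s] is prescribed; the size of the corresponding [c] over [s0] follows
    from the bound on [/ |lin|]. *)
Definition chart_dom (L : R) (A : R -> R -> Prop) (s0 : C) (eta : R) (p : C2) : Prop :=
  strip L s0 (X p) /\ exists rho del, A rho del /\ Cmod (Cexp (X p)) < rho /\
    Cmod (Y p) < eta * del.

Lemma chart_dom_open L A s0 eta : open (chart_dom L A s0 eta).
Proof.
move=> p [Hs [rho [del [HA [H1 H2]]]]].
have L1 : locally p (fun q : C2 => Cmod (Cexp (X q)) < rho).
  by apply: (open_hol_lt (E := C2) (fun q => Cexp (X q))) => // q; apply: hol_Cexp; exact: hol_fst.
have L2 : locally p (fun q : C2 => Cmod (Y q) < eta * del).
  by apply: (open_hol_lt (E := C2) (fun q => Y q)) => // q; exact: hol_snd.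
have L0 := strip_open L s0 p Hs.
apply: filter_imp (filter_and _ _ L0 (filter_and _ _ L1 L2)).
by move=> q [? [? ?]]; split=> //; exists rho, del.
Qed.

(* [Yf (s, c)] is the value at [s] of the leaf equal to [c] at [s0], and
   [Cf (s, y)] the value at [s0] of the leaf equal to [y] at [s]. *)
Record leaf_chart (lambda L : R) (A : R -> R -> Prop) (s0 : C) (f : C2 -> C)
    (eta etac K : R) (Yf Cf : C2 -> C) : Prop := {
  lc_eta : 0 < eta <= 1;
  lc_etac : 0 < etac <= 1;
  lc_K : 3 <= K;
  lc_Yf : forall p, leaf_dom lambda L A s0 eta p ->
    (exists l, filterdiff (U := C2) (V := C_NormedModule) Yf (locally p) l /\
      l e1 = ((RtoC lambda + f (Cexp (X p), Yf p)) * Yf p)%C) /\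
    Cmod (Yf p) <= K * Cmod (Y p * lin lambda s0 (X p)) /\
    (X p = s0 -> Yf p = Y p) /\ (Y p = RtoC 0 -> Yf p = RtoC 0);
  lc_lin : forall s : C, leaf_dom lambda L A s0 eta (s, RtoC 0) ->
    cderiv (fun c => Yf (s, c)) (RtoC 0) (lin lambda s0 s);
  lc_inj : forall s c c' : C, leaf_dom lambda L A s0 eta (s, c) -> leaf_dom lambda L A s0 eta (s, c') ->
    Yf (s, c) = Yf (s, c') -> c = c';
  lc_Cf : forall p, chart_dom L A s0 etac p ->
    hol (E := C2) Cf p /\ leaf_dom lambda L A s0 eta (X p, Cf p) /\ Yf (X p, Cf p) = Y p /\
    Cmod (Cf p) <= K * Cmod (Y p) /\ Cmod (Cf p * lin lambda s0 (X p)) <= K * Cmod (Y p)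
}.

(** A point over [s] may use any pair whose [rho] exceeds [|exp s|]; the pair with the larger [del]
    serves both constants. *)
Lemma leaf_dom_common lambda L A r s0 f eta (s c c' : C) :
  tame A r s0 f -> 0 < eta -> leaf_dom lambda L A s0 eta (s, c) -> leaf_dom lambda L A s0 eta (s, c') ->
  exists rho del, A rho del /\ Cmod (Cexp s) < rho /\
    Cmod c * Rmax 1 (Cmod (lin lambda s0 s)) < eta * del /\
    Cmod c' * Rmax 1 (Cmod (lin lambda s0 s)) < eta * del.
Proof.
move=> Ht He [_ [rho [del [HA [H1 [H2 H3]]]]]] [_ [rho' [del' [HA' [H1' [H2' H3']]]]]].
change (Cmod c < eta * del) in H2; change (Cmod c' < eta * del') in H2'.
change (Cmod (c * lin lambda s0 s) < eta * del) in H3; change (Cmod (c' * lin lambda s0 s) < eta * del') in H3'.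
rewrite Cmod_mult in H3; rewrite Cmod_mult in H3'.
case: (Rle_lt_dec del del') => Hd.
- exists rho', del'; split=> //; split=> //; split; last exact: Rmult_Rmax_lt.
  have : eta * del <= eta * del' by apply: Rmult_le_compat_l; lra.
  by move=> Hdd; apply: Rmult_Rmax_lt; lra.
- exists rho, del; split=> //; split=> //; split; first exact: Rmult_Rmax_lt.
  have : eta * del' <= eta * del by apply: Rmult_le_compat_l; lra.
  by move=> Hdd; apply: Rmult_Rmax_lt; lra.
Qed.

(** The sign of [lambda] enters here: [|lin|] grows as Re s tends to minus infinity and Re s stays
    below [ln r], so the linear transport from [s] back to [s0] multiplies sizes by a bounded
    factor. *)
Lemma lin_inv_bound lambda r s0 : lambda < 0 -> 0 < r -> exists Bd, 1 <= Bd /\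
  forall s, Cmod (Cexp s) < r -> / Cmod (lin lambda s0 s) <= Bd.
Proof.
move=> Hla Hr; exists (Rmax 1 (exp (- lambda * (ln r - fst s0)))); split; first exact: Rmax_l.
move=> s; rewrite Cmod_Cexp Cmod_lin -exp_Ropp => Hs.
apply: Rle_trans (Rmax_r _ _); apply: exp_le_exp.
have : fst s < ln r by rewrite -(ln_exp (fst s)); apply: ln_increasing => //; exact: exp_pos.
nra.
Qed.

(** [Cf] solves [y = c * lin * exp (u (s, c))]: writing [c = y / lin * exp w], the unknown [w] is
    bounded and satisfies [w = - u (s, c)], a second fixed point problem, now in [(s, y)]. It
    contracts because [u] is Lipschitz in [c], with a constant inverse to the size of its disc. *)
Lemma leaf_chart_exists lambda L A r s0 f :
  lambda < 0 -> 0 < L -> 0 < r -> tame A r s0 f ->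
  exists eta etac K Yf Cf, leaf_chart lambda L A s0 f eta etac K Yf Cf.
Proof.
move=> Hla HL Hr Ht.
have [eta0 [u [Heta0 Hu]]] := leaf_exists lambda L A r s0 f Hla HL Ht.
have [Bd [HBd HBdl]] := lin_inv_bound lambda r s0 Hla Hr.
have lin0 : forall s, 0 < Cmod (lin lambda s0 s) by move=> s; rewrite Cmod_lin; exact: exp_pos.
have linz : forall s, lin lambda s0 s <> RtoC 0 by move=> s; apply/Cmod_gt_0.
(* [|c| * m s < eta * del] combines the two size conditions of [leaf_dom]. *)
set m := fun s => Rmax 1 (Cmod (lin lambda s0 s)).
have Hm1 : forall s, 1 <= m s by move=> s; exact: Rmax_l.
have Hm2 : forall s, Cmod (lin lambda s0 s) <= m s by move=> s; exact: Rmax_r.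
have ulip : forall s c c' rho del, A rho del -> strip L s0 s -> Cmod (Cexp s) < rho ->
    Cmod c * m s < eta0 * del / 2 -> Cmod c' * m s < eta0 * del / 2 ->
    Cmod (u (s, c') - u (s, c)) <= 8 * m s / (eta0 * del) * Cmod (c' - c).
  move=> s c c' rho del HA Hs H1 Hc Hc'.
  have [_ [Hd _]] := Ht rho del HA.
  have Hms := Hm1 s.
  have Hed : 0 < eta0 * del by apply: Rmult_lt_0_compat; lra.
  have HR : 0 < eta0 * del / m s by apply: Rdiv_lt_0_compat; lra.
  have Hon : hol_on (E := C_NormedModule) (fun c => u (s, c)) (RtoC 0) (eta0 * del / m s) 1.
    move=> w Hw0; have {}Hw0 : Cmod (w - RtoC 0) < eta0 * del / m s := Hw0.
    rewrite Cminus_0_r in Hw0.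
    have Hwm : Cmod w * m s < eta0 * del.
      have -> : eta0 * del = eta0 * del / m s * m s by field; lra.
      by apply: Rmult_lt_compat_r; lra.
    have Hw := Cmod_ge_0 w.
    have Hdom : leaf_dom lambda L A s0 eta0 (s, w).
      split=> //; exists rho, del; split=> //; split=> //.
      change (Cmod w < eta0 * del /\ Cmod (w * lin lambda s0 s) < eta0 * del).
      rewrite Cmod_mult; have := Hm2 s; split; nra.
    have [G1 [G2 _]] := Hu _ Hdom; split=> //.
    by apply: (hol_pair_comp (E := C_NormedModule) u (fun _ => s) (fun y => y)) => //; [exact: hol_const|exact: hol_id].
  have Hb : forall w, Cmod w * m s < eta0 * del / 2 -> nball (E := C_NormedModule) (RtoC 0) (eta0 * del / m s / 2) w.
    move=> w Hw; change (Cmod (w - RtoC 0) < eta0 * del / m s / 2); rewrite Cminus_0_r.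
    apply: (Rmult_lt_reg_r (m s)); first lra.
    have -> : eta0 * del / m s / 2 * m s = eta0 * del / 2 by field; lra.
    by [].
  have := lipschitz_half_ball (E := C_NormedModule) _ (RtoC 0) c c' _ 1 HR Hon (Hb c Hc) (Hb c' Hc').
  have -> : 8 * 1 / (eta0 * del / m s) = 8 * m s / (eta0 * del) by field; lra.
  by [].
(* [72 / 200 < 1] is the injectivity factor, [24 / 600 < 1 / 2] the contraction factor, and
   [3 * Bd * etac] equals [eta], so the [c] found lies in the leaf domain. *)
set eta := eta0 / 200.
set etac := eta0 / (600 * Bd).
have Hetac : 0 < etac by apply: Rdiv_lt_0_compat; lra.
have HetacE : etac * Bd = eta0 / 600 by rewrite /etac; field; lra.
pose Yf := leaf lambda s0 u.
have leaf_sub : forall p, leaf_dom lambda L A s0 eta p -> leaf_dom lambda L A s0 eta0 p.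
  move=> p [Hs [rho [del [HA [H1 [H2 H3]]]]]]; split=> //; exists rho, del.
  have [_ [Hd _]] := Ht rho del HA.
  have : eta * del <= eta0 * del by apply: Rmult_le_compat_r; rewrite /eta; lra.
  by move=> Hle; repeat split=> //; lra.
pose D := chart_dom L A s0 etac.
pose cw (w : C2 -> C) (p : C2) : C := (Y p / lin lambda s0 (X p) * Cexp (w p))%C.
have cwb : forall w p rho del, A rho del -> Cmod (Cexp (X p)) < rho -> Cmod (Y p) < etac * del -> Cmod (w p) <= 1 ->
    Cmod (cw w p) * m (X p) <= 3 * Bd * Cmod (Y p).
  move=> w p rho del HA H1 H2 Hw.
  have [[_ Hrr] _] := Ht rho del HA.
  rewrite /cw Cmod_mult Cmod_div // /Rdiv.
  have H3 := Cexp_le_3 _ Hw; have H30 := Cmod_ge_0 (Cexp (w p)).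
  have HB := HBdl (X p) ltac:(lra).
  have HY := Cmod_ge_0 (Y p).
  have Hl := lin0 (X p).
  have Hml : m (X p) * / Cmod (lin lambda s0 (X p)) <= Bd.
    rewrite /m /Rmax; case: Rle_dec => _; last by lra.
    by rewrite Rinv_r; lra.
  have Hml0 : 0 <= m (X p) * / Cmod (lin lambda s0 (X p)).
    by apply: Rmult_le_pos; [have := Hm1 (X p); lra|left; exact: Rinv_0_lt_compat].
  have -> : Cmod (Y p) * / Cmod (lin lambda s0 (X p)) * Cmod (Cexp (w p)) * m (X p) =
    (m (X p) * / Cmod (lin lambda s0 (X p))) * Cmod (Cexp (w p)) * Cmod (Y p) by ring.
  apply: Rmult_le_compat_r => //.
  rewrite (Rmult_comm 3); exact: Rmult_le_compat.
have cwb2 : forall w p rho del, A rho del -> Cmod (Cexp (X p)) < rho -> Cmod (Y p) < etac * del -> Cmod (w p) <= 1 ->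
    Cmod (cw w p) * m (X p) < eta * del.
  move=> w p rho del HA H1 H2 Hw.
  have [_ [Hd _]] := Ht rho del HA.
  apply: Rle_lt_trans (cwb w p rho del HA H1 H2 Hw) _.
  have : 3 * Bd * Cmod (Y p) < 3 * Bd * (etac * del) by apply: Rmult_lt_compat_l; lra.
  have -> : 3 * Bd * (etac * del) = 3 * (etac * Bd) * del by ring.
  rewrite HetacE /eta; lra.
have cwdom : forall w p, D p -> Cmod (w p) <= 1 -> leaf_dom lambda L A s0 eta (X p, cw w p).
  move=> w p [Hs [rho [del [HA [H1 H2]]]]] Hw.
  have H := cwb2 w p rho del HA H1 H2 Hw.
  have H0 := Cmod_ge_0 (cw w p).
  split=> //; exists rho, del; split=> //; split=> //.
  change (Cmod (cw w p) < eta * del /\ Cmod (cw w p * lin lambda s0 (X p)) < eta * del).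
  rewrite Cmod_mult; have := Hm1 (X p); have := Hm2 (X p); split; nra.
have Dopen : open D by exact: chart_dom_open.
pose B (w : C2 -> C) (p : C2) : C := (RtoC 0 - u (X p, cw w p))%C.
have HB1 : forall w, hol_bounded D 1 w -> hol_bounded D 1 (B w).
  move=> w Hw p Hp; have [Hw1 Hw2] := Hw p Hp.
  have [G1 [G2 _]] := Hu _ (leaf_sub _ (cwdom w p Hp Hw2)).
  split; last by rewrite /B Cmod_sub_rev Cminus_0_r.
  apply: hol_minus; first exact: hol_const.
  apply: (hol_pair_comp u) => //; first exact: hol_fst.
  apply: hol_mult; last exact: hol_Cexp.
  by apply: hol_div; [exact: hol_snd|apply: hol_lin; exact: hol_fst|].
have HB2 : forall w w' e, 0 <= e -> hol_bounded D 1 w -> hol_bounded D 1 w' ->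
    (forall p, D p -> Cmod (w p - w' p) <= e) ->
    forall p, D p -> Cmod (B w p - B w' p) <= e / 2.
  move=> w w' e He Hw Hw' Hd p Hp.
  have [Hs [rho [del [HA [H1 H2]]]]] := Hp.
  have Hwp := proj2 (Hw p Hp); have Hwp' := proj2 (Hw' p Hp).
  have [[_ Hrr] [Hdel _]] := Ht rho del HA.
  have C1 := cwb2 w p rho del HA H1 H2 Hwp.
  have C2' := cwb2 w' p rho del HA H1 H2 Hwp'.
  have Hed : 0 < eta0 * del by apply: Rmult_lt_0_compat; lra.
  have HU := ulip (X p) (cw w p) (cw w' p) rho del HA Hs H1 ltac:(rewrite /eta in C1; lra) ltac:(rewrite /eta in C2'; lra).
  have -> : (B w p - B w' p = u (X p, cw w' p) - u (X p, cw w p))%C by rewrite /B; ring.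
  apply: Rle_trans HU _.
  have E : (cw w' p - cw w p = Y p / lin lambda s0 (X p) * (Cexp (w' p) - Cexp (w p)))%C by rewrite /cw; ring.
  rewrite E Cmod_mult Cmod_div //.
  have H3 := Cexp_lipschitz_3 _ _ Hwp' Hwp.
  have Hde := Hd p Hp; rewrite Cmod_sub_rev in Hde.
  have HBp := HBdl (X p) ltac:(lra).
  have Hl := lin0 (X p).
  have HY := Cmod_ge_0 (Y p).
  have Hml : m (X p) * / Cmod (lin lambda s0 (X p)) <= Bd.
    rewrite /m /Rmax; case: Rle_dec => _; last by lra.
    by rewrite Rinv_r; lra.
  have Hml0 : 0 <= m (X p) * / Cmod (lin lambda s0 (X p)).
    by apply: Rmult_le_pos; [have := Hm1 (X p); lra|left; exact: Rinv_0_lt_compat].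
  have -> : 8 * m (X p) / (eta0 * del) * (Cmod (Y p) / Cmod (lin lambda s0 (X p)) * Cmod (Cexp (w' p) - Cexp (w p))) =
    8 / (eta0 * del) * ((m (X p) * / Cmod (lin lambda s0 (X p))) * Cmod (Y p) * Cmod (Cexp (w' p) - Cexp (w p))) by field; lra.
  apply: Rle_trans (_ : 8 / (eta0 * del) * (Bd * (etac * del) * (3 * e)) <= _).
    apply: Rmult_le_compat_l; first by apply: Rdiv_le_0_compat; lra.
    apply: Rmult_le_compat; [|exact: Cmod_ge_0| |lra].
      exact: Rmult_le_pos.
    by apply: Rmult_le_compat => //; lra.
  have -> : 8 / (eta0 * del) * (Bd * (etac * del) * (3 * e)) = 24 * (etac * Bd) / eta0 * e by field; lra.
  rewrite HetacE.
  have -> : 24 * (eta0 / 600) / eta0 * e = e * (24 / 600) by field; lra.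
  lra.
have [w [Hw Hfix]] := hol_fixed_point D 1 B Dopen ltac:(lra) HB1 HB2.
exists eta, etac, (3 * Bd), Yf, (cw w).
split.
- by rewrite /eta; lra.
- split=> //; nra.
- lra.
- move=> p /leaf_sub Hp; have [G1 [G2 [[l [Hl El]] [G3 G4]]]] := Hu p Hp; split; last split; last split.
  + have HY := filterdiff_snd p.
    have [ll Hll] := hol_lin lambda s0 (fun q : C2 => X q) p (hol_fst p).
    have Elin : exists ll, filterdiff (U := C2) (V := C_NormedModule) (fun q => lin lambda s0 (X q)) (locally p) ll
        /\ ll e1 = (RtoC lambda * lin lambda s0 (X p))%C.
      have Hc := cderiv_Cexp (RtoC lambda * (X p - s0))%C.
      have Hin := filterdiff_mult_C _ _ p _ _ (filterdiff_const_C (RtoC lambda) p)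
        (filterdiff_minus_C _ _ p _ _ (filterdiff_fst p) (filterdiff_const_C s0 p)).
      eexists; split; first exact: (filterdiff_comp' (V := C_NormedModule) _ _ p _ _ Hin Hc).
      by rewrite /lin /=; cring.
    have [ll' [Hll' Ell]] := Elin.
    have Hcu : filterdiff (U := C2) (V := C_NormedModule) (fun q => Cexp (u q)) (locally p) (fun v => (Cexp (u p) * l v)%C).
      exact: (filterdiff_comp' (V := C_NormedModule) _ _ p _ _ Hl (cderiv_Cexp (u p))).
    have Hall := filterdiff_mult_C _ _ p _ _ (filterdiff_mult_C _ _ p _ _ HY Hll') Hcu.
    eexists; split; first exact: Hall.
    by rewrite /= Ell El /Yf /leaf; cring.
  + rewrite /Yf /leaf Cmod_mult Rmult_comm; apply: Rmult_le_compat_r; first exact: Cmod_ge_0.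
    by apply: Rle_trans (Cexp_le_3 _ G2) _; lra.
  + move=> E; rewrite /Yf /leaf G3 // Cexp_0 E /lin.
    by rewrite Cminus_diag Cmult_0_r Cexp_0; ring.
  + by move=> E; rewrite /Yf /leaf E; ring.
- move=> s /leaf_sub Hs; have [[l Hl] [_ [_ [_ G4]]]] := Hu _ Hs.
  have Hcu : exists d, cderiv (fun c => Cexp (u (s, c))) (RtoC 0) d.
    apply/hol_cderiv; apply: hol_Cexp.
    apply: (hol_pair_comp (E := C_NormedModule) u (fun _ => s) (fun c => c)); [exact: hol_const|exact: hol_id|by exists l].
  have [d Hd] := Hcu.
  have H1 := filterdiff_mult_C (E := C_NormedModule) _ _ (RtoC 0) _ _
    (filterdiff_mult_C (E := C_NormedModule) _ _ (RtoC 0) _ _ (filterdiff_id _) (filterdiff_const_C (E := C_NormedModule) (lin lambda s0 s) (RtoC 0))) Hd.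
  apply: (filterdiff_ext_lin _ _ _ H1) => v.
  by rewrite G4 // Cexp_0; cring.
- move=> s c c' Hc Hc' E.
  have [rho [del [HA [H1 [H2 H3]]]]] := leaf_dom_common lambda L A r s0 f eta s c c' Ht ltac:(rewrite /eta; lra) Hc Hc'.
  have [_ [Hd _]] := Ht rho del HA.
  have Hed : 0 < eta0 * del by apply: Rmult_lt_0_compat; lra.
  have HU := ulip s c c' rho del HA (proj1 Hc) H1 ltac:(rewrite /eta /m in H2 *; lra) ltac:(rewrite /eta /m in H3 *; lra).
  have [_ [U1 _]] := Hu _ (leaf_sub _ Hc); have [_ [U1' _]] := Hu _ (leaf_sub _ Hc').
  (* Equal values at [s] force [c = c' * exp (u (s, c') - u (s, c))]; as [u] is Lipschitz in [c],
     [|c - c'|] is at most [72 / 200] of itself. *)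
  have Ec : (c - c' = c' * ((Cexp (u (s, c') - u (s, c))) - 1))%C.
    have E' : (c * lin lambda s0 s * Cexp (u (s, c)) = c' * lin lambda s0 s * Cexp (u (s, c')))%C := E.
    rewrite Cexp_minus.
    have Ecc : c = (c * lin lambda s0 s * Cexp (u (s, c)) / (lin lambda s0 s * Cexp (u (s, c))))%C.
      by cfield; split; [exact: Cexp_neq_0|exact: linz].
    rewrite {1}Ecc E'; cfield; split; [exact: Cexp_neq_0|exact: linz].
  set h := (u (s, c') - u (s, c))%C in HU Ec.
  have Hh2 : Cmod h <= 2.
    apply: Rle_trans (Cmod_triangle_sub _ _) _; lra.
  have Hexp : exp (Cmod h) <= 9.
    apply: Rle_trans (exp_le_exp _ _ Hh2) _.
    have -> : 2 = 1 + 1 by ring.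
    rewrite exp_plus; have := exp_le_3; have := exp_pos 1; nra.
  have Hh0 := Cmod_ge_0 h.
  have Hcc : Cmod (c - c') <= Cmod c' * (9 * Cmod h).
    rewrite Ec Cmod_mult; apply: Rmult_le_compat_l; first exact: Cmod_ge_0.
    apply: Rle_trans (Cmod_Cexp_minus_1 h) _.
    rewrite Rmult_comm; exact: Rmult_le_compat_r.
  rewrite (Cmod_sub_rev c' c) in HU.
  have H0 := Cmod_ge_0 (c - c').
  have Hc0 := Cmod_ge_0 c'.
  have Hfin : Cmod (c - c') <= (Cmod c' * m s) * (72 / (eta0 * del)) * Cmod (c - c').
    apply: Rle_trans Hcc _.
    have : Cmod c' * (9 * Cmod h) <= Cmod c' * (9 * (8 * m s / (eta0 * del) * Cmod (c - c'))).
      by apply: Rmult_le_compat_l => //; lra.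
    have -> : Cmod c' * (9 * (8 * m s / (eta0 * del) * Cmod (c - c'))) = Cmod c' * m s * (72 / (eta0 * del)) * Cmod (c - c') by field; lra.
    by [].
  have Hfac : (Cmod c' * m s) * (72 / (eta0 * del)) <= eta * del * (72 / (eta0 * del)).
    by apply: Rmult_le_compat_r; [apply: Rdiv_le_0_compat; lra|left].
  have Ef : eta * del * (72 / (eta0 * del)) = 72 / 200 by rewrite /eta; field; lra.
  rewrite Ef in Hfac.
  have : Cmod (c - c') = 0 by nra.
  move=> /Cmod_eq_0 E3.
  have -> : c = (c - c' + c')%C by ring.
  by rewrite E3; ring.
- move=> p Hp; have [Hw1 Hw2] := Hw p Hp.
  split; last split; last split.
  + apply: hol_mult; last exact: hol_Cexp.
    by apply: hol_div; [exact: hol_snd|apply: hol_lin; exact: hol_fst|].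
  + exact: cwdom.
  + rewrite /Yf /leaf.
    change ((cw w p * lin lambda s0 (X p) * Cexp (u (X p, cw w p)))%C = Y p).
    have Eu : u (X p, cw w p) = (- w p)%C by rewrite (Hfix p Hp) /B; ring.
    rewrite Eu Cexp_opp /cw; field; split; [exact: Cexp_neq_0|exact: linz].
  + have [Hs [rho [del [HA [H1 H2]]]]] := Hp.
    have H := cwb w p rho del HA H1 H2 Hw2.
    have H0 := Cmod_ge_0 (cw w p).
    rewrite Cmod_mult; have := Hm1 (X p); have := Hm2 (X p); split; nra.
Qed.

(** * Monodromy in a leaf chart *)

Definition tau : C := (0, 2 * PI).

Lemma Cexp_tau (s : C) : Cexp (s + tau) = Cexp s.
Proof.
have -> : (s + tau)%C = (fst s, snd s + 2 * PI) by apply: injective_projections => /=; ring.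
by rewrite Cexp_periodic; case: s.
Qed.

Lemma chart_leaf lambda L A s0 f eta etac K Yf Cf (s c : C) :
  leaf_chart lambda L A s0 f eta etac K Yf Cf ->
  leaf_dom lambda L A s0 eta (s, c) -> chart_dom L A s0 etac (s, Yf (s, c)) ->
  Cf (s, Yf (s, c)) = c.
Proof.
move=> H Hc Hy; have [_ [H1 [H2 _]]] := lc_Cf _ _ _ _ _ _ _ _ _ _ H _ Hy.
exact: (lc_inj _ _ _ _ _ _ _ _ _ _ H s).
Qed.

Lemma locally_pair (F G : C2 -> C) (p : C2) (D : C2 -> Prop) :
  hol F p -> hol G p -> locally ((F p, G p) : C2) D -> locally p (fun q => D (F q, G q)).
Proof.
move=> [lF HF] [lG HG] HD.
have Hp := filterdiff_pair F G p lF lG HF HG.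
by apply: (filterdiff_continuous (V := C2) (fun q => (F q, G q)) p (ex_intro _ _ Hp)).
Qed.

Lemma locally_pair_C (F G : C -> C) (z : C) (D : C2 -> Prop) :
  hol (E := C_NormedModule) F z -> hol (E := C_NormedModule) G z -> locally ((F z, G z) : C2) D ->
  locally (T := C_NormedModule) z (fun w => D (F w, G w)).
Proof.
move=> [lF HF] [lG HG] HD.
have Hp := filterdiff_pair (E := C_NormedModule) F G z lF lG HF HG.
by apply: (filterdiff_continuous (U := C_NormedModule) (V := C2) (fun q => (F q, G q)) z (ex_intro _ _ Hp)).
Qed.

(* Derivative along the leaf of constant [c]. *)
Lemma filterdiff_along_leaf lambda L A s0 f eta etac K Yf Cf (s c : C) (d : C) (F : C2 -> C) lF :
  leaf_chart lambda L A s0 f eta etac K Yf Cf ->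
  leaf_dom lambda L A s0 eta (s, c) ->
  filterdiff (U := C2) (V := C_NormedModule) F (locally (((s + d)%C, Yf (s, c)) : C2)) lF ->
  cderiv (fun z => F ((z + d)%C, Yf (z, c))) s
    (lF (RtoC 1, ((RtoC lambda + f (Cexp s, Yf (s, c))) * Yf (s, c))%C)).
Proof.
move=> H Hc HF.
have [[l [Hl El]] _] := lc_Yf _ _ _ _ _ _ _ _ _ _ H _ Hc.
have Hs : cderiv (fun z => z + d)%C s (RtoC 1).
  apply/cderiv_eps => eps He; exists 1; split; first lra.
  move=> v _.
  have -> : (s + v + d - (s + d) - RtoC 1 * v = RtoC 0)%C by ring.
  by rewrite Cmod_0; have := Cmod_ge_0 v; nra.
have HYc : cderiv (fun z => Yf (z, c)) s (l e1).
  have H1 := filterdiff_pair (E := C_NormedModule) (fun z => z) (fun _ => c) s _ _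
    (filterdiff_id _) (filterdiff_const_C (E := C_NormedModule) c s).
  have H2 := filterdiff_comp' (U := C_NormedModule) (V := C2) _ Yf s _ _ H1 Hl.
  apply: (filterdiff_ext_lin _ _ _ H2) => v.
  change (l (v, RtoC 0) = (l e1 * v)%C).
  rewrite (linear_C2 l (v, RtoC 0) (proj1 Hl)) [X (_, _)]/= [Y (_, _)]/=; cring.
rewrite El in HYc.
have HP := filterdiff_pair (E := C_NormedModule) _ _ s _ _ Hs HYc.
have H2 := filterdiff_comp' (U := C_NormedModule) (V := C2) _ F s _ _ HP HF.
apply: (filterdiff_ext_lin _ _ _ H2) => v.
set k := ((RtoC lambda + f (Cexp s, Yf (s, c))) * Yf (s, c))%C.
change (lF ((RtoC 1 * v)%C, (k * v)%C) = (lF (RtoC 1, k) * v)%C).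
rewrite (linear_C2 lF ((RtoC 1 * v)%C, (k * v)%C) (proj1 HF)) (linear_C2 lF (RtoC 1, k) (proj1 HF)).
simpl; cring.
Qed.

Lemma cderiv_unique (f : C -> C) (z l l' : C) : cderiv f z l -> cderiv f z l' -> l = l'.
Proof.
move=> H H'; have := filterdiff_locally_unique (E := C_NormedModule) f z (RtoC 1) _ _ H H'.
by rewrite !Cmult_1_r.
Qed.

Lemma leaf_dom_vertical lambda L A s0 eta (s c : C) :
  leaf_dom lambda L A s0 eta (s, c) ->
  locally (T := C_NormedModule) s (fun z : C => leaf_dom lambda L A s0 eta (z, c)).
Proof.
move=> H; apply: (locally_pair_C (fun z => z) (fun _ => c)).
- exact: hol_id.
- exact: hol_const.
- exact: leaf_dom_open.
Qed.

Lemma hol_Yf lambda L A s0 f eta etac K Yf Cf p :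
  leaf_chart lambda L A s0 f eta etac K Yf Cf -> leaf_dom lambda L A s0 eta p -> hol (E := C2) Yf p.
Proof. by move=> H Hp; have [[l [Hl _]] _] := lc_Yf _ _ _ _ _ _ _ _ _ _ H _ Hp; exists l. Qed.

(** [Cf (z, Yf (z, c))] is the constant [c], so [Cf] is a first integral in the coordinates [(s, y)]
    and its differential kills the leaf direction. *)
Lemma chart_invariant lambda L A s0 f eta etac K Yf Cf p :
  leaf_chart lambda L A s0 f eta etac K Yf Cf -> chart_dom L A s0 etac p ->
  exists l, filterdiff (U := C2) (V := C_NormedModule) Cf (locally p) l /\
    l (RtoC 1, ((RtoC lambda + f (Cexp (X p), Y p)) * Y p)%C) = RtoC 0.
Proof.
move=> H Hp.
have [[l Hl] [Hd [HY _]]] := lc_Cf _ _ _ _ _ _ _ _ _ _ H _ Hp.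
exists l; split=> //.
set c := Cf p in Hd HY; set s := X p in Hd HY *.
have Ep : p = (((s + RtoC 0)%C, Yf (s, c)) : C2).
  by rewrite HY Cplus_0_r /s; case: (p).
rewrite Ep in Hl.
have H1 := filterdiff_along_leaf lambda L A s0 f eta etac K Yf Cf s c (RtoC 0) Cf l H Hd Hl.
rewrite HY in H1.
apply: cderiv_unique H1 _.
have HYhol : hol (E := C_NormedModule) (fun z => Yf (z, c)) s.
  apply: (hol_pair_comp (E := C_NormedModule) Yf (fun z => z) (fun _ => c)).
  - exact: hol_id.
  - exact: hol_const.
  - exact: hol_Yf H Hd.
apply: (filterdiff_ext_locally (U := C_NormedModule) (fun _ => c)); last first.
  apply: (filterdiff_ext_lin _ (fun _ => RtoC 0)); first exact: filterdiff_const_C.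
  by move=> v; cring.
have L1 := leaf_dom_vertical lambda L A s0 eta s c Hd.
have L2 : locally (T := C_NormedModule) s (fun z => chart_dom L A s0 etac (z, Yf (z, c))).
  apply: (locally_pair_C (fun z => z) (fun z => Yf (z, c))) => //; first exact: hol_id.
  apply: chart_dom_open; rewrite HY; by move: Hp; rewrite /s; case: (p).
apply: filter_imp (filter_and _ _ L1 L2) => z [Z1 Z2].
by rewrite Cplus_0_r (chart_leaf _ _ _ _ _ _ _ _ _ _ z c H Z1 Z2).
Qed.

(** With its converse below: each change of coordinates costs a factor [K], the origin of the powers
    of [K] in the later smallness conditions. *)
Lemma leaf_dom_of_chart lambda L A s0 f eta etac K Yf Cf eta' (p : C2) :
  leaf_chart lambda L A s0 f eta etac K Yf Cf -> eta' <= etac -> 0 < eta' ->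
  (forall rho del, A rho del -> 0 < del) ->
  chart_dom L A s0 eta' p -> chart_dom L A s0 etac p /\ leaf_dom lambda L A s0 (K * eta') (X p, Cf p).
Proof.
move=> H He He0 HA0 [Hs [rho [del [HA [H1 H2]]]]].
have Hd := HA0 rho del HA.
have Hc : chart_dom L A s0 etac p.
  split=> //; exists rho, del; split=> //; split=> //.
  have : eta' * del <= etac * del by apply: Rmult_le_compat_r; lra.
  lra.
split=> //.
have [_ [_ [_ [B1 B2]]]] := lc_Cf _ _ _ _ _ _ _ _ _ _ H _ Hc.
have HK := lc_K _ _ _ _ _ _ _ _ _ _ H.
have : K * Cmod (Y p) < K * (eta' * del) by apply: Rmult_lt_compat_l; lra.
move=> HH; split=> //; exists rho, del; split=> //; split=> //.
rewrite -Rmult_assoc in HH.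
by split; [exact: Rle_lt_trans B1 HH|exact: Rle_lt_trans B2 HH].
Qed.

Lemma chart_of_leaf_dom lambda L A s0 f eta etac K Yf Cf eta' (s c : C) :
  leaf_chart lambda L A s0 f eta etac K Yf Cf -> eta' <= eta -> 0 < eta' ->
  (forall rho del, A rho del -> 0 < del) ->
  leaf_dom lambda L A s0 eta' (s, c) -> 
  leaf_dom lambda L A s0 eta (s, c) /\ chart_dom L A s0 (K * eta') (s, Yf (s, c)).
Proof.
move=> H He He0 HA0 [Hs [rho [del [HA [H1 [H2 H3]]]]]].
have Hd := HA0 rho del HA.
have Hle : eta' * del <= eta * del by apply: Rmult_le_compat_r; lra.
have Hc : leaf_dom lambda L A s0 eta (s, c).
  by split=> //; exists rho, del; split=> //; split=> //; split; lra.
split=> //.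
have [_ [B1 _]] := lc_Yf _ _ _ _ _ _ _ _ _ _ H _ Hc.
have HK := lc_K _ _ _ _ _ _ _ _ _ _ H.
split=> //; exists rho, del; split=> //; split=> //.
change (Cmod (Yf (s, c)) < K * eta' * del).
apply: Rle_lt_trans B1 _; rewrite Rmult_assoc; apply: Rmult_lt_compat_l; lra.
Qed.

Lemma chart_dom_tau L A s0 eta (s y : C) :
  strip L s0 (s + tau)%C -> chart_dom L A s0 eta (s, y) -> chart_dom L A s0 eta ((s + tau)%C, y).
Proof.
move=> Hst [_ [rho [del [HA [H1 H2]]]]]; split=> //; exists rho, del; split=> //; split=> //.
by change (Cmod (Cexp (s + tau)) < rho); rewrite Cexp_tau.
Qed.

(* Both sides are constant along the leaves and agree at [s0]. *)
Lemma chart_period lambda L A r s0 f eta etac K Yf Cf eta' (s y : C) :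
  leaf_chart lambda L A s0 f eta etac K Yf Cf -> tame A r s0 f ->
  0 < eta' -> K * eta' <= eta -> K * (K * eta') <= etac -> 2 * PI < L ->
  strip L s0 (s + tau)%C -> chart_dom L A s0 eta' (s, y) ->
  Cf ((s + tau)%C, y) = Cf ((s0 + tau)%C, Cf (s, y)).
Proof.
move=> H Ht He He1 He2 HL Hst Hp.
have HK := lc_K _ _ _ _ _ _ _ _ _ _ H.
have HA0 : forall rho del, A rho del -> 0 < del by move=> rho del /Ht [_ [? _]]; lra.
have Hk1 : 0 < K * eta' by nra.
have He3 : eta' <= etac.
  have : 1 * eta' <= K * eta' by apply: Rmult_le_compat_r; lra.
  have : 1 * (K * eta') <= K * (K * eta') by apply: Rmult_le_compat_r; lra.
  lra.
have [Hp1 Hp2] := leaf_dom_of_chart _ _ _ _ _ _ _ _ _ _ eta' (s, y) H He3 He HA0 Hp.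
set c := Cf (s, y) in Hp2 *.
have [_ [_ [HY _]]] := lc_Cf _ _ _ _ _ _ _ _ _ _ H _ Hp1.
have HY' : Yf (s, c) = y := HY.
pose F (z : C) := Cf ((z + tau)%C, Yf (z, c)).
have Hseg : forall t, 0 <= t <= 1 -> leaf_dom lambda L A s0 (K * eta') ((s0 + RtoC t * (s - s0))%C, c).
  by move=> t Ht01; exact: (leaf_dom_star lambda L A r s0 f (K * eta') (s, c) t Ht Hp2 Ht01).
have Hseg2 : forall t, 0 <= t <= 1 ->
    leaf_dom lambda L A s0 eta ((s0 + RtoC t * (s - s0))%C, c) /\
    chart_dom L A s0 (K * (K * eta')) ((s0 + RtoC t * (s - s0))%C, Yf ((s0 + RtoC t * (s - s0))%C, c)).
  move=> t /Hseg Hz.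
  exact: (chart_of_leaf_dom _ _ _ _ _ _ _ _ _ _ (K * eta') _ c H He1 Hk1 HA0 Hz).
have HF := constant_on_segment (E := C_NormedModule) F s0 (s - s0)%C.
have E1 : plus s0 (s - s0)%C = s by change ((s0 + (s - s0))%C = s); ring.
rewrite E1 in HF.
have -> : Cf ((s + tau)%C, y) = F s by rewrite /F HY'.
rewrite HF.
  rewrite /F; congr Cf; congr pair.
  have [D0 _] := Hseg2 0 ltac:(lra).
  have E0 : (s0 + RtoC 0 * (s - s0))%C = s0 by ring.
  rewrite E0 in D0.
  have [_ [_ [E _]]] := lc_Yf _ _ _ _ _ _ _ _ _ _ H (s0, c) D0.
  exact: E.
move=> t Ht01.
have -> : plus s0 (scal (RtoC t) (s - s0)%C) = (s0 + RtoC t * (s - s0))%C by [].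
set z := (s0 + RtoC t * (s - s0))%C.
have [Dz Cz] := Hseg2 t Ht01.
rewrite -/z in Dz Cz.
have Sz : strip L s0 (z + tau)%C.
  have Sp := proj1 Hp1.
  rewrite /strip in Hst Sp *.
  (* The imaginary part of [z + tau] interpolates between those of [s0 + tau] and [s + tau], both in
     the strip; [2 PI < L] is used for the first. *)
  have Et : snd (z + tau)%C - snd s0 = t * (snd (s + tau)%C - snd s0) + (1 - t) * (2 * PI).
    by rewrite /z /tau /=; ring.
  rewrite Et.
  have HPI := PI_RGT_0.
  apply: Rle_lt_trans (Rabs_triang _ _) _.
  rewrite (Rabs_mult t) (Rabs_mult (1 - t) (2 * PI)) (Rabs_pos_eq t) ?(Rabs_pos_eq (1 - t)) ?(Rabs_pos_eq (2 * PI)); try lra.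
  case: (Req_dec t 0) => [->|Ht0]; first lra.
  have : t * Rabs (snd (s + tau)%C - snd s0) < t * L by apply: Rmult_lt_compat_l; lra.
  have : (1 - t) * (2 * PI) <= (1 - t) * L by apply: Rmult_le_compat_l; lra.
  lra.
have Czt : chart_dom L A s0 etac ((z + tau)%C, Yf (z, c)).
  apply: chart_dom_tau => //.
  have [S1 [rho [del [HA [G1 G2]]]]] := Cz; split=> //; exists rho, del; split=> //; split=> //.
  have Hd := HA0 rho del HA.
  have : K * (K * eta') * del <= etac * del by apply: Rmult_le_compat_r; lra.
  lra.
have [l [Hl El]] := chart_invariant _ _ _ _ _ _ _ _ _ _ _ H Czt.
have HD := filterdiff_along_leaf lambda L A s0 f eta etac K Yf Cf z c tau Cf l H Dz Hl.
eexists; split; first exact: HD.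
move: El; rewrite [X (_, _)]/= [Y (_, _)]/= Cexp_tau => ->.
by rewrite Cmult_0_l.
Qed.

(** * Analytic continuation along the circle *)

Lemma interval_induction (P : R -> Prop) :
  P 0 ->
  (forall t, 0 <= t <= 1 -> exists eps, 0 < eps /\
     forall s, 0 <= s <= 1 -> Rabs (s - t) < eps -> (P s <-> P t)) ->
  P 1.
Proof.
move=> P0 Hloc.
(* The supremum of the initial segments on which [P] holds is reached and equals 1, since [P] is
   locally constant. *)
pose S x := 0 <= x <= 1 /\ forall s, 0 <= s <= x -> P s.
have HS0 : S 0 by split; [lra|move=> s Hs; have -> : s = 0 by lra].
have Hbd : bound S by exists 1 => x [Hx _]; lra.
have [x [Hx1 Hx2]] := completeness S Hbd (ex_intro _ 0 HS0).
have Hx01 : 0 <= x <= 1 by split; [exact: Hx1|apply: Hx2 => y [Hy _]; lra].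
have [eps [He Heq]] := Hloc x Hx01.
have [y [HSy Hy]] : exists y, S y /\ x - eps < y.
  apply: NNPP => Hno.
  have : x <= x - eps; last lra.
  apply: Hx2 => y HSy; apply: Rnot_lt_le => Hlt; apply: Hno; by exists y.
have Hyx := Hx1 y HSy.
have Px : P x.
  apply: (proj1 (Heq y _ _)).
  - exact: (proj1 HSy).
  - by apply: Rabs_def1; lra.
  - by apply: (proj2 HSy); have := proj1 (proj1 HSy); lra.
have Hup : forall s, 0 <= s <= 1 -> s < x + eps -> P s.
  move=> s Hs Hsx; case: (Rle_lt_dec s y) => Hsy; first by apply: (proj2 HSy); lra.
  by apply/(Heq s Hs) => //; apply: Rabs_def1; lra.
case: (Req_dec x 1) => Hx; first by rewrite -Hx.
have : Rmin 1 (x + eps / 2) <= x.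
  apply: Hx1; split; first by split; [apply: Rmin_glb; lra|exact: Rmin_l].
  move=> s Hs; apply: Hup; have := Rmin_l 1 (x + eps / 2); have := Rmin_r 1 (x + eps / 2); lra.
by rewrite /Rmin; case: Rle_dec => ?; lra.
Qed.

(** For [x <> 0] this vector spans the kernel of [omega]; pairing it with [e2], on which [omega]
    takes the value [x], isolates the value of [l]. *)
Lemma wedge_kernel (lambda : R) (f : C2 -> C) (x y : C) (l : C2 -> C) :
  x <> RtoC 0 ->
  (forall u v : C2, wedge l (omega lambda f (x, y)) u v = RtoC 0) ->
  l (x, ((RtoC lambda + f (x, y)) * y)%C) = RtoC 0.
Proof.
move=> Hx Hw.
have := Hw (x, ((RtoC lambda + f (x, y)) * y)%C) e2.
rewrite /wedge /omega /= => E.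
set a := l (x, _) in E *.
have {}E : (a * x = RtoC 0)%C by rewrite -E; ring.
have -> : a = (a * x / x)%C by field.
by rewrite E /Cdiv Cmult_0_l.
Qed.

Lemma circle_eq (s0 : C) (t : R) :
  circle (Cexp s0) t = ((Cexp (s0 + RtoC t * tau), RtoC 0) : C2).
Proof.
rewrite /circle Cexp_plus; congr pair; congr Cmult.
rewrite /Cexp /tau /=.
have -> : t * 0 - 0 * (2 * PI) = 0 by ring.
have -> : t * (2 * PI) + 0 * 0 = 2 * PI * t by ring.
by rewrite exp_0 !Rmult_1_l.
Qed.

Definition on_circle (s0 : C) (t : R) : C2 := ((s0 + RtoC t * tau)%C, RtoC 0).

Lemma on_circle_leaf_dom lambda L A r s0 f eta t :
  tame A r s0 f -> 0 < eta -> (exists rho del, A rho del) -> 2 * PI < L -> 0 <= t <= 1 ->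
  leaf_dom lambda L A s0 eta (on_circle s0 t).
Proof.
move=> Ht He [rho [del HA]] HL Ht01.
have [[Hr _] [Hd _]] := Ht rho del HA.
have Hed : 0 < eta * del by apply: Rmult_lt_0_compat; lra.
split.
  rewrite /strip /on_circle /tau /=.
  have -> : snd s0 + (t * (2 * PI) + 0 * 0) - snd s0 = t * (2 * PI) by ring.
  have HPI := PI_RGT_0.
  rewrite Rabs_pos_eq; nra.
exists rho, del; split=> //; split; last split.
- rewrite /on_circle [X _]/= Cexp_plus Cmod_mult.
  have -> : Cmod (Cexp (RtoC t * tau)) = 1.
    by rewrite Cmod_Cexp /tau /= -exp_0; congr exp; ring.
  lra.
- by rewrite /on_circle [Y _]/= Cmod_0.
- by rewrite /on_circle [Y _]/= Cmult_0_l Cmod_0.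
Qed.

Lemma norm_on_circle (s0 : C) (t s : R) :
  norm (minus (on_circle s0 s) (on_circle s0 t)) <= Rabs (s - t) * (2 * PI).
Proof.
apply: Rle_trans (norm_C2_le _) _.
have -> : X (minus (on_circle s0 s) (on_circle s0 t)) = (RtoC (s - t) * tau)%C.
  by rewrite RtoC_minus; change ((s0 + RtoC s * tau - (s0 + RtoC t * tau))%C = ((RtoC s - RtoC t) * tau)%C); ring.
have -> : Y (minus (on_circle s0 s) (on_circle s0 t)) = RtoC 0.
  by change ((RtoC 0 - RtoC 0)%C = RtoC 0); ring.
rewrite Cmod_0 Rplus_0_r Cmod_mult Cmod_R.
have -> : Cmod tau = 2 * PI; last by right.
have HPI := PI_RGT_0.
have -> : tau = (Ci * RtoC (2 * PI))%C by apply: injective_projections => /=; ring.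
rewrite Cmod_mult Cmod_Ci Cmod_R Rabs_pos_eq; lra.
Qed.

Section Continuation.
Context (lambda L : R) (A : R -> R -> Prop) (r : R) (s0 : C) (f : C2 -> C)
  (eta etac K : R) (Yf Cf : C2 -> C)
  (HC : leaf_chart lambda L A s0 f eta etac K Yf Cf) (Ht : tame A r s0 f)
  (HA : exists rho del, A rho del) (HL : 2 * PI < L).

(** In the coordinates [(s, c)] the loop unrolls into a segment and first integrals depend on [c]
    alone. *)
Definition leaf_point (p : C2) : C2 := (Cexp (X p), Yf p).

Lemma leaf_point_continuous (p : C2) (D : C2 -> Prop) :
  leaf_dom lambda L A s0 eta p -> locally (leaf_point p) D -> locally p (fun q => D (leaf_point q)).
Proof.
move=> Hp HD; apply: locally_pair => //.
- by apply: hol_Cexp; exact: hol_fst.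
- exact: hol_Yf HC Hp.
Qed.

Lemma hol_leaf_point (F : C2 -> C) (p : C2) :
  leaf_dom lambda L A s0 eta p -> hol (E := C2) F (leaf_point p) -> hol (E := C2) (fun q => F (leaf_point q)) p.
Proof.
move=> Hp HF; apply: hol_pair_comp => //.
- by apply: hol_Cexp; exact: hol_fst.
- exact: hol_Yf HC Hp.
Qed.

Lemma leaf_point_on_circle (t : R) : 0 <= t <= 1 ->
  leaf_point (on_circle s0 t) = circle (Cexp s0) t.
Proof.
move=> Ht01; rewrite circle_eq /leaf_point; congr pair.
have Hd := on_circle_leaf_dom lambda L A r s0 f eta t Ht (proj1 (lc_eta _ _ _ _ _ _ _ _ _ _ HC)) HA HL Ht01.
by have [_ [_ [_ E]]] := lc_Yf _ _ _ _ _ _ _ _ _ _ HC _ Hd; apply: E.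
Qed.

Lemma first_integral_on_leaves (H : C2 -> C) :
  minimal_first_integral (omega lambda f) (base_point (Cexp s0)) H ->
  locally (on_circle s0 0) (fun p : C2 => H (leaf_point p) = H (Cexp s0, Y p)).
Proof.
move=> [_ [_ HI]].
have H01 : 0 <= 0 <= 1 by lra.
have Hd := on_circle_leaf_dom lambda L A r s0 f eta 0 Ht (proj1 (lc_eta _ _ _ _ _ _ _ _ _ _ HC)) HA HL H01.
have E0 : circle (Cexp s0) 0 = base_point (Cexp s0).
  by rewrite circle_eq /base_point Cmult_0_l Cplus_0_r.
rewrite -E0 -leaf_point_on_circle // in HI.
have L1 := leaf_point_continuous _ _ Hd HI.
have L2 := leaf_dom_open lambda L A s0 eta _ Hd.
have [d [Hd0 Hball]] := open_polydisc _ _ (filter_and _ _ L1 L2).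
apply: (locally_polydisc _ d _ Hd0) => p HX HY.
set s := X p in HX *; set c := Y p in HY *.
have Hs0 : X (on_circle s0 0) = s0 by rewrite /on_circle /=; ring.
have Hc0 : Y (on_circle s0 0) = RtoC 0 by [].
rewrite Hs0 in HX Hball; rewrite Hc0 in HY Hball.
pose F (q : C2) := H (Cexp (X q), Y q).
pose Fc (z : C) := F ((z + RtoC 0)%C, Yf (z, c)).
have Hpt : forall t, 0 <= t <= 1 -> Cmod (s0 + RtoC t * (s - s0) - s0) < d.
  move=> t Ht01; have -> : (s0 + RtoC t * (s - s0) - s0 = RtoC t * (s - s0))%C by ring.
  rewrite Cmod_mult Cmod_R Rabs_pos_eq; last lra.
  have := Cmod_ge_0 (s - s0); nra.
have HF := constant_on_segment (E := C_NormedModule) Fc s0 (s - s0)%C.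
have E1 : plus s0 (s - s0)%C = s by change ((s0 + (s - s0))%C = s); ring.
rewrite E1 in HF.
have Ep : p = (s, c) by rewrite /s /c; case: (p).
have -> : H (leaf_point p) = Fc s by rewrite /Fc /F /leaf_point Ep Cplus_0_r.
rewrite HF.
  have [_ Hl0] := Hball (s0, c) ltac:(rewrite /= Cminus_diag Cmod_0; lra) HY.
  have [_ [_ [E _]]] := lc_Yf _ _ _ _ _ _ _ _ _ _ HC (s0, c) Hl0.
  by rewrite /Fc /F Cplus_0_r [X (_, _)]/= [Y (_, _)]/= E.
move=> t Ht01.
have -> : plus s0 (scal (RtoC t) (s - s0)%C) = (s0 + RtoC t * (s - s0))%C by [].
set z := (s0 + RtoC t * (s - s0))%C.
have [[l [Hl Hw]] Hz] := Hball (z, c) (Hpt t Ht01) HY.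
have Hexp : filterdiff (U := C2) (V := C_NormedModule) (fun q => Cexp (X q)) (locally ((z, Yf (z, c)) : C2)) (fun v => (Cexp z * X v)%C).
  exact: (filterdiff_comp' (U := C2) (V := C_NormedModule) (fun q : C2 => X q) Cexp (z, Yf (z, c)) _ _ (filterdiff_fst _) (cderiv_Cexp z)).
have HFd := filterdiff_comp' (U := C2) (V := C2) _ H ((z, Yf (z, c)) : C2) _ _
  (filterdiff_pair _ _ _ _ _ Hexp (filterdiff_snd _)) Hl.
have HFd' : filterdiff (U := C2) (V := C_NormedModule) F (locally (((z + RtoC 0)%C, Yf (z, c)) : C2))
   (fun v => l ((Cexp z * X v)%C, Y v)) by rewrite Cplus_0_r; exact: HFd.
have HD := filterdiff_along_leaf lambda L A s0 f eta etac K Yf Cf z c (RtoC 0) F _ HC Hz HFd'.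
eexists; split; first exact: HD.
rewrite [X (_, _)]/= [Y (_, _)]/= Cmult_1_r.
have -> := wedge_kernel lambda f (Cexp z) (Yf (z, c)) l (Cexp_neq_0 z) Hw.
by rewrite Cmult_0_l.
Qed.

(** Read in [(s, c)], the continued germ stays equal to [H (Cexp s0, c)]. The set of times where
    this holds is open and closed: neighbouring germs come from one holomorphic function, and the
    identity principle spreads the vanishing of the difference. *)
Lemma continuation_on_leaves (H : C2 -> C) (Ht' : R -> C2 -> C) :
  minimal_first_integral (omega lambda f) (base_point (Cexp s0)) H ->
  continuation (circle (Cexp s0)) Ht' ->
  locally (base_point (Cexp s0)) (fun q : C2 => Ht' 0 q = H q) ->
  locally (on_circle s0 1) (fun p : C2 => Ht' 1 (leaf_point p) = H (Cexp s0, Y p)).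
Proof.
move=> HI Hcont H0.
have He := proj1 (lc_eta _ _ _ _ _ _ _ _ _ _ HC).
have Hdom : forall t, 0 <= t <= 1 -> leaf_dom lambda L A s0 eta (on_circle s0 t).
  by move=> t; exact: (on_circle_leaf_dom lambda L A r s0 f eta t Ht He HA HL).
have Hchi : exists r1, 0 < r1 /\ forall c, Cmod c < r1 -> hol (E := C2) H (Cexp s0, c).
  have [_ [_ /open_polydisc [r1 [Hr1 Hh]]]] := HI.
  exists r1; split=> // c Hc.
  have [l [Hl _]] := Hh (Cexp s0, c) ltac:(rewrite /= Cminus_diag Cmod_0; lra) ltac:(rewrite /= Cminus_0_r; lra).
  by exists l.
have [r1 [Hr1 Hh]] := Hchi.
pose G t (p : C2) := (Ht' t (leaf_point p) - H (Cexp s0, Y p))%C.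
pose Z t := locally (on_circle s0 t) (fun p : C2 => G t p = RtoC 0).
suff HZ : Z 1.
  apply: filter_imp HZ => p; rewrite /G => E.
  have -> : Ht' 1 (leaf_point p) = (Ht' 1 (leaf_point p) - H (Cexp s0, Y p) + H (Cexp s0, Y p))%C by ring.
  by rewrite E Cplus_0_l.
have H01 : 0 <= 0 <= 1 by lra.
apply: interval_induction.
  have E0 : base_point (Cexp s0) = leaf_point (on_circle s0 0).
    by rewrite leaf_point_on_circle // circle_eq /base_point Cmult_0_l Cplus_0_r.
  rewrite E0 in H0.
  have L1 := leaf_point_continuous _ _ (Hdom 0 H01) H0.
  apply: filter_imp (filter_and _ _ L1 (first_integral_on_leaves H HI)) => p [P1 P2].
  by rewrite /G P1 P2; ring.
move=> t Ht01.
have [U [HU [HUt [Hhol [e1' Hloc]]]]] := Hcont t Ht01.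
rewrite -leaf_point_on_circle // in HUt.
have LU := leaf_point_continuous _ _ (Hdom t Ht01) (HU _ HUt).
have LD := leaf_dom_open lambda L A s0 eta _ (Hdom t Ht01).
have LY : locally (on_circle s0 t) (fun p : C2 => Cmod (Y p) < r1).
  apply: (open_hol_lt (E := C2) (fun q => Y q)) => [q|]; first exact: hol_snd.
  by rewrite /on_circle /= Cmod_0.
have [rb [Hrb Hball]] := proj1 (locally_nball _ _) (filter_and _ _ LU (filter_and _ _ LD LY)).
have HG : forall p, nball (on_circle s0 t) rb p -> hol (E := C2) (G t) p.
  move=> p /Hball [P1 [P2 P3]].
  apply: hol_minus; first by apply: hol_leaf_point => //; exact: Hhol.
  apply: (hol_pair_comp H (fun _ => Cexp s0) (fun p => Y p)); [exact: hol_const|exact: hol_snd|exact: Hh].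
have [R0 [M [HR0 [HM HGon]]]] := hol_bounded_near (G t) _ rb Hrb HG.
have HPI := PI_RGT_0.
(* [on_circle] moves at speed at most [2 PI], so the two centres are less than [R0 / 8] apart. *)
exists (Rmin e1' (R0 / (16 * PI))); split.
  by apply: Rmin_pos; [exact: cond_pos|apply: Rdiv_lt_0_compat; lra].
move=> s Hs Hst.
have Hst1 := Rlt_le_trans _ _ _ Hst (Rmin_l _ _).
have Hst2 := Rlt_le_trans _ _ _ Hst (Rmin_r _ _).
have Hn : norm (minus (on_circle s0 s) (on_circle s0 t)) < R0 / 8.
  apply: Rle_lt_trans (norm_on_circle _ _ _) _.
  have -> : R0 / 8 = R0 / (16 * PI) * (2 * PI) by field; lra.
  by apply: Rmult_lt_compat_r; lra.
have [_ Heq] := Hloc s Hst1 Hs.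
rewrite -leaf_point_on_circle // in Heq.
have LG : locally (on_circle s0 s) (fun p => G s p = G t p).
  by apply: filter_imp (leaf_point_continuous _ _ (Hdom s Hs) Heq) => p E; rewrite /G E.
split=> HZ.
- have /locally_nball [d [Hd Hzero]] : locally (on_circle s0 s) (fun p => G t p = RtoC 0).
    by apply: filter_imp (filter_and _ _ LG HZ) => p [-> ].
  (* Around [on_circle s0 s] a radius [7 R0 / 8] remains, and a quarter of it exceeds
     [R0 / 8 + R0 / 16]: a neighbourhood of [on_circle s0 t] is covered. *)
  have Hon' : hol_on (G t) (on_circle s0 s) (7 * R0 / 8) M by apply: hol_on_sub HGon _; lra.
  apply/locally_nball; exists (R0 / 16); split; first lra.
  move=> p Hp; apply: (identity_quarter_ball (G t) (on_circle s0 s) (7 * R0 / 8) M d) => //; first lra.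
  apply: (nball_nball _ (on_circle s0 t) _ (R0 / 8) (R0 / 16)) => //; last lra.
  rewrite /nball; apply: Rle_lt_trans Hn; right.
  by rewrite -norm_opp opp_minus.
- move/locally_nball: HZ => [d [Hd Hzero]].
  have Hz := identity_quarter_ball (G t) (on_circle s0 t) R0 M d (proj1 HR0) Hd HGon Hzero.
  have L1 : locally (on_circle s0 s) (fun p => G t p = RtoC 0).
    apply/locally_nball; exists (R0 / 8); split; first lra.
    move=> p Hp; apply: Hz; apply: (nball_nball _ (on_circle s0 s) _ (R0 / 8) (R0 / 8)) => //; lra.
  by apply: filter_imp (filter_and _ _ LG L1) => p [-> ].
Qed.

(** The germ reached at time 1 is known in two ways: it is [phi] after [H] by definition of the
    monodromy, and [H (Cexp s0, c)] on the leaf of constant [c]. Both are evaluated at the point of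
    ordinate [y] on the transversal, seen over [s0 + tau]. *)
Lemma holonomy_chart (H : C2 -> C) (phi : C -> C) :
  minimal_first_integral (omega lambda f) (base_point (Cexp s0)) H ->
  monodromy (Cexp s0) H phi ->
  locally (T := C_NormedModule) (RtoC 0)
    (fun y : C => phi (H (Cexp s0, y)) = H (Cexp s0, Cf ((s0 + tau)%C, y))).
Proof.
move=> HI [Ht' [Hcont [Hstart Hend]]].
have H11 : 0 <= 1 <= 1 by lra.
have L1 := continuation_on_leaves H Ht' HI Hcont Hstart.
have HK := lc_K _ _ _ _ _ _ _ _ _ _ HC.
have Hec := lc_etac _ _ _ _ _ _ _ _ _ _ HC.
have [d1 [Hd1 Hb1]] := open_polydisc _ _ L1.
have [d2 [Hd2 Hb2]] := open_polydisc _ _ Hend.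
have Ex1 : X (on_circle s0 1) = (s0 + tau)%C by rewrite /on_circle /=; ring.
have [rho [del HAA]] := HA.
have [[Hr _] [Hd _]] := Ht rho del HAA.
have Hed : 0 < etac * del by apply: Rmult_lt_0_compat; lra.
apply/locally_nball; exists (Rmin (etac * del) (Rmin d2 (d1 / K))); split.
  by repeat apply: Rmin_pos => //; apply: Rdiv_lt_0_compat; lra.
move=> y Hy0; have {}Hy0 : Cmod (y - RtoC 0) < Rmin (etac * del) (Rmin d2 (d1 / K)) := Hy0.
rewrite Cminus_0_r in Hy0.
have Hy1 := Rlt_le_trans _ _ _ Hy0 (Rmin_l _ _).
have Hy2 := Rlt_le_trans _ _ _ Hy0 (Rmin_r _ _).
have Hy3 := Rlt_le_trans _ _ _ Hy2 (Rmin_l _ _).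
have Hy4 := Rlt_le_trans _ _ _ Hy2 (Rmin_r _ _).
have Hch : chart_dom L A s0 etac ((s0 + tau)%C, y).
  split.
    rewrite /strip /tau /=; have HPI := PI_RGT_0.
    have -> : snd s0 + 2 * PI - snd s0 = 2 * PI by ring.
    by rewrite Rabs_pos_eq; lra.
  exists rho, del; split=> //; split=> //.
  by change (Cmod (Cexp (s0 + tau)) < rho); rewrite Cexp_tau.
have [_ [_ [EY [B1 _]]]] := lc_Cf _ _ _ _ _ _ _ _ _ _ HC _ Hch.
set c := Cf ((s0 + tau)%C, y) in EY B1 *.
have Hc : Cmod c < d1.
  apply: Rle_lt_trans B1 _; change (K * Cmod y < d1).
  have : Cmod y * K < d1 / K * K by apply: Rmult_lt_compat_r; lra.
  have -> : d1 / K * K = d1 by field; lra.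
  lra.
have E1 := Hb1 ((s0 + tau)%C, c) ltac:(rewrite Ex1 /= Cminus_diag Cmod_0; lra) ltac:(rewrite /= Cminus_0_r; lra).
have E2 := Hb2 (Cexp s0, y) ltac:(rewrite /= Cminus_diag Cmod_0; lra) ltac:(rewrite /= Cminus_0_r; lra).
rewrite -E2 -E1 /leaf_point; congr (Ht' 1); congr pair.
- by rewrite /= Cexp_tau.
- by symmetry; exact: EY.
Qed.

End Continuation.

(** * The fibred conjugacy *)

Lemma unit_circle_angle (a b : R) : a * a + b * b = 1 ->
  exists t, - PI <= t <= PI /\ cos t = a /\ sin t = b.
Proof.
move=> H.
have Ha : -1 <= a <= 1 by nra.
have Hs : sin (acos a) = sqrt (1 - a²) by apply: sin_acos.
have Hb : sqrt (1 - a²) = Rabs b.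
  have -> : 1 - a² = b² by rewrite /Rsqr; lra.
  exact: sqrt_Rsqr_abs.
have [B1 B2] := acos_bound a.
case: (Rle_lt_dec 0 b) => Hb0.
- exists (acos a); split; first by have := PI_RGT_0; lra.
  by rewrite cos_acos // Hs Hb Rabs_pos_eq.
- exists (- acos a); split; first by lra.
  rewrite cos_neg sin_neg cos_acos // Hs Hb Rabs_left //; split=> //; ring.
Qed.

Lemma Cexp_surj (s0 x : C) : x <> RtoC 0 -> exists s : C, Cexp s = x /\ Rabs (snd s - snd s0) <= PI.
Proof.
move=> Hx.
(* Dividing by [Cexp rot] centres the interval of arguments at [snd s0]. *)
set rot : C := (0, snd s0).
pose w := (x / Cexp rot)%C.
have Hw : w <> RtoC 0.
  by apply: Cmult_neq_0 => //; rewrite -Cexp_opp; exact: Cexp_neq_0.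
have Hm : 0 < Cmod w by apply/Cmod_gt_0.
have [t [Ht [Hc Hs]]] : exists t, - PI <= t <= PI /\ cos t = fst w / Cmod w /\ sin t = snd w / Cmod w.
  apply: unit_circle_angle.
  have := Cmod2_alt w; rewrite /Re /Im => E.
  have -> : fst w / Cmod w * (fst w / Cmod w) + snd w / Cmod w * (snd w / Cmod w) =
    (fst w ^ 2 + snd w ^ 2) / (Cmod w ^ 2) by field; lra.
  by rewrite -E; field; lra.
exists ((ln (Cmod w), t) + rot)%C; split.
- rewrite Cexp_plus.
  have key : forall v : C, 0 < Cmod v -> cos t = fst v / Cmod v -> sin t = snd v / Cmod v ->
      Cexp (ln (Cmod v), t) = v.
    move=> v Hv Hvc Hvs; rewrite /Cexp [fst (_, _)]/= [snd (_, _)]/= exp_ln // Hvc Hvs.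
    by apply: injective_projections => /=; field; lra.
  rewrite key //.
  rewrite /w; field; exact: Cexp_neq_0.
- rewrite /rot /=.
  have -> : t + snd s0 - snd s0 = t by ring.
  by apply: Rabs_le.
Qed.

(** The half width [PI + 1] leaves a margin around logarithms at distance [PI], while the full width
    stays below [4 PI], so that two logarithms differ by at most one period. *)
Lemma Cexp_inj_strip (s0 s s' : C) :
  strip (PI + 1) s0 s -> strip (PI + 1) s0 s' -> Cexp s = Cexp s' ->
  s' = s \/ s' = (s + tau)%C \/ s = (s' + tau)%C.
Proof.
rewrite /strip => Hs Hs' E.
have Ef : fst s' = fst s.
  have := f_equal Cmod E; rewrite !Cmod_Cexp => /exp_inv; by [].
have He := exp_pos (fst s).
have Hc : cos (snd s) = cos (snd s').
  have := f_equal fst E; rewrite /Cexp [fst (_, _)]/= [fst (exp (fst s') * _, _)]/= Ef => H.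
  by apply: (Rmult_eq_reg_l (exp (fst s))) => //; lra.
have Hn : sin (snd s) = sin (snd s').
  have := f_equal snd E; rewrite /Cexp [snd (_, _)]/= [snd (exp (fst s') * _, _)]/= Ef => H.
  by apply: (Rmult_eq_reg_l (exp (fst s))) => //; lra.
set d := snd s' - snd s.
have Hcd : cos d = 1.
  rewrite /d cos_minus -Hc -Hn; have := sin2_cos2 (snd s); rewrite /Rsqr; lra.
have Hsd : sin (d / 2) = 0.
  have : cos d = 1 - 2 * sin (d / 2) * sin (d / 2).
    by rewrite -cos_2a_sin; congr cos; field.
  nra.
have [k Hk] := sin_eq_0_0 _ Hsd.
have HPI : 3 < PI by have := PI2_3_2; rewrite /PI; lra.
have [A1 A2] := Rabs_def2 _ _ Hs; have [A3 A4] := Rabs_def2 _ _ Hs'.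
have Hd : - (2 * PI + 2) < d < 2 * PI + 2 by rewrite /d; lra.
have Hkb : -2 < IZR k < 2.
  by split; apply: (Rmult_lt_reg_r PI); lra.
have [/lt_IZR K1 /lt_IZR K2] := Hkb.
have Hk3 : (k = 0 \/ k = 1 \/ k = -1)%Z by lia.
case: Hk3 => [Ek|[Ek|Ek]]; rewrite Ek in Hk.
- left; apply: injective_projections => //; rewrite /d in Hk; lra.
- right; left; apply: injective_projections => /=; first by rewrite Ef; ring.
  rewrite /d in Hk; lra.
- right; right; apply: injective_projections => /=; first by rewrite Ef; ring.
  rewrite /d in Hk; lra.
Qed.

(** Counterpart of [chart_dom] in the variable [x], with [x = 0] included; it is a neighbourhood of
    the disc once the radii [rho] exhaust it. *)
Definition box (A : R -> R -> Prop) (eta : R) (p : C2) : Prop :=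
  exists rho del, A rho del /\ Cmod (X p) < rho /\ Cmod (Y p) < eta * del.

Lemma box_open A eta : open (box A eta).
Proof.
move=> p [rho [del [HA [H1 H2]]]].
have L1 : locally p (fun q : C2 => Cmod (X q) < rho).
  by apply: (open_hol_lt (E := C2) (fun q => X q)) => // q; exact: hol_fst.
have L2 : locally p (fun q : C2 => Cmod (Y q) < eta * del).
  by apply: (open_hol_lt (E := C2) (fun q => Y q)) => // q; exact: hol_snd.
by apply: filter_imp (filter_and _ _ L1 L2) => q [? ?]; exists rho, del.
Qed.

Lemma box_chart_dom L A s0 eta (s : C) (p : C2) :
  box A eta p -> Cexp s = X p -> strip L s0 s -> chart_dom L A s0 eta (s, Y p).
Proof.
move=> [rho [del [HA [H1 H2]]]] E Hs; split=> //; exists rho, del; split=> //; split=> //.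
by change (Cmod (Cexp s) < rho); rewrite E.
Qed.

Lemma box_le A eta eta' p : (forall rho del, A rho del -> 0 < del) -> eta <= eta' -> box A eta p -> box A eta' p.
Proof.
move=> HA0 He [rho [del [HA [H1 H2]]]]; exists rho, del; split=> //; split=> //.
have := HA0 _ _ HA => Hd.
have : eta * del <= eta' * del by apply: Rmult_le_compat_r; lra.
lra.
Qed.

(** Transfers to [x = 0] what logarithms prove for [x <> 0]; with [F2 = 0] it transfers
    identities. *)
Lemma le_by_density (F1 F2 : C2 -> C) (p : C2) :
  hol F1 p -> hol F2 p ->
  locally p (fun q : C2 => X q <> RtoC 0 -> Cmod (F1 q) <= Cmod (F2 q)) -> Cmod (F1 p) <= Cmod (F2 p).
Proof.
move=> H1 H2 HL.
case: (excluded_middle_informative (X p = RtoC 0)) => Ep; last by apply: (locally_singleton _ _ HL).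
apply: le_epsilon => eps He.
have [d1 [Hd1 C1]] := hol_continuous F1 p H1 (eps / 2) ltac:(lra).
have [d2 [Hd2 C2']] := hol_continuous F2 p H2 (eps / 2) ltac:(lra).
have /locally_nball [d3 [Hd3 Hle]] := HL.
pose t := Rmin d1 (Rmin d2 d3).
have Ht : 0 < t by rewrite /t; repeat apply: Rmin_pos.
have Ht1 : t <= d1 by exact: Rmin_l.
have Ht2 : t <= Rmin d2 d3 by exact: Rmin_r.
have := Rmin_l d2 d3; have := Rmin_r d2 d3 => T3 T2.
pose w : C2 := plus p (scal (RtoC (t / 2)) e1).
have Ew : X w = RtoC (t / 2).
  by change ((X p + RtoC (t / 2) * RtoC 1)%C = RtoC (t / 2)); rewrite Ep; ring.
have Hwt : norm (minus w p) < t.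
  rewrite /w plus_minus_l; apply: Rle_lt_trans (norm_C2_le _) _.
  change (Cmod (RtoC (t / 2) * RtoC 1) + Cmod (RtoC (t / 2) * RtoC 0) < t).
  rewrite Cmult_1_r Cmult_0_r Cmod_0 Cmod_R Rabs_pos_eq; lra.
have Ew0 : X w <> RtoC 0 by rewrite Ew => /RtoC_inj; lra.
have B1 := C1 w ltac:(lra).
have B2 := C2' w ltac:(lra).
have B3 := Hle w ltac:(rewrite /nball; lra) Ew0.
have := Cmod_triangle_sub (F1 w) (F1 w - F1 p).
have -> : (F1 w - (F1 w - F1 p) = F1 p)%C by ring.
have := Cmod_triangle (F2 w - F2 p) (F2 p).
have -> : (F2 w - F2 p + F2 p = F2 w)%C by ring.
lra.
Qed.

(** A pair [(a, b)] encodes the condition [a * eta < b]; as [0 <= a], decreasing [eta] preserves the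
    conditions already met. *)
Lemma small_parameter (l : list (R * R)) :
  List.Forall (fun ab => 0 <= fst ab /\ 0 < snd ab) l ->
  exists eta, 0 < eta /\ List.Forall (fun ab => fst ab * eta < snd ab) l.
Proof.
elim: l => [|[a b] l IH] H; first by exists 1; split; [lra|].
have [eta [He Hl]] := IH (List.Forall_inv_tail H).
have [Ha Hb] : 0 <= a /\ 0 < b := List.Forall_inv H.
set m := Rmin eta (b / (a + 1)).
have Hm : 0 < m by apply: Rmin_pos => //; apply: Rdiv_lt_0_compat; lra.
exists m; split=> //; constructor.
- have H1 : m <= b / (a + 1) by exact: Rmin_r.
  have H2 : m * (a + 1) <= b / (a + 1) * (a + 1) by apply: Rmult_le_compat_r; lra.
  have E : b / (a + 1) * (a + 1) = b by field; lra.
  simpl; nra.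
- have H1 : m <= eta by exact: Rmin_l.
  apply/List.Forall_forall => x Hx.
  have [Hx1 _] := proj1 (List.Forall_forall _ _) (List.Forall_inv_tail H) x Hx.
  have Hx2 := proj1 (List.Forall_forall _ _) Hl x Hx.
  have : fst x * m <= fst x * eta by apply: Rmult_le_compat_l.
  lra.
Qed.

Lemma strip_le (L L' : R) (s0 s : C) : L <= L' -> strip L s0 s -> strip L' s0 s.
Proof. rewrite /strip; lra. Qed.

(* [G] is the second component of the conjugacy: in the coordinates [c] of the
   two charts it reads [h], for every determination [s] of [log x]. *)
Definition fiber_conj (lambda : R) (A : R -> R -> Prop) (s0 : C) (etac1 : R) (Cf1 : C2 -> C)
    (eta2 etac2 : R) (Yf2 : C2 -> C) (h : C -> C) (d : R) (eta M : R) (G : C2 -> C) : Prop :=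
  0 < eta <= 1 /\ 0 <= M /\ forall p, box A eta p ->
  hol G p /\ Cmod (G p) <= M * Cmod (Y p) /\
  forall s : C, strip (PI + 1) s0 s -> Cexp s = X p ->
    chart_dom (2 * PI + 1) A s0 etac1 (s, Y p) /\ Cmod (Cf1 (s, Y p)) < d /\
    leaf_dom lambda (2 * PI + 1) A s0 eta2 (s, h (Cf1 (s, Y p))) /\
    G p = Yf2 (s, h (Cf1 (s, Y p))) /\ chart_dom (2 * PI + 1) A s0 etac2 (s, G p).

Section HalfConjugacy.
Context (lambda : R) (A : R -> R -> Prop) (r : R) (s0 : C) (f1 f2 : C2 -> C)
  (eta1 etac1 K1 : R) (Yf1 Cf1 : C2 -> C) (eta2 etac2 K2 : R) (Yf2 Cf2 : C2 -> C)
  (HC1 : leaf_chart lambda (2 * PI + 1) A s0 f1 eta1 etac1 K1 Yf1 Cf1)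
  (HC2 : leaf_chart lambda (2 * PI + 1) A s0 f2 eta2 etac2 K2 Yf2 Cf2)
  (Ht1 : tame A r s0 f1) (Ht2 : tame A r s0 f2)
  (h : C -> C) (d Kh : R) (Hd : 0 < d) (HKh : 1 <= Kh)
  (Hh : forall c : C, Cmod c < d -> hol (E := C_NormedModule) h c /\ Cmod (h c) <= Kh * Cmod c /\
     h (Cf1 ((s0 + tau)%C, c)) = Cf2 ((s0 + tau)%C, h c)).

Let gval (s y : C) : C := Yf2 (s, h (Cf1 (s, y))).

(** One direction only: exchanging the foliations and inverting [h] gives the other. The holonomies
    enter solely through the relation between [h] and the maps [Cf1 (s0 + tau, .)] and
    [Cf2 (s0 + tau, .)], which makes the construction single-valued over [x <> 0]. *)
Lemma half_conjugacy :
  exists eta M G, fiber_conj lambda A s0 etac1 Cf1 eta2 etac2 Yf2 h d eta M G.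
Proof.
have HPI := PI_RGT_0.
have HA0 : forall rho del, A rho del -> 0 < del by move=> rho del /Ht1 [_ [? _]]; lra.
have HA1 : forall rho del, A rho del -> del <= 1 by move=> rho del /Ht1 [_ [? _]]; lra.
have He1 := lc_eta _ _ _ _ _ _ _ _ _ _ HC1; have Hec1 := lc_etac _ _ _ _ _ _ _ _ _ _ HC1.
have HK1 := lc_K _ _ _ _ _ _ _ _ _ _ HC1.
have He2 := lc_eta _ _ _ _ _ _ _ _ _ _ HC2; have Hec2 := lc_etac _ _ _ _ _ _ _ _ _ _ HC2.
have HK2 := lc_K _ _ _ _ _ _ _ _ _ _ HC2.
have HP1 : 0 < Kh * K1 by nra.
have HP2 : 0 < K2 * (Kh * K1) by apply: Rmult_lt_0_compat; lra.
have HP3 : 0 < K2 * (K2 * (Kh * K1)) by apply: Rmult_lt_0_compat; lra.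
have HP4 : 0 < K2 * (K2 * (K2 * (Kh * K1))) by apply: Rmult_lt_0_compat; lra.
have HP0 : 0 < K1 * K1 by nra.
(* Passing through a chart multiplies sizes by [K1] or [K2], and [h] multiplies them by [Kh]. The
   last two conditions allow [chart_period] at the image point in the second chart. *)
have [eta [Heta Hsmall]] := small_parameter
  (cons (1, 1) (cons (1, etac1) (cons (K1, eta1) (cons (K1 * K1, etac1) (cons (K1, d) (cons (Kh * K1, eta2)
  (cons (K2 * (Kh * K1), etac2) (cons (K2 * (K2 * (Kh * K1)), eta2) (cons (K2 * (K2 * (K2 * (Kh * K1))), etac2) nil)))))))))
  ltac:(repeat constructor; simpl; lra).
have {Hsmall} [S1 [S2 [S3 [S4 [S5 [S6 [S7 [S8 S9]]]]]]]] :
  eta < 1 /\ eta < etac1 /\ K1 * eta < eta1 /\ K1 * (K1 * eta) < etac1 /\ K1 * eta < d /\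
  Kh * K1 * eta < eta2 /\ K2 * (Kh * K1 * eta) < etac2 /\ K2 * (K2 * (Kh * K1 * eta)) < eta2 /\
  K2 * (K2 * (K2 * (Kh * K1 * eta))) < etac2.
  do 9 (move/(fun H => conj (List.Forall_inv H) (List.Forall_inv_tail H)): Hsmall => [/= ? Hsmall]).
  repeat split; nra.
have HKe : 0 < Kh * K1 * eta by apply: Rmult_lt_0_compat.
have key : forall p (s : C), box A eta p -> strip (PI + 1) s0 s -> Cexp s = X p ->
    chart_dom (2 * PI + 1) A s0 eta (s, Y p) /\
    chart_dom (2 * PI + 1) A s0 etac1 (s, Y p) /\ Cmod (Cf1 (s, Y p)) < d /\
    leaf_dom lambda (2 * PI + 1) A s0 eta2 (s, h (Cf1 (s, Y p))) /\
    chart_dom (2 * PI + 1) A s0 (K2 * (Kh * K1 * eta)) (s, gval s (Y p)) /\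
    Cmod (gval s (Y p)) <= K2 * (Kh * K1) * Cmod (Y p).
  move=> p s Hp Hs Es.
  have Hs' : strip (2 * PI + 1) s0 s by apply: strip_le Hs; lra.
  have D1 := box_chart_dom _ _ _ _ _ _ Hp Es Hs'.
  have [D2 D3] := leaf_dom_of_chart _ _ _ _ _ _ _ _ _ _ eta _ HC1 (Rlt_le _ _ S2) Heta HA0 D1.
  have [_ [_ [_ [B1 B2]]]] := lc_Cf _ _ _ _ _ _ _ _ _ _ HC1 _ D2.
  change (Cmod (Cf1 (s, Y p)) <= K1 * Cmod (Y p)) in B1.
  change (Cmod (Cf1 (s, Y p) * lin lambda s0 s) <= K1 * Cmod (Y p)) in B2.
  have [rho [del [HAA [H1 H2]]]] := Hp.
  have Hd0 := HA0 _ _ HAA; have Hd1 := HA1 _ _ HAA.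
  have HY0 := Cmod_ge_0 (Y p).
  have B3 : Cmod (Cf1 (s, Y p)) < d.
    have : K1 * Cmod (Y p) <= K1 * eta by apply: Rmult_le_compat_l; nra.
    lra.
  have [_ [B4 _]] := Hh _ B3.
  set c2 := h (Cf1 (s, Y p)) in B4 *.
  have B5 : Cmod c2 <= Kh * K1 * Cmod (Y p).
    by apply: Rle_trans B4 _; rewrite Rmult_assoc; apply: Rmult_le_compat_l; lra.
  have B6 : Cmod (c2 * lin lambda s0 s) <= Kh * K1 * Cmod (Y p).
    rewrite Cmod_mult; rewrite Cmod_mult in B2.
    have L0 := Cmod_ge_0 (lin lambda s0 s).
    apply: Rle_trans (_ : Kh * Cmod (Cf1 (s, Y p)) * Cmod (lin lambda s0 s) <= _).
      exact: Rmult_le_compat_r.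
    by rewrite !Rmult_assoc; apply: Rmult_le_compat_l; lra.
  have B7 : Kh * K1 * Cmod (Y p) < Kh * K1 * eta * del.
    by rewrite (Rmult_assoc _ eta); apply: Rmult_lt_compat_l.
  have D4 : leaf_dom lambda (2 * PI + 1) A s0 (Kh * K1 * eta) (s, c2).
    split=> //; exists rho, del; split=> //; split; first by rewrite [X _]/= Es.
    change (Cmod c2 < Kh * K1 * eta * del /\ Cmod (c2 * lin lambda s0 s) < Kh * K1 * eta * del); lra.
  have [D5 D6] := chart_of_leaf_dom _ _ _ _ _ _ _ _ _ _ (Kh * K1 * eta) s c2 HC2 (Rlt_le _ _ S6) HKe HA0 D4.
  split=> //; split=> //; split=> //; split=> //; split=> //.
  have [_ [B8 _]] := lc_Yf _ _ _ _ _ _ _ _ _ _ HC2 _ D5.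
  apply: Rle_trans B8 _; rewrite Rmult_assoc; apply: Rmult_le_compat_l; first lra.
  exact: B6.
(* Adding [tau] applies the holonomy of the first foliation to the leaf constant, [h] turns it into
   that of the second, and the period of the second chart absorbs it. *)
have period : forall p (s : C), box A eta p -> strip (PI + 1) s0 s -> strip (PI + 1) s0 (s + tau)%C -> Cexp s = X p ->
    gval (s + tau)%C (Y p) = gval s (Y p).
  move=> p s Hp Hs Hst Es.
  have [D0 [D1 [B1 [D2 [D3 _]]]]] := key p s Hp Hs Es.
  have Hst' : strip (2 * PI + 1) s0 (s + tau)%C by apply: strip_le Hst; lra.
  have P1 := chart_period lambda _ A r s0 f1 _ _ _ _ _ eta s (Y p) HC1 Ht1 Heta (Rlt_le _ _ S3) (Rlt_le _ _ S4) ltac:(lra) Hst' D0.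
  have [_ [_ P2]] := Hh _ B1.
  have D4 : chart_dom (2 * PI + 1) A s0 etac2 (s, gval s (Y p)).
    have [Hs1 [rho [del [HAA [H1 H2]]]]] := D3.
    split=> //; exists rho, del; split=> //; split=> //.
    have := HA0 _ _ HAA => Hdel.
    have : K2 * (Kh * K1 * eta) * del <= etac2 * del by apply: Rmult_le_compat_r; lra.
    lra.
  have P3 := chart_leaf _ _ _ _ _ _ _ _ _ _ s _ HC2 D2 D4.
  have P4 := chart_period lambda _ A r s0 f2 _ _ _ _ _ (K2 * (Kh * K1 * eta)) s (gval s (Y p)) HC2 Ht2
    ltac:(apply: Rmult_lt_0_compat; lra) (Rlt_le _ _ S8) (Rlt_le _ _ S9) ltac:(lra) Hst' D3.
  rewrite {1}/gval P1 P2 -P3 -/(gval s (Y p)) -P4.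
  have D5 := chart_dom_tau _ _ _ _ _ _ Hst' D4.
  by have [_ [_ [E _]]] := lc_Cf _ _ _ _ _ _ _ _ _ _ HC2 _ D5.
have welldef : forall p (s s' : C), box A eta p -> strip (PI + 1) s0 s -> strip (PI + 1) s0 s' ->
    Cexp s = X p -> Cexp s' = X p -> gval s' (Y p) = gval s (Y p).
  move=> p s s' Hp Hs Hs' Es Es'.
  have [E|[E|E]] := Cexp_inj_strip s0 s s' Hs Hs' (eq_trans Es (eq_sym Es')).
  - by rewrite E.
  - by rewrite E; apply: period => //; rewrite -E.
  - by rewrite E; symmetry; apply: period => //; rewrite -E.
(* An arbitrary, possibly discontinuous choice of logarithms is enough, since [gval] does not depend
   on it. *)
have [sl Hsl] := choice_on (RtoC 0) (fun x : C => x <> RtoC 0)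
  (fun x s => Cexp s = x /\ Rabs (snd s - snd s0) <= PI) (fun x Hx => Cexp_surj s0 x Hx).
have Hsl' : forall x : C, x <> RtoC 0 -> Cexp (sl x) = x /\ strip (PI + 1) s0 (sl x).
  by move=> x /Hsl [E1 E2]; split=> //; rewrite /strip; lra.
pose g (p : C2) := gval (sl (X p)) (Y p).
have gE : forall p (s : C), box A eta p -> strip (PI + 1) s0 s -> Cexp s = X p -> g p = gval s (Y p).
  move=> p s Hp Hs Es.
  have Hx : X p <> RtoC 0 by rewrite -Es; exact: Cexp_neq_0.
  have [E1 E2] := Hsl' _ Hx.
  exact: welldef.
have gbound : forall p, box A eta p -> X p <> RtoC 0 -> Cmod (g p) <= K2 * (Kh * K1) * Cmod (Y p).
  move=> p Hp Hx; have [E1 E2] := Hsl' _ Hx.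
  by have [_ [_ [_ [_ [_ B]]]]] := key p _ Hp E2 E1.
have ghol : forall p, box A eta p -> X p <> RtoC 0 -> hol (E := C2) g p.
  move=> p Hp Hx.
  have [E1 E2] := Hsl _ Hx.
  set s1 := sl (X p) in E1 E2.
  have Hd1 : Cexp s1 <> RtoC 0 by exact: Cexp_neq_0.
  have Hce : forall z : C, Cmod (z - s1) < 1 / 2 -> hol (E := C_NormedModule) Cexp z.
    by move=> z _; apply: (hol_Cexp (E := C_NormedModule) (fun z => z)); exact: hol_id.
  (* A holomorphic logarithm near [X p] with values within [1 / 2] of [s1], hence inside the strip
     of half width [PI + 1]. *)
  have [lg [eps [del [Heps [Hdel [Hlg _]]]]]] := local_inverse Cexp s1 (Cexp s1) (1 / 2) ltac:(lra) Hce (cderiv_Cexp s1) Hd1.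
  rewrite E1 in Hlg.
  have Hlgs : forall x : C, Cmod (x - X p) < eps -> strip (PI + 1) s0 (lg x).
    move=> x Hx1; have [_ [B _]] := Hlg x Hx1.
    have := Rabs_snd_le_Cmod (lg x - s1)%C.
    have := Rabs_triang (snd (lg x - s1)%C) (snd s1 - snd s0).
    have -> : snd (lg x - s1)%C + (snd s1 - snd s0) = snd (lg x) - snd s0 by simpl; ring.
    rewrite /strip; lra.
  have Hpp : Cmod (X p - X p) < eps by rewrite Cminus_diag Cmod_0.
  apply: (hol_ext_loc (fun q : C2 => gval (lg (X q)) (Y q))).
    have L1 : locally p (fun q : C2 => Cmod (X q - X p) < eps).
      by apply: (locally_polydisc p eps).
    apply: filter_imp (filter_and _ _ L1 (box_open A eta p Hp)) => q [Q1 Q2].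
    by rewrite (gE q (lg (X q))) //; [exact: Hlgs|exact: (proj2 (proj2 (Hlg _ Q1)))].
  have [Hl1 [_ Hl2]] := Hlg _ Hpp.
  have [_ [D1 [B1 [D2 _]]]] := key p (lg (X p)) Hp (Hlgs _ Hpp) Hl2.
  have Hlx : hol (E := C2) (fun q => lg (X q)) p by apply: hol_comp => //; exact: hol_fst.
  apply: (hol_pair_comp Yf2) => //; last exact: hol_Yf HC2 D2.
  apply: hol_comp; last exact: (proj1 (Hh _ B1)).
  apply: (hol_pair_comp Cf1) => //; first exact: hol_snd.
  by have [Hcf _] := lc_Cf _ _ _ _ _ _ _ _ _ _ HC1 _ D1.
pose M := K2 * (Kh * K1).
have HM : 0 < M by exact: HP2.
have HYM : forall q, box A eta q -> Cmod (Y q) <= 1.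
  move=> q [rho [del [HAA [_ H2]]]].
  have := HA0 _ _ HAA; have := HA1 _ _ HAA; nra.
have [G HG] := removable_fst (box A eta) g (box_open A eta) ghol (fun p Hp => ex_intro _ M
  (filter_imp _ _ (fun q Hq Hx => Rle_trans _ _ _ (gbound q Hq Hx)
     (Rle_trans _ _ _ (Rmult_le_compat_l M _ _ (Rlt_le _ _ HM) (HYM q Hq)) (Req_le _ _ (Rmult_1_r M)))) (box_open A eta p Hp))).
exists eta, M, G; split; first lra; split; first lra.
move=> p Hp; have [HG1 HG2] := HG p Hp; split=> //; split.
  have := le_by_density G (fun q => RtoC M * Y q)%C p HG1.
  rewrite Cmod_mult Cmod_R Rabs_pos_eq; last lra.
  apply.
    by apply: hol_mult; [exact: hol_const|exact: hol_snd].
  apply: filter_imp (box_open A eta p Hp) => q Hq Hx.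
  rewrite Cmod_mult Cmod_R Rabs_pos_eq; last lra.
  rewrite (proj2 (HG q Hq) Hx); exact: gbound.
move=> s Hs Es.
have [D0 [D1 [B1 [D2 [D3 _]]]]] := key p s Hp Hs Es.
have Hx : X p <> RtoC 0 by rewrite -Es; exact: Cexp_neq_0.
have EG : G p = Yf2 (s, h (Cf1 (s, Y p))) by rewrite (HG2 Hx) (gE p s Hp Hs Es).
split=> //; split=> //; split=> //; split=> //.
rewrite EG; have [Hs1 [rho [del [HAA [H1 H2]]]]] := D3.
split=> //; exists rho, del; split=> //; split=> //.
have Hdel := HA0 _ _ HAA.
apply: Rlt_le_trans H2 _; apply: Rmult_le_compat_r; lra.
Qed.
End HalfConjugacy.

Section Conjugacy.
Context (lambda : R) (A : R -> R -> Prop) (r : R) (s0 : C) (f1 f2 : C2 -> C)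
  (eta1 etac1 K1 : R) (Yf1 Cf1 : C2 -> C) (eta2 etac2 K2 : R) (Yf2 Cf2 : C2 -> C)
  (HC1 : leaf_chart lambda (2 * PI + 1) A s0 f1 eta1 etac1 K1 Yf1 Cf1)
  (HC2 : leaf_chart lambda (2 * PI + 1) A s0 f2 eta2 etac2 K2 Yf2 Cf2)
  (Ht1 : tame A r s0 f1) (Ht2 : tame A r s0 f2)
  (h : C -> C) (d eta M : R) (G : C2 -> C)
  (HG : fiber_conj lambda A s0 etac1 Cf1 eta2 etac2 Yf2 h d eta M G).

Lemma exists_log (x : C) : x <> RtoC 0 -> exists s, Cexp s = x /\ strip (PI + 1) s0 s.
Proof.
by move=> /(Cexp_surj s0) [s [E H]]; exists s; split=> //; rewrite /strip; lra.
Qed.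

(** On the leaf of constant [c] of the first foliation, [G] takes the values of the leaf [h c] of
    the second. Equating the two derivatives in [s] says that [(X, G)] maps leaf directions to leaf
    directions. *)
Lemma fiber_conj_pde (p : C2) : box A eta p -> X p <> RtoC 0 ->
  exists l, filterdiff (U := C2) (V := C_NormedModule) G (locally p) l /\
    l (X p, ((RtoC lambda + f1 p) * Y p)%C) = ((RtoC lambda + f2 (X p, G p)) * G p)%C.
Proof.
move=> Hp Hx.
have [_ [_ Hspec]] := HG.
have [[l Hl] [_ Hs]] := Hspec p Hp.
have [s [Es Hss]] := exists_log _ Hx.
have [D1 [B1 [D2 [EG _]]]] := Hs s Hss Es.
exists l; split=> //.
have [_ [Dl [EY _]]] := lc_Cf _ _ _ _ _ _ _ _ _ _ HC1 _ D1.
set c := Cf1 (s, Y p) in B1 D2 EG Dl EY *.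
change (leaf_dom lambda (2 * PI + 1) A s0 eta1 (s, c)) in Dl.
change (Yf1 (s, c) = Y p) in EY.
pose F (q : C2) := G (Cexp (X q), Y q).
have Ep : p = (Cexp s, Yf1 (s, c)) by rewrite EY Es; case: (p).
have Hexp : filterdiff (U := C2) (V := C_NormedModule) (fun q => Cexp (X q)) (locally ((s, Yf1 (s, c)) : C2)) (fun v => (Cexp s * X v)%C).
  exact: (filterdiff_comp' (U := C2) (V := C_NormedModule) (fun q : C2 => X q) Cexp (s, Yf1 (s, c)) _ _ (filterdiff_fst _) (cderiv_Cexp s)).
have Hl' := Hl; rewrite Ep in Hl'.
have HFd := filterdiff_comp' (U := C2) (V := C2) _ G ((s, Yf1 (s, c)) : C2) _ _
  (filterdiff_pair _ _ _ _ _ Hexp (filterdiff_snd _)) Hl'.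
have HFd' : filterdiff (U := C2) (V := C_NormedModule) F (locally (((s + RtoC 0)%C, Yf1 (s, c)) : C2))
   (fun v => l ((Cexp s * X v)%C, Y v)) by rewrite Cplus_0_r; exact: HFd.
have HD1 := filterdiff_along_leaf _ _ _ _ f1 _ _ _ _ _ s c (RtoC 0) F _ HC1 Dl HFd'.
have HD2 := filterdiff_along_leaf _ _ _ _ f2 _ _ _ _ _ s (h c) (RtoC 0) (fun q => Y q) _ HC2 D2 (filterdiff_snd _).
rewrite [X (_, _)]/= [Y (_, _)]/= Cmult_1_r in HD1.
rewrite [Y (_, _)]/= in HD2.
have E : l (Cexp s, ((RtoC lambda + f1 (Cexp s, Yf1 (s, c))) * Yf1 (s, c))%C) =
    ((RtoC lambda + f2 (Cexp s, Yf2 (s, h c))) * Yf2 (s, h c))%C.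
  apply: cderiv_unique HD1 _.
  apply: filterdiff_ext_locally HD2.
  have L1 := leaf_dom_vertical _ _ _ _ _ _ _ Dl.
  have Hid : hol (E := C_NormedModule) (fun z => z) s by exact: hol_id.
  have HYhol : hol (E := C_NormedModule) (fun z => Yf1 (z, c)) s.
    apply: (hol_pair_comp (E := C_NormedModule) Yf1 (fun z => z) (fun _ => c)) => //; first exact: hol_const.
    exact: hol_Yf HC1 Dl.
  have L2 : locally (T := C_NormedModule) s (fun z => box A eta (Cexp z, Yf1 (z, c))).
    apply: (locally_pair_C (fun z => Cexp z) (fun z => Yf1 (z, c))) => //.
      exact: (hol_Cexp (E := C_NormedModule) (fun z => z)).
    by apply: box_open; rewrite -Ep.
  have L3 : locally (T := C_NormedModule) s (fun z => strip (PI + 1) s0 (X ((z, c) : C2))).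
    apply: (locally_pair_C (fun z => z) (fun _ => c) s (fun q => strip (PI + 1) s0 (X q))) => //; first exact: hol_const.
    exact: strip_open.
  apply: filter_imp (filter_and _ _ L1 (filter_and _ _ L2 L3)) => z [Z1 [Z2 Z3]].
  have [_ [_ Hz]] := Hspec _ Z2.
  have [D1z [_ [_ [EGz _]]]] := Hz z Z3 eq_refl.
  rewrite [Y (_, _)]/= in D1z EGz.
  by rewrite /F [X (_, _)]/= [Y (_, _)]/= Cplus_0_r EGz (chart_leaf _ _ _ _ _ _ _ _ _ _ z c HC1 Z1 D1z).
move: E; rewrite -EG -Es EY => <-.
by rewrite Ep EY.
Qed.

(** Both foliations have the same [lambda], hence the same linear flow, which cancels between the
    two charts: the slope of [G] in [y] at 0 is [h0] for every [x <> 0]. The constant of the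
    quadratic remainder does not depend on [x], so the bound passes to [x = 0]. *)
Lemma fiber_conj_tangent (h0 : C) (Kh : R) (p : C2) :
  (forall c : C, Cmod c < d -> Cmod (h c) <= Kh * Cmod c) ->
  cderiv h (RtoC 0) h0 -> box A eta p -> Y p = RtoC 0 ->
  exists B, 0 <= B /\ locally p (fun q : C2 => Cmod (G q - h0 * Y q) <= B * (Cmod (Y q) * Cmod (Y q))).
Proof.
move=> HKh Hh0 Hp HY0.
have [Heta [HM Hspec]] := HG.
have [rho [del [HA [H1 H2]]]] := Hp.
have [_ [Hdel _]] := Ht1 rho del HA.
set S := eta * del.
have HS : 0 < S by apply: Rmult_lt_0_compat; lra.
have HS1 : S <= 1 by rewrite /S; nra.
set B := 128 * M / (S * S).
have HB : 0 <= B by apply: Rdiv_le_0_compat; nra.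
exists B; split=> //.
have Hbox : forall x y : C, Cmod x < rho -> Cmod y < S -> box A eta (x, y).
  by move=> x y Hx Hy; exists rho, del.
have HG0 : forall x : C, Cmod x < rho -> G (x, RtoC 0) = RtoC 0.
  move=> x Hx; have [_ [B1 _]] := Hspec _ (Hbox x (RtoC 0) Hx ltac:(rewrite Cmod_0; lra)).
  apply: Cmod_eq_0; apply: Rle_antisym; last exact: Cmod_ge_0.
  by apply: Rle_trans B1 _; rewrite [Y _]/= Cmod_0; lra.
have main : forall x y : C, Cmod x < rho -> x <> RtoC 0 -> Cmod y < S / 4 ->
    Cmod (G (x, y) - h0 * y) <= B * (Cmod y * Cmod y).
  move=> x y Hx Hx0 Hy.
  pose phi (y : C) := G (x, y).
  have Hon : hol_on (E := C_NormedModule) phi (RtoC 0) S M.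
    move=> w Hw0; have {}Hw0 : Cmod (w - RtoC 0) < S := Hw0.
    rewrite Cminus_0_r in Hw0.
    have [G1 [G2 _]] := Hspec _ (Hbox x w Hx Hw0); split.
    - by apply: (hol_pair_comp (E := C_NormedModule) G (fun _ => x) (fun y => y)) => //; [exact: hol_const|exact: hol_id].
    - apply: Rle_trans G2 _; rewrite -{2}(Rmult_1_r M); apply: Rmult_le_compat_l => //; rewrite [Y _]/=; lra.
  have Hphi : cderiv phi (RtoC 0) h0.
    have [s [Es Hs]] := exists_log x Hx0.
    have Hall : forall w : C, Cmod w < S ->
        chart_dom (2 * PI + 1) A s0 etac1 (s, w) /\ Cmod (Cf1 (s, w)) < d /\
        leaf_dom lambda (2 * PI + 1) A s0 eta2 (s, h (Cf1 (s, w))) /\ phi w = Yf2 (s, h (Cf1 (s, w))).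
      move=> w Hw; have [_ [_ Hw']] := Hspec _ (Hbox x w Hx Hw).
      by have [D1 [D2 [D3 [D4 _]]]] := Hw' s Hs Es.
    have H0S : Cmod (RtoC 0) < S by rewrite Cmod_0.
    have [D1 [D2 [D3 D4]]] := Hall _ H0S.
    have [Hcf [Dl [_ [B1 _]]]] := lc_Cf _ _ _ _ _ _ _ _ _ _ HC1 _ D1.
    have EC0 : Cf1 (s, RtoC 0) = RtoC 0.
      apply: Cmod_eq_0; apply: Rle_antisym; last exact: Cmod_ge_0.
      by apply: Rle_trans B1 _; rewrite [Y _]/= Cmod_0; lra.
    have Eh0 : h (RtoC 0) = RtoC 0.
      rewrite EC0 in D2.
      apply: Cmod_eq_0; apply: Rle_antisym; last exact: Cmod_ge_0.
      by apply: Rle_trans (HKh _ D2) _; rewrite Cmod_0; lra.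
    rewrite EC0 Eh0 in D3.
    change (leaf_dom lambda (2 * PI + 1) A s0 eta1 (s, Cf1 (s, RtoC 0))) in Dl.
    rewrite EC0 in Dl.
    have HlinY1 := lc_lin _ _ _ _ _ _ _ _ _ _ HC1 s Dl.
    have HlinY2 := lc_lin _ _ _ _ _ _ _ _ _ _ HC2 s D3.
    have [m Hm] : exists m, cderiv (fun y => Cf1 (s, y)) (RtoC 0) m.
      apply/hol_cderiv; apply: (hol_pair_comp (E := C_NormedModule) Cf1 (fun _ => s) (fun y => y)) => //; [exact: hol_const|exact: hol_id].
    have chain : forall (a b : C -> C) (la lb : C), cderiv a (RtoC 0) la -> a (RtoC 0) = RtoC 0 -> cderiv b (RtoC 0) lb ->
        cderiv (fun y => b (a y)) (RtoC 0) (lb * la)%C.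
      move=> a b la lb Ha Ea Hb.
      rewrite -Ea in Hb.
      have HH := filterdiff_comp' (U := C_NormedModule) (V := C_NormedModule) a b (RtoC 0) _ _ Ha Hb.
      by apply: (filterdiff_ext_lin _ _ _ HH) => v; cring.
    have HLS : locally (T := C_NormedModule) (RtoC 0) (fun w : C => Cmod w < S).
      apply/locally_nball; exists S; split=> // w Hw; have {}Hw : Cmod (w - RtoC 0) < S := Hw.
      by rewrite Cminus_0_r in Hw.
    (* [Yf1 (s, .)] undoes [Cf1 (s, .)], so the slope [m] of the latter at 0 is inverse to [lin]. *)
    have Em : (lin lambda s0 s * m)%C = RtoC 1.
      apply: (cderiv_unique (fun y => y) (RtoC 0)); last first.
        apply/cderiv_eps => eps He; exists 1; split; first lra.
        move=> v _; have -> : (RtoC 0 + v - RtoC 0 - RtoC 1 * v = RtoC 0)%C by ring.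
        by rewrite Cmod_0; have := Cmod_ge_0 v; nra.
      apply: filterdiff_ext_locally (chain _ _ _ _ Hm EC0 HlinY1).
      apply: filter_imp HLS => w Hw.
      have [Dw _] := Hall w Hw.
      by have [_ [_ [EYw _]]] := lc_Cf _ _ _ _ _ _ _ _ _ _ HC1 _ Dw; exact: EYw.
    have Ea2 : (fun y => h (Cf1 (s, y))) (RtoC 0) = RtoC 0 by rewrite EC0.
    have Hcomp := chain _ _ _ _ (chain _ _ _ _ Hm EC0 Hh0) Ea2 HlinY2.
    have Elin : (lin lambda s0 s * (h0 * m) = h0)%C.
      have -> : (lin lambda s0 s * (h0 * m) = h0 * (lin lambda s0 s * m))%C by ring.
      by rewrite Em; ring.
    rewrite Elin in Hcomp.
    apply: filterdiff_ext_locally Hcomp.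
    by apply: filter_imp HLS => w Hw; have [_ [_ [_ E]]] := Hall w Hw; rewrite E.
  have := second_order_remainder (E := C_NormedModule) phi (RtoC 0) y _ S M HS Hon Hphi Hy.
  have -> : plus (RtoC 0) y = y by change ((RtoC 0 + y)%C = y); ring.
  rewrite /phi HG0 // Cminus_0_r.
  by [].
apply: (filter_imp (fun q : C2 => Cmod (X q) < rho /\ Cmod (Y q) < S / 4)); last first.
  apply: (filter_and (F := locally p)).
  - by apply: (open_hol_lt (E := C2) (fun q => X q)) => // q; exact: hol_fst.
  - apply: (open_hol_lt (E := C2) (fun q => Y q)) => [q|]; first exact: hol_snd.
    rewrite HY0 Cmod_0; lra.
move=> q [Q1 Q2].
have := le_by_density (fun q => G q - h0 * Y q)%C (fun q => RtoC B * (Y q * Y q))%C q.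
rewrite !Cmod_mult Cmod_R Rabs_pos_eq // => HH; apply: HH.
- apply: hol_minus.
    have [Hg _] := Hspec (X q, Y q) (Hbox (X q) (Y q) Q1 ltac:(lra)).
    by move: Hg; case: (q).
  by apply: hol_mult; [exact: hol_const|exact: hol_snd].
- by apply: hol_mult; [exact: hol_const|apply: hol_mult; exact: hol_snd].
- have L1 : locally q (fun w : C2 => Cmod (X w) < rho).
    by apply: (open_hol_lt (E := C2) (fun q => X q)) => // w; exact: hol_fst.
  have L2 : locally q (fun w : C2 => Cmod (Y w) < S / 4).
    by apply: (open_hol_lt (E := C2) (fun q => Y q)) => // w; exact: hol_snd.
  apply: filter_imp (filter_and _ _ L1 L2) => w [W1 W2] Wx.
  rewrite !Cmod_mult Cmod_R Rabs_pos_eq //.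
  by have := main (X w) (Y w) W1 Wx W2; case: (w).
Qed.

(** In the charts [G] followed by [G'] reads [h'] after [h], the identity on [|c| < d'']; smallness
    of [eta0] keeps the leaf constant there, and density gives [x = 0]. *)
Lemma fiber_conj_inverse (h' : C -> C) (d' d'' eta' M' : R) (G' : C2 -> C) (eta0 : R) (p : C2) :
  fiber_conj lambda A s0 etac2 Cf2 eta1 etac1 Yf1 h' d' eta' M' G' ->
  (forall c : C, Cmod c < d'' -> h' (h c) = c) ->
  0 < eta0 <= eta -> M * eta0 < eta' -> K1 * eta0 < d'' ->
  box A eta0 p -> G' (X p, G p) = Y p.
Proof.
move=> HG' Hinv He0 He1 He2.
have [_ [HM Hspec]] := HG; have [_ [_ Hspec']] := HG'.
have HA0 : forall rho del, A rho del -> 0 < del <= 1 by move=> rho del /Ht1 [_ [? _]]; lra.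
have Hbox : forall q, box A eta0 q -> box A eta q /\ box A eta' (X q, G q).
  move=> q Hq; have Hq' : box A eta q.
    by apply: (box_le A eta0) => // [rho del /HA0|]; lra.
  split=> //.
  have [_ [B1 _]] := Hspec q Hq'.
  have [rho [del [HAA [H1 H2]]]] := Hq; exists rho, del; split=> //; split=> //.
  have Hdel := HA0 _ _ HAA.
  apply: Rle_lt_trans B1 _.
  have : M * Cmod (Y q) <= M * (eta0 * del) by apply: Rmult_le_compat_l; lra.
  have : M * eta0 * del < eta' * del by apply: Rmult_lt_compat_r; lra.
  lra.
have HK1 := lc_K _ _ _ _ _ _ _ _ _ _ HC1.
have main : forall q, box A eta0 q -> X q <> RtoC 0 -> G' (X q, G q) = Y q.
  move=> q Hq Hx; have [Hq1 Hq2] := Hbox q Hq.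
  have [s [Es Hs]] := exists_log _ Hx.
  have [_ [_ S1]] := Hspec q Hq1.
  have [D1 [_ [D2 [EG D3]]]] := S1 s Hs Es.
  have [_ [_ S2]] := Hspec' _ Hq2.
  have [_ [_ [_ [EG' _]]]] := S2 s Hs Es.
  rewrite EG' [Y (_, _)]/= EG (chart_leaf _ _ _ _ _ _ _ _ _ _ s _ HC2 D2); last by rewrite -EG.
  have [_ [_ [EY [B1 _]]]] := lc_Cf _ _ _ _ _ _ _ _ _ _ HC1 _ D1.
  rewrite Hinv; first exact: EY.
  apply: Rle_lt_trans B1 _; rewrite [Y _]/=.
  have [rho [del [HAA [_ H2]]]] := Hq.
  have Hdel := HA0 _ _ HAA.
  have : K1 * Cmod (Y q) <= K1 * eta0 by apply: Rmult_le_compat_l; nra.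
  lra.
move=> Hp.
have -> : G' (X p, G p) = (G' (X p, G p) - Y p + Y p)%C by ring.
have -> : (G' (X p, G p) - Y p)%C = RtoC 0; last by ring.
apply: Cmod_eq_0; apply: Rle_antisym; last exact: Cmod_ge_0.
rewrite -Cmod_0.
apply: (le_by_density (fun q => G' (X q, G q) - Y q)%C (fun _ => RtoC 0)).
- apply: hol_minus; last exact: hol_snd.
  have [Hp1 Hp2] := Hbox p Hp.
  apply: hol_pair_comp; first exact: hol_fst.
    by have [? _] := Hspec p Hp1.
  by have [? _] := Hspec' _ Hp2.
- exact: hol_const.
- apply: filter_imp (box_open A eta0 p Hp) => q Hq Hx.
  rewrite main // Cminus_diag; lra.
Qed.

End Conjugacy.

(** * The conjugacy on the transversal *)

Lemma tube_around_disc (r rho : R) (P : C2 -> Prop) :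
  (forall x : C, Cmod x < r -> locally ((x, RtoC 0) : C2) P) -> 0 < rho < r ->
  exists del, 0 < del <= 1 /\ forall x y : C, Cmod x < rho -> Cmod y < del -> P (x, y).
Proof.
move=> HP Hrho.
have Hex : forall uv : R * R, True -> exists d, 0 < d /\ forall x y : C,
    Rabs (fst x - fst uv) < d -> Rabs (snd x - snd uv) < d -> Cmod x <= rho -> Cmod y < d -> P (x, y).
  move=> uv _; case: (Rle_lt_dec (Cmod uv) rho) => Huv.
  - have [d [Hd H]] := open_polydisc _ _ (HP uv ltac:(lra)).
    exists (d / 2); split; first lra.
    move=> x y H1 H2 _ Hy; apply: H.
    + apply: Rle_lt_trans (Cmod_le_abs (fst (x - uv)%C) (snd (x - uv)%C)) _.
      have -> : fst (x - uv)%C = fst x - fst uv by [].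
      have -> : snd (x - uv)%C = snd x - snd uv by [].
      lra.
    + by rewrite /= Cminus_0_r; lra.
  (* For a centre outside the closed disc, the square of this half side misses [|x| <= rho], so the
     claim is vacuous there; compactness can then be used on a square containing the disc. *)
  - exists ((Cmod uv - rho) / 2); split; first lra.
    move=> x y H1 H2 Hx _; exfalso.
    have := Cmod_le_abs (fst (x - uv)%C) (snd (x - uv)%C).
    have -> : fst (x - uv)%C = fst x - fst uv by [].
    have -> : snd (x - uv)%C = snd x - snd uv by [].
    have := Cmod_triangle_inv uv x; rewrite Cmod_sub_rev => T1 T2.
    have T3 : (x - uv)%C = (fst x - fst uv, snd x - snd uv) by [].
    rewrite T3 in T1; lra.
have [F HF] := choice_on 1 (fun _ => True) _ Hex.
pose del (u v : R) := mkposreal (F (u, v)) (proj1 (HF (u, v) I)).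
have [d Hd] := compactness_value_2d (- rho) rho (- rho) rho del.
exists (Rmin 1 d); split.
  by split; [apply: Rmin_pos; [lra|exact: cond_pos]|exact: Rmin_l].
move=> x y Hx Hy.
have X1 := Rle_lt_trans _ _ _ (Rabs_fst_le_Cmod x) Hx; have X2 := Rle_lt_trans _ _ _ (Rabs_snd_le_Cmod x) Hx.
have [X3 X4] := Rabs_def2 _ _ X1; have [X5 X6] := Rabs_def2 _ _ X2.
apply: NNPP => Hno; apply: (Hd (fst x) (snd x)); try lra.
move=> [u [v [_ [_ [H1 [H2 H3]]]]]]; apply: Hno.
apply: (proj2 (HF (u, v) I)) => //; first lra.
have := Rmin_r 1 d; simpl in H3; lra.
Qed.

Definition near0 (P : C -> Prop) : Prop := locally (T := C_NormedModule) (RtoC 0) P.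

Lemma near0_comp (k : C -> C) (P : C -> Prop) :
  hol (E := C_NormedModule) k (RtoC 0) -> k (RtoC 0) = RtoC 0 -> near0 P -> near0 (fun z => P (k z)).
Proof.
move=> Hk Hk0 HP; have := filterdiff_continuous _ _ Hk; apply.
by rewrite Hk0.
Qed.

Lemma near0_ball (P : C -> Prop) : near0 P <-> exists d, 0 < d /\ forall z : C, Cmod z < d -> P z.
Proof.
split.
- move=> /locally_nball [d [Hd H]]; exists d; split=> // z Hz; apply: H.
  by change (Cmod (z - RtoC 0) < d); rewrite Cminus_0_r.
- move=> [d [Hd H]]; apply/locally_nball; exists d; split=> // z Hz; apply: H.
  by have {}Hz : Cmod (z - RtoC 0) < d := Hz; rewrite Cminus_0_r in Hz.
Qed.

Lemma near0_and (P Q : C -> Prop) : near0 P -> near0 Q -> near0 (fun z => P z /\ Q z).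
Proof. exact: filter_and. Qed.

Lemma near0_at (P : C -> Prop) : near0 P -> P (RtoC 0).
Proof. by move=> H; exact: (locally_singleton _ _ H). Qed.

Lemma germ_inverse (k : C -> C) (b : C) :
  near0 (hol (E := C_NormedModule) k) -> k (RtoC 0) = RtoC 0 -> cderiv k (RtoC 0) b -> b <> RtoC 0 ->
  exists k', near0 (hol (E := C_NormedModule) k') /\ k' (RtoC 0) = RtoC 0 /\
    near0 (fun z => k (k' z) = z) /\ near0 (fun z => k' (k z) = z).
Proof.
move=> Hk Hk0 Hb Hb0.
have [r [Hr Hkr]] := proj1 (near0_ball _) Hk.
have Hkr' : forall z : C, Cmod (z - 0) < r -> hol (E := C_NormedModule) k z.
  by move=> z; rewrite Cminus_0_r; exact: Hkr.
have [g [eps [del [He [Hd [H1 H2]]]]]] := local_inverse k (RtoC 0) b r Hr Hkr' Hb Hb0.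
rewrite Hk0 in H1 H2.
have H2' : near0 (fun z => g (k z) = z).
  have L1 := near0_comp k (fun w => Cmod (w - 0) < eps) (near0_at _ Hk) Hk0 
    (proj2 (near0_ball _) (ex_intro _ eps (conj He (fun z Hz => eq_ind_r (fun w => Cmod w < eps) Hz (Cminus_0_r z))))).
  have L2 : near0 (fun z => Cmod z < del) by apply/near0_ball; exists del; split=> //; lra.
  apply: filter_imp (near0_and _ _ L1 L2) => z [Z1 Z2].
  by apply: H2 => //; rewrite Cminus_0_r.
exists g; split; last split; last split.
- by apply/near0_ball; exists eps; split=> // z Hz; apply: (fun h => proj1 (H1 z h)); rewrite Cminus_0_r.
- by have := near0_at _ H2'; rewrite Hk0.
- by apply/near0_ball; exists eps; split=> // z Hz; apply: (fun h => proj2 (proj2 (H1 z h))); rewrite Cminus_0_r.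
- exact: H2'.
Qed.

Lemma germ_linear_bound (h : C -> C) :
  near0 (hol (E := C_NormedModule) h) -> h (RtoC 0) = RtoC 0 ->
  exists K, 1 <= K /\ near0 (fun c => Cmod (h c) <= K * Cmod c).
Proof.
move=> Hh H0.
have [r [Hr Hhr]] := proj1 (locally_nball _ _) Hh.
have [s [M [Hs [HM Hon]]]] := hol_bounded_near (E := C_NormedModule) h (RtoC 0) r Hr Hhr.
have HK : 0 <= 8 * M / s by apply: Rdiv_le_0_compat; lra.
exists (8 * M / s + 1); split; first lra.
apply/locally_nball; exists (s / 2); split; first lra.
move=> c Hc.
have := lipschitz_half_ball (E := C_NormedModule) h (RtoC 0) (RtoC 0) c s M ltac:(lra) Hon (nball_center (E := C_NormedModule) (RtoC 0) (s / 2) ltac:(lra)) Hc.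
rewrite H0 Cminus_0_r.
have -> : norm (minus c (RtoC 0)) = Cmod c by change (Cmod (c - RtoC 0) = Cmod c); rewrite Cminus_0_r.
have := Cmod_ge_0 c; nra.
Qed.

Definition germ (k : C -> C) : Prop := near0 (hol (E := C_NormedModule) k) /\ k (RtoC 0) = RtoC 0.

Lemma germ_comp (k k' : C -> C) : germ k -> germ k' -> germ (fun z => k (k' z)).
Proof.
move=> [H1 E1] [H2 E2]; split; last by rewrite E2.
have L := near0_comp k' _ (near0_at _ H2) E2 H1.
apply: filter_imp (near0_and _ _ H2 L) => z [Z1 Z2].
exact: hol_comp.
Qed.

Lemma near0_germ (k : C -> C) (P : C -> Prop) : germ k -> near0 P -> near0 (fun z => P (k z)).
Proof. by move=> [H E]; apply: near0_comp => //; exact: near0_at H. Qed.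

(* [chi_i] are the first integrals on the transversal, [mu_i] the holonomies of
   the leaves: [h = chi2^-1 psi chi1] conjugates [mu1] to [mu2]. *)
Lemma conjugacy_germ (chi1 chi2 xi2 phi1 phi2 psi psi' mu1 mu2 : C -> C) :
  germ chi1 -> germ chi2 -> germ xi2 -> germ phi1 -> germ psi -> germ mu1 -> germ mu2 ->
  near0 (fun z => chi2 (xi2 z) = z) -> near0 (fun z => xi2 (chi2 z) = z) ->
  near0 (fun z => psi' (psi z) = z) ->
  near0 (fun z => phi1 (chi1 z) = chi1 (mu1 z)) -> near0 (fun z => phi2 (chi2 z) = chi2 (mu2 z)) ->
  near0 (fun z => phi2 z = psi (phi1 (psi' z))) ->
  near0 (fun z => xi2 (psi (chi1 (mu1 z))) = mu2 (xi2 (psi (chi1 z)))).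
Proof.
move=> Gc1 Gc2 Gx Gp1 Gpsi Gm1 Gm2 I1 I2 I3 R1 R2 Cj.
have Gpc := germ_comp _ _ Gpsi Gc1.
have Gh := germ_comp _ _ Gx Gpc.
have L1 := near0_germ _ _ (germ_comp _ _ Gm2 Gh) I2.
have L2 := near0_germ _ _ Gh R2.
have L3 := near0_germ _ _ Gpc I1.
have L4 := near0_germ _ _ Gpc Cj.
have L5 := near0_germ _ _ Gc1 I3.
apply: filter_imp (near0_and _ _ R1 (near0_and _ _ L1 (near0_and _ _ L2 (near0_and _ _ L3 (near0_and _ _ L4 L5)))))
  => z [E1 [E2 [E3 [E4 [E5 E6]]]]].
by rewrite -E2 -E3 E4 E5 E6 E1.
Qed.

Lemma cderiv_vertical (F : C2 -> C) (x y : C) l :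
  filterdiff (U := C2) (V := C_NormedModule) F (locally ((x, y) : C2)) l -> cderiv (fun y => F (x, y)) y (l e2).
Proof.
move=> Hl.
have H1 := filterdiff_pair (E := C_NormedModule) (fun _ => x) (fun y => y) y _ _
  (filterdiff_const_C (E := C_NormedModule) x y) (filterdiff_id _).
have H2 := filterdiff_comp' (U := C_NormedModule) (V := C2) _ F y _ _ H1 Hl.
apply: (filterdiff_ext_lin _ _ _ H2) => v.
change (l (RtoC 0, v) = (l e2 * v)%C).
rewrite (linear_C2 l (RtoC 0, v) (proj1 Hl)) /=; cring.
Qed.

Lemma Cmult_eq_0_l (a x : C) : (a * x = RtoC 0)%C -> x <> RtoC 0 -> a = RtoC 0.
Proof.
move=> E Hx; have -> : a = (a * x / x)%C by field.
by rewrite E /Cdiv Cmult_0_l.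
Qed.

(** At [(x0, 0)] the form is [x0 dy], so [dH] is a multiple of [dy], nonzero because [dH] is: [H]
    restricts to a coordinate on the transversal [x = x0]. *)
Lemma transversal (lambda : R) (f : C2 -> C) (x0 : C) (H : C2 -> C) :
  x0 <> RtoC 0 -> minimal_first_integral (omega lambda f) (base_point x0) H ->
  germ (fun y => H (x0, y)) /\ exists b, b <> RtoC 0 /\ cderiv (fun y => H (x0, y)) (RtoC 0) b /\
    exists l, filterdiff (U := C2) (V := C_NormedModule) H (locally (base_point x0)) l /\
      forall v : C2, l v = (b * Y v)%C.
Proof.
move=> Hx [H0 [[l [Hl [v0 Hv0]]] HI]]; split.
  split; last exact: H0.
  have [d [Hd HB]] := open_polydisc _ _ HI.
  apply/near0_ball; exists d; split=> // y Hy.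
  have [l' [Hl' _]] := HB (x0, y) ltac:(rewrite /= Cminus_diag Cmod_0; lra) ltac:(rewrite /= Cminus_0_r; lra).
  by apply/hol_cderiv; eexists; exact: cderiv_vertical Hl'.
have [l' [Hl' Hw]] := locally_singleton _ _ HI.
have Ll := linear_C2 l _ (proj1 Hl).
have E1 : l e1 = RtoC 0.
  rewrite (filterdiff_locally_unique (E := C2) H (base_point x0) e1 l l' Hl Hl').
  have := Hw e1 e2; rewrite /wedge /omega /base_point /= => E.
  set a := l' (RtoC 1, RtoC 0) in E *.
  have {}E : (a * x0 = RtoC 0)%C by rewrite -E; ring.
  exact: Cmult_eq_0_l E Hx.
have Lv : forall v : C2, l v = (l e2 * Y v)%C.
  by move=> v; rewrite (Ll v) E1; cring.
exists (l e2); split.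
  by move=> E; apply: Hv0; rewrite Lv E Cmult_0_l.
split; first exact: cderiv_vertical Hl.
by exists l.
Qed.

Lemma germ_derivative_neq_0 (h h' : C -> C) (h0 : C) :
  germ h -> germ h' -> cderiv h (RtoC 0) h0 -> near0 (fun z => h' (h z) = z) -> h0 <> RtoC 0.
Proof.
move=> [_ E] [Hh' _] Hh0 Hinv Ez.
have [k Hk] := proj1 (hol_cderiv h' (RtoC 0)) (near0_at _ Hh').
rewrite -E in Hk.
have HH := filterdiff_comp' (U := C_NormedModule) (V := C_NormedModule) h h' (RtoC 0) _ _ Hh0 Hk.
have HI := filterdiff_ext_locally _ _ _ _ Hinv HH.
have := filterdiff_locally_unique (E := C_NormedModule) _ _ (RtoC 1) _ _ HI (filterdiff_id _).
rewrite Ez Cmult_0_l Cmult_0_r => /RtoC_inj; lra.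
Qed.

Lemma chart_holonomy_germ lambda A r s0 f eta etac K Yf Cf :
  leaf_chart lambda (2 * PI + 1) A s0 f eta etac K Yf Cf -> tame A r s0 f ->
  (exists rho del, A rho del) -> germ (fun y => Cf ((s0 + tau)%C, y)).
Proof.
move=> HC Ht [rho [del HA]].
have [[Hr _] [Hd _]] := Ht rho del HA.
have Hec := lc_etac _ _ _ _ _ _ _ _ _ _ HC.
have Hdom : forall y : C, Cmod y < etac * del -> chart_dom (2 * PI + 1) A s0 etac ((s0 + tau)%C, y).
  move=> y Hy; split.
    rewrite /strip /tau /=; have HPI := PI_RGT_0.
    have -> : snd s0 + 2 * PI - snd s0 = 2 * PI by ring.
    by rewrite Rabs_pos_eq; lra.
  exists rho, del; split=> //; split=> //.
  by change (Cmod (Cexp (s0 + tau)) < rho); rewrite Cexp_tau.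
have Hpos : 0 < etac * del by apply: Rmult_lt_0_compat; lra.
split.
- apply/near0_ball; exists (etac * del); split=> // y Hy.
  apply: (hol_pair_comp (E := C_NormedModule) Cf (fun _ => (s0 + tau)%C) (fun y => y)).
  + exact: hol_const.
  + exact: hol_id.
  + exact: (proj1 (lc_Cf _ _ _ _ _ _ _ _ _ _ HC _ (Hdom y Hy))).
- have [_ [_ [_ [B _]]]] := lc_Cf _ _ _ _ _ _ _ _ _ _ HC _ (Hdom (RtoC 0) ltac:(rewrite Cmod_0; lra)).
  apply: Cmod_eq_0; apply: Rle_antisym; last exact: Cmod_ge_0.
  by apply: Rle_trans B _; rewrite [Y _]/= Cmod_0; lra.
Qed.

(** * Assembly of the diffeomorphism from the two half conjugacies *)

Theorem theorem3p1
  (lambda r : R) (Hlambda : lambda < 0) (Hr : 0 < r)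
  (f1 f2 : C2 -> C_NormedModule) (U1 U2 : C2 -> Prop)
  (HU1 : open U1) (HU2 : open U2)
  (HD1 : forall p, Delta r p -> U1 p) (HD2 : forall p, Delta r p -> U2 p)
  (Hf1 : holomorphic U1 f1) (Hf2 : holomorphic U2 f2)
  (Hf1_0 : forall p, Delta r p -> f1 p = RtoC 0)
  (Hf2_0 : forall p, Delta r p -> f2 p = RtoC 0)
  (x0 : C) (Hx0 : 0 < Cmod x0 < r)
  (H1 H2 : C2 -> C_NormedModule)
  (phi1 phi2 psi : C_NormedModule -> C_NormedModule)
  (Hhol1 : holonomy (omega lambda f1) x0 H1 phi1)
  (Hhol2 : holonomy (omega lambda f2) x0 H2 phi2)
  (Hconj : conjugate_by psi phi1 phi2) :
  exists (V1 V2 : C2 -> Prop) (Phi : C2 -> C2) (c : C),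
    (forall p, Delta r p -> V1 p) /\ (forall p, Delta r p -> V2 p) /\
    (forall p, V1 p -> U1 p) /\ (forall p, V2 p -> U2 p) /\
    analytic_diffeo V1 V2 Phi /\
    fibered_form r V1 Phi c /\
    pullback_wedge_zero V1 Phi (omega lambda f2) (omega lambda f1) /\
    (* c d(H2) = d(psi o H1) at the base point: c = 1 when the conjugacy is
       tangent to the identity *)
    c <> RtoC 0 /\
    (forall l1 l2 : C2 -> C_NormedModule,
       filterdiff (fun q : C2 => psi (H1 q)) (locally (base_point x0)) l1 ->
       filterdiff H2 (locally (base_point x0)) l2 ->
       forall v : C2, l1 v = (c * l2 v)%C).
Proof.
have Hx00 : x0 <> RtoC 0 by apply/Cmod_gt_0; lra.
have [s0 [Es0 _]] := Cexp_surj (RtoC 0) x0 Hx00.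
subst x0.
have HPI := PI_RGT_0.
pose good (p : C2) := U1 p /\ U2 p /\ Cmod (f1 p) <= 1 /\ Cmod (f2 p) <= 1.
have Hgood : forall x : C, Cmod x < r -> locally ((x, RtoC 0) : C2) good.
  move=> x Hx.
  have HDx : Delta r (x, RtoC 0) by [].
  have bound : forall (f : C2 -> C), hol (E := C2) f (x, RtoC 0) -> f (x, RtoC 0) = RtoC 0 ->
      locally ((x, RtoC 0) : C2) (fun q => Cmod (f q) <= 1).
    move=> f Hf Hf0; have [d [Hd H]] := hol_continuous f _ Hf 1 ltac:(lra).
    apply/locally_nball; exists d; split=> // q /H; rewrite Hf0 Cminus_0_r; lra.
  have B1 := bound f1 (Hf1 _ (HD1 _ HDx)) (Hf1_0 _ HDx).
  have B2 := bound f2 (Hf2 _ (HD2 _ HDx)) (Hf2_0 _ HDx).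
  have O1 := HU1 _ (HD1 _ HDx); have O2 := HU2 _ (HD2 _ HDx).
  by apply: filter_imp (filter_and _ _ (filter_and _ _ O1 O2) (filter_and _ _ B1 B2)) => q [[? ?] [? ?]].
(* [rho < r] is strict and [del] depends on [rho], because the domains may thin out towards the
   boundary of the disc; [rho] exceeds [|x0|] so that every box contains the base point. *)
pose A rho del := Cmod (Cexp s0) < rho < r /\ 0 < del <= 1 /\
  forall x y : C, Cmod x < rho -> Cmod y < del -> good (x, y).
have HAcov : forall x : C, Cmod x < r -> exists rho del, A rho del /\ Cmod x < rho.
  move=> x Hx.
  set rho := (Rmax (Cmod x) (Cmod (Cexp s0)) + r) / 2.
  have M1 : Cmod x <= Rmax (Cmod x) (Cmod (Cexp s0)) by exact: Rmax_l.
  have M2 : Cmod (Cexp s0) <= Rmax (Cmod x) (Cmod (Cexp s0)) by exact: Rmax_r.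
  have M3 : Rmax (Cmod x) (Cmod (Cexp s0)) < r by apply: Rmax_lub_lt; lra.
  have [del [Hdel H]] := tube_around_disc r rho good Hgood ltac:(rewrite /rho; lra).
  exists rho, del; split; last by rewrite /rho; lra.
  by split; [rewrite /rho; lra|split].
have HAne : exists rho del, A rho del.
  by have [rho [del [HA _]]] := HAcov (Cexp s0) ltac:(lra); exists rho, del.
have Ht1 : tame A r s0 f1.
  move=> rho del [HA1 [HA2 HA3]]; split; first lra; split=> // x y Hx Hy.
  have [G1 [_ [G3 _]]] := HA3 x y Hx Hy; split; first exact: Hf1; split=> //.
  by apply: Hf1_0; split=> //=; lra.
have Ht2 : tame A r s0 f2.
  move=> rho del [HA1 [HA2 HA3]]; split; first lra; split=> // x y Hx Hy.
  have [_ [G2 [_ G4]]] := HA3 x y Hx Hy; split; first exact: Hf2; split=> //.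
  by apply: Hf2_0; split=> //=; lra.
have [eta1 [etac1 [K1 [Yf1 [Cf1 HC1]]]]] := leaf_chart_exists lambda (2 * PI + 1) A r s0 f1 Hlambda ltac:(lra) Hr Ht1.
have [eta2 [etac2 [K2 [Yf2 [Cf2 HC2]]]]] := leaf_chart_exists lambda (2 * PI + 1) A r s0 f2 Hlambda ltac:(lra) Hr Ht2.
have [HI1 [[_ [Gphi1 _]] Hmon1]] := Hhol1.
have [HI2 [[_ [Gphi2 _]] Hmon2]] := Hhol2.
have R1 := holonomy_chart lambda _ A r s0 f1 _ _ _ _ _ HC1 Ht1 HAne ltac:(lra) H1 phi1 HI1 Hmon1.
have R2 := holonomy_chart lambda _ A r s0 f2 _ _ _ _ _ HC2 Ht2 HAne ltac:(lra) H2 phi2 HI2 Hmon2.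
have [Gchi1 [b1 [Hb1 [Db1 [d1 [Hd1 Ed1]]]]]] := transversal lambda f1 (Cexp s0) H1 Hx00 HI1.
have [Gchi2 [b2 [Hb2 [Db2 [d2 [Hd2 Ed2]]]]]] := transversal lambda f2 (Cexp s0) H2 Hx00 HI2.
set chi1 := fun y : C => H1 (Cexp s0, y) in Gchi1 Db1.
set chi2 := fun y : C => H2 (Cexp s0, y) in Gchi2 Db2.
have [xi1 [Hxi1 [Exi1 [I11 I12]]]] := germ_inverse chi1 b1 (proj1 Gchi1) (proj2 Gchi1) Db1 Hb1.
have [xi2 [Hxi2 [Exi2 [I21 I22]]]] := germ_inverse chi2 b2 (proj1 Gchi2) (proj2 Gchi2) Db2 Hb2.
have Gxi1 : germ xi1 by split.
have Gxi2 : germ xi2 by split.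
have [psi' [[[Epsi Hpsi] [[Epsi' Hpsi'] [Ipsi Ipsi']]] Hcj]] := Hconj.
have Gpsi : germ psi by split.
have Gpsi' : germ psi' by split.
have Gp1 : germ phi1 by case: Gphi1.
have Gp2 : germ phi2 by case: Gphi2.
have Gm1 := chart_holonomy_germ lambda A r s0 f1 _ _ _ _ _ HC1 Ht1 HAne.
have Gm2 := chart_holonomy_germ lambda A r s0 f2 _ _ _ _ _ HC2 Ht2 HAne.
(* The conjugacy is inverted as a germ, so that the construction can be run with the foliations
   exchanged. *)
have Hcj' : near0 (fun z => phi1 z = psi' (phi2 (psi z))).
  have L1 := near0_germ _ _ Gpsi Hcj.
  have L2 := near0_germ _ _ Gp1 Ipsi.
  apply: filter_imp (near0_and _ _ L1 (near0_and _ _ L2 Ipsi)) => z [-> [E2 E3]].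
  by rewrite E3 E2.
have J1 := conjugacy_germ chi1 chi2 xi2 phi1 phi2 psi psi' _ _ Gchi1 Gchi2 Gxi2 Gp1 Gpsi Gm1 Gm2 I21 I22 Ipsi R1 R2 Hcj.
have J2 := conjugacy_germ chi2 chi1 xi1 phi2 phi1 psi' psi _ _ Gchi2 Gchi1 Gxi1 Gp2 Gpsi' Gm2 Gm1 I11 I12 Ipsi' R2 R1 Hcj'.
pose h (z : C) : C := xi2 (psi (chi1 z)).
pose h' (z : C) : C := xi1 (psi' (chi2 z)).
have Gh : germ h by apply: (germ_comp xi2) => //; exact: (germ_comp psi).
have Gh' : germ h' by apply: (germ_comp xi1) => //; exact: (germ_comp psi').
have Gpc : germ (fun z => psi (chi1 z)) by exact: (germ_comp psi).
have Gpc' : germ (fun z => psi' (chi2 z)) by exact: (germ_comp psi').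
have Inv1 : near0 (fun z => h' (h z) = z).
  apply: filter_imp (near0_and _ _ (near0_germ _ _ Gpc I21) (near0_and _ _ (near0_germ _ _ Gchi1 Ipsi) I12)) => z [E1 [E2 E3]].
  by rewrite /h' /h E1 E2 E3.
have Inv2 : near0 (fun z => h (h' z) = z).
  apply: filter_imp (near0_and _ _ (near0_germ _ _ Gpc' I11) (near0_and _ _ (near0_germ _ _ Gchi2 Ipsi') I22)) => z [E1 [E2 E3]].
  by rewrite /h' /h E1 E2 E3.
have [k1 [Hk1 Lk1]] := germ_linear_bound h (proj1 Gh) (proj2 Gh).
have [k2 [Hk2 Lk2]] := germ_linear_bound h' (proj1 Gh') (proj2 Gh').
have [dd1 [Hdd1 D1]] := proj1 (near0_ball _) (near0_and _ _ (proj1 Gh) (near0_and _ _ Lk1 (near0_and _ _ J1 Inv1))).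
have [dd2 [Hdd2 D2]] := proj1 (near0_ball _) (near0_and _ _ (proj1 Gh') (near0_and _ _ Lk2 (near0_and _ _ J2 Inv2))).
have [eta12 [M12 [G12 HG12]]] := half_conjugacy lambda A r s0 f1 f2 _ _ _ _ _ _ _ _ _ _ HC1 HC2 Ht1 Ht2 h dd1 k1 Hdd1 Hk1
  (fun c Hc => let '(conj a (conj b (conj e _))) := D1 c Hc in conj a (conj b e)).
have [eta21 [M21 [G21 HG21]]] := half_conjugacy lambda A r s0 f2 f1 _ _ _ _ _ _ _ _ _ _ HC2 HC1 Ht2 Ht1 h' dd2 k2 Hdd2 Hk2
  (fun c Hc => let '(conj a (conj b (conj e _))) := D2 c Hc in conj a (conj b e)).
have [He12 [HM12 S12]] := HG12; have [He21 [HM21 S21]] := HG21.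
have HK1 := lc_K _ _ _ _ _ _ _ _ _ _ HC1; have HK2 := lc_K _ _ _ _ _ _ _ _ _ _ HC2.
(* On [box A eta0] each of [G12] and [G21] takes values where the other is defined, and the leaf
   constants stay where [h] and [h'] invert each other. *)
have [eta0 [Heta0 Hsmall]] := small_parameter
  (cons (1, eta12) (cons (1, eta21) (cons (M12, eta21) (cons (M21, eta12) (cons (K1, dd1) (cons (K2, dd2) nil))))))
  ltac:(repeat (apply: List.Forall_cons; [simpl; lra|]); exact: List.Forall_nil).
have {Hsmall} [Q1 [Q2 [Q3 [Q4 [Q5 Q6]]]]] : eta0 < eta12 /\ eta0 < eta21 /\ M12 * eta0 < eta21 /\
    M21 * eta0 < eta12 /\ K1 * eta0 < dd1 /\ K2 * eta0 < dd2.
  do 6 (move/(fun H => conj (List.Forall_inv H) (List.Forall_inv_tail H)): Hsmall => [/= ? Hsmall]).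
  repeat split; lra.
(* [Phi] must send its domain into [box A eta0], where the identities with [Psi] hold, hence a
   second, smaller parameter. *)
have [eta3 [Heta3 Hsmall]] := small_parameter (cons (1, eta0) (cons (M12, eta0) nil)) ltac:(repeat (apply: List.Forall_cons; [simpl; lra|]); exact: List.Forall_nil).
have {Hsmall} [Q7 Q8] : eta3 < eta0 /\ M12 * eta3 < eta0.
  do 2 (move/(fun H => conj (List.Forall_inv H) (List.Forall_inv_tail H)): Hsmall => [/= ? Hsmall]).
  split; lra.
have HA0 : forall rho del, A rho del -> 0 < del by move=> rho del [_ [? _]]; lra.
have inv1 : forall p, box A eta0 p -> G21 (X p, G12 p) = Y p.
  move=> p Hp; apply: (fiber_conj_inverse lambda A r s0 f1 f2 _ _ _ _ _ _ _ _ _ _ HC1 HC2 Ht1 h dd1 eta12 M12 G12 HG12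
    h' dd2 dd1 eta21 M21 G21 eta0 p HG21) => //; last lra.
  by move=> c /D1 [_ [_ [_ ?]]].
have inv2 : forall p, box A eta0 p -> G12 (X p, G21 p) = Y p.
  move=> p Hp; apply: (fiber_conj_inverse lambda A r s0 f2 f1 _ _ _ _ _ _ _ _ _ _ HC2 HC1 Ht2 h' dd2 eta21 M21 G21 HG21
    h dd1 dd2 eta12 M12 G12 eta0 p HG12) => //; last lra.
  by move=> c /D2 [_ [_ [_ ?]]].
have sub12 : forall p, box A eta0 p -> box A eta12 p by move=> p; apply: box_le => //; lra.
have sub21 : forall p, box A eta0 p -> box A eta21 p by move=> p; apply: box_le => //; lra.
have sub30 : forall p, box A eta3 p -> box A eta0 p by move=> p; apply: box_le => //; lra.
have boxgood : forall p, box A eta0 p -> good p.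
  move=> p [rho [del [HA [B1 B2]]]].
  have [_ [Hdel Hg]] := HA.
  have := Hg (X p) (Y p) B1 ltac:(nra); by case: (p).
have Dbox : forall eta p, 0 < eta -> Delta r p -> box A eta p.
  move=> eta p He [Hp1 Hp2]; have [rho [del [HA HX]]] := HAcov _ Hp1.
  exists rho, del; split=> //; split=> //; rewrite Hp2 Cmod_0.
  by apply: Rmult_lt_0_compat => //; exact: HA0 HA.
pose Phi (p : C2) : C2 := (X p, G12 p).
pose Psi (q : C2) : C2 := (X q, G21 q).
have Phihol : forall p, box A eta12 p -> exists l, filterdiff (U := C2) (V := C_NormedModule) G12 (locally p) l /\
    filterdiff (U := C2) (V := C2) Phi (locally p) (fun v => (X v, l v)).
  move=> p /S12 [[l Hl] _]; exists l; split=> //.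
  exact: filterdiff_pair (filterdiff_fst p) Hl.
have Psihol : forall p, box A eta21 p -> exists l, filterdiff (U := C2) (V := C2) Psi (locally p) l.
  move=> p /S21 [[l Hl] _]; eexists.
  exact: filterdiff_pair (filterdiff_fst p) Hl.
have PhiB : forall p, box A eta3 p -> box A eta0 (Phi p).
  move=> p Hp; have [rho [del [HA [B1 B2]]]] := Hp; exists rho, del; split=> //; split=> //.
  have [_ [B3 _]] := S12 p (sub12 _ (sub30 _ Hp)).
  have Hdel := HA0 _ _ HA.
  apply: Rle_lt_trans B3 _.
  have : M12 * Cmod (Y p) <= M12 * (eta3 * del) by apply: Rmult_le_compat_l; lra.
  have : M12 * eta3 * del < eta0 * del by apply: Rmult_lt_compat_r.
  lra.
have PsiPhi : forall p, box A eta0 p -> Psi (Phi p) = p.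
  by move=> p Hp; rewrite /Psi /Phi [X (_, _)]/= inv1 //; case: (p).
have PhiPsi : forall q, box A eta0 q -> Phi (Psi q) = q.
  by move=> q Hq; rewrite /Psi /Phi [X (_, _)]/= inv2 //; case: (q).
have [h0 Hh0] := proj1 (hol_cderiv h (RtoC 0)) (near0_at _ (proj1 Gh)).
(* The target is the part of [box A eta0] that [Psi] sends into the source: this makes [Phi] onto it
   without a description of the image. *)
exists (box A eta3), (fun q => box A eta0 q /\ box A eta3 (Psi q)), Phi, h0.
split; first by move=> p; exact: Dbox.
split.
  move=> p Hp; have Hb := Dbox eta0 p Heta0 Hp; split=> //.
  have E : Psi p = p.
    have [_ [B _]] := S21 p (sub21 p Hb).
    have [_ Hp2] := Hp.
    rewrite Hp2 Cmod_0 Rmult_0_r in B.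
    rewrite /Psi (Cmod_eq_0 (G21 p)); last by apply: Rle_antisym => //; exact: Cmod_ge_0.
    by rewrite -Hp2; case: (p).
  by rewrite E; exact: Dbox.
split; first by move=> p /sub30 /boxgood [].
split; first by move=> p [/boxgood [_ [? _]] _].
split.
  split; first exact: box_open.
  split.
    move=> q [Hq1 Hq2].
    have [l Hl] := Psihol q (sub21 q Hq1).
    have L1 := box_open A eta0 q Hq1.
    have L2 : locally q (fun q => box A eta3 (Psi q)).
      by apply: (filterdiff_continuous Psi q (ex_intro _ l Hl)); exact: box_open.
    exact: filter_and.
  split.
    move=> p Hp; split; first exact: PhiB.
    by rewrite PsiPhi //; exact: sub30.
  split.
    move=> p Hp; have [l [_ Hl]] := Phihol p (sub12 _ (sub30 _ Hp)); eexists; exact: Hl.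
  exists Psi; split; first by move=> q [].
  split; first by move=> q [Hq _]; apply: Psihol; exact: sub21.
  split; first by move=> p Hp; apply: PsiPhi; exact: sub30.
  by move=> q [Hq _]; exact: PhiPsi.
split.
  split; first by [].
  move=> p Hp eps.
  have [B [HB Htan]] := fiber_conj_tangent lambda A r s0 f1 f2 _ _ _ _ _ _ _ _ _ _ HC1 HC2 Ht1 h dd1 eta12 M12 G12 HG12 h0 k1 p
    (fun c Hc => proj1 (proj2 (D1 c Hc))) Hh0 (Dbox eta12 p ltac:(lra) Hp) (proj2 Hp).
  have He := cond_pos eps.
  have LY : locally p (fun q : C2 => Cmod (Y q) < eps / (B + 1)).
    apply: (open_hol_lt (E := C2) (fun q => Y q)) => [q|]; first exact: hol_snd.
    have -> : Y p = RtoC 0 := proj2 Hp.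
    by rewrite Cmod_0; apply: Rdiv_lt_0_compat; lra.
  apply: filter_imp (filter_and _ _ Htan LY) => q [T1 T2].
  change (Cmod (G12 q - h0 * Y q) <= eps * Cmod (Y q)).
  apply: Rle_trans T1 _.
  have HY := Cmod_ge_0 (Y q).
  rewrite -Rmult_assoc; apply: Rmult_le_compat_r => //.
  have : Cmod (Y q) * (B + 1) <= eps / (B + 1) * (B + 1) by apply: Rmult_le_compat_r; lra.
  have -> : eps / (B + 1) * (B + 1) = eps by field; lra.
  nra.
split.
  move=> p Hp.
  have Hp12 := sub12 _ (sub30 _ Hp).
  (* On [x = 0] both forms are multiples of [dx] and [Phi] preserves [x], so their wedge is zero;
     elsewhere the equation satisfied by [G12] decides. *)
  case: (excluded_middle_informative (X p = RtoC 0)) => Hx.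
    have [l [Hl HPhi]] := Phihol p Hp12.
    exists (fun v => (X v, l v)); split=> // u v.
    rewrite /wedge /omega [X (Phi p)]/= [Y (Phi p)]/= Hx.
    rewrite [X (_, _)]/= [Y (_, _)]/= [X (_, _)]/= [Y (_, _)]/=.
    by rewrite /=; ring.
  have [l [Hl El]] := fiber_conj_pde lambda A s0 f1 f2 _ _ _ _ _ _ _ _ _ _ HC1 HC2 h dd1 eta12 M12 G12 HG12 p Hp12 Hx.
  exists (fun v => (X v, l v)); split; first exact: filterdiff_pair (filterdiff_fst p) Hl.
  move=> u v.
  (* By [El] the pulled back form at [p] is [l e2] times [omega lambda f1 p]. *)
  have Llin := linear_C2 l _ (proj1 Hl).
  rewrite (Llin (X p, _)) [X (_, _)]/= [Y (_, _)]/= in El.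
  rewrite /wedge /omega.
  change (X (Phi p)) with (X p); change (Y (Phi p)) with (G12 p).
  change (f2 (Phi p)) with (f2 (X p, G12 p)).
  rewrite (Llin u) (Llin v) /=.
  rewrite -El; ring.
split; first exact: germ_derivative_neq_0 Gh Gh' Hh0 Inv1.
move=> l1 l2 Hl1 Hl2 v.
have E2 : l2 v = (b2 * Y v)%C.
  by rewrite (filterdiff_locally_unique (E := C2) H2 _ v l2 d2 Hl2 Hd2) Ed2.
have [k Hk] := proj1 (hol_cderiv psi (RtoC 0)) (near0_at _ (proj1 Gpsi)).
have Hbase : H1 (base_point (Cexp s0)) = RtoC 0 by exact: (proj2 Gchi1).
rewrite -Hbase in Hk.
have Hl1' := filterdiff_comp' (U := C2) (V := C_NormedModule) H1 psi (base_point (Cexp s0)) _ _ Hd1 Hk.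
have E1 : forall w, l1 w = (k * d1 w)%C.
  by move=> w; exact: (filterdiff_locally_unique (E := C2) _ _ w _ _ Hl1 Hl1').
have Dl1 := cderiv_vertical _ _ _ _ Hl1.
(* [chi2 (h z) = psi (chi1 z)] near 0, so [b2 * h0] is also the derivative of [psi] after [H1] on
   the transversal. *)
have Hb2h : cderiv (fun z => chi2 (h z)) (RtoC 0) (b2 * h0)%C.
  have Db2' := Db2; rewrite -{1}(proj2 Gh) in Db2'.
  have HH := filterdiff_comp' (U := C_NormedModule) (V := C_NormedModule) h chi2 (RtoC 0) _ _ Hh0 Db2'.
  by apply: (filterdiff_ext_lin _ _ _ HH) => w; cring.
have Eb : l1 e2 = (b2 * h0)%C.
  apply: cderiv_unique Dl1 _.
  apply: filterdiff_ext_locally Hb2h.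
  by apply: filter_imp (near0_germ _ _ Gpc I21) => z E; rewrite /h E.
rewrite E2 (E1 v) Ed1.
rewrite (E1 e2) Ed1 [Y e2]/= in Eb.
have -> : (k * (b1 * Y v) = (k * (b1 * RtoC 1)) * Y v)%C by ring.
rewrite Eb; cring.
Qed.
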